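(* Let $n\ge2$, $1\le k\le n-1$, $\alpha_1,\alpha_2,\beta_1,\beta_2\in\mathbb{R}$, $p\ge\max\{1,1+\alpha_2\}$ with $p>1+\alpha_2$ when $\alpha_2>0$, and $p\le r<\infty$. Consider $$\|R_kf\|_{L^r_{\beta_1,\beta_2}(\Xi_k(\mathbb{S}^n))}\le C\|f\|_{L^p_{\alpha_1,\alpha_2}(\mathbb{S}^n)}\quad\text{for all even radial }f\in L^p_{\alpha_1,\alpha_2}(\mathbb{S}^n).\qquad( * )$$ Let (N) denote the conditions: $\beta_1>k-n$, $\frac{\alpha_1+n}{p}-\frac{\beta_1+n-k}{r}\le k$, and $\frac{\beta_2+k+1}{r}\ge\frac{\alpha_2+1}{p}$, the last inequality being strict if $p=1+\alpha_2$. (A) If $k\ge2$, $( * )$ holds if and only if (N) holds. (B) If $k=1$ and in addition $\frac1p-\frac1r\le\frac12$ when $p>1$, or $r<2$ when $p=1$, then $( * )$ holds if and only if (N) holds.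
   Context: $\mathbb{S}^n\subset\mathbb{R}^{n+1}$ unit sphere with origin $0:=e_{n+1}$, distance $d$, surface measure $dx$. $\Xi_k(\mathbb{S}^n)$: $k$-dimensional totally geodesic submanifolds (intersections with $(k+1)$-dimensional linear subspaces) with $d(0,\xi)<\pi/2$, with invariant measure such that for $\varphi(\xi)=\tilde\varphi(d(0,\xi))$, $\int\varphi\,d\xi=c_{n,k}\int_0^{\pi/2}\tilde\varphi(h)\sin^{n-k-1}h\cos^kh\,dh$. $R_kf(\xi)=\int_\xi f\,d_\xi x$. $\|f\|^p_{L^p_{\alpha_1,\alpha_2}(\mathbb{S}^n)}=\int|f(x)|^p\sin^{\alpha_1}d(0,x)|\cos d(0,x)|^{\alpha_2}dx$, $\|\varphi\|^r_{L^r_{\beta_1,\beta_2}(\Xi_k(\mathbb{S}^n))}=\int|\varphi(\xi)|^r\sin^{\beta_1}d(0,\xi)\cos^{\beta_2}d(0,\xi)d\xi$. Even radial: $f(x)=F(|x_{n+1}|)$. $C$ independent of $f$. *)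

(* Defs.v *)
From HB Require Import structures.
From mathcomp Require Import all_boot all_order all_algebra.
From mathcomp Require Import all_classical all_reals all_analysis.
Set Implicit Arguments. Unset Strict Implicit. Unset Printing Implicit Defensive.
Import Order.TTheory GRing.Theory Num.Theory.
Local Open Scope classical_set_scope.
Local Open Scope ring_scope.

Section RadonDefs.
Variable R : realType.

Definition vnorm m (x : 'rV[R]_m) : R := Num.sqrt (\sum_i x 0 i ^+ 2).
Definition vdot m (x y : 'rV[R]_m) : R := \sum_i x 0 i * y 0 i.

Definition sphdist m (x y : 'rV[R]_m) : R := acos (vdot x y).
Definition origin n : 'rV[R]_(n.+1) := \row_(i < n.+1) (i == ord_max)%:R.

(* Lebesgue integral over R^m of a nonnegative function, as the iterated
   (Tonelli) integral of one-dimensional Lebesgue integrals. *)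
Fixpoint iint m : ('rV[R]_m -> \bar R) -> \bar R :=
  match m return ('rV[R]_m -> \bar R) -> \bar R with
  | 0 => fun g => g 0
  | m'.+1 => fun g =>
      (\int[@lebesgue_measure R]_t
          iint (fun v : 'rV[R]_m' => g (row_mx (\row_(_ < 1) t) v)))%E
  end.

(* Integral of a nonnegative function over the unit sphere S^m of R^(m+1)
   with respect to the surface measure, defined by the cone (polar-coordinates)
   formula:  int_{S^m} g dsigma = (m+1) int_{0<|x|<=1} g(x/|x|) dx. *)
Definition sph_int m (g : 'rV[R]_(m.+1) -> \bar R) : \bar R :=
  ((m.+1)%:R%:E * iint (fun x : 'rV[R]_(m.+1) =>
      if ((0 < vnorm x) && (vnorm x <= 1))%R then g ((vnorm x)^-1 *: x) else 0%E))%E.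

(* A k-dimensional totally geodesic submanifold xi of S^n is the intersection
   of S^n with a (k+1)-dimensional subspace V; we describe V as the row space
   of a full rank matrix G : 'M_(k+1, n+1). *)
Definition gsphere k n (G : 'M[R]_(k.+1, n.+1)) : set 'rV[R]_(n.+1) :=
  [set x | vnorm x = 1 /\ exists t : 'rV[R]_(k.+1), x = t *m G].

Definition dist0 k n (G : 'M[R]_(k.+1, n.+1)) : R :=
  inf [set sphdist (origin n) x | x in gsphere G].

(* Integral of a nonnegative h over xi = gsphere G w.r.t. its own surface
   measure d_xi x: the cone formula on V, where Lebesgue measure on V is the
   image of Lebesgue measure on R^(k+1) under t |-> t G, rescaled by the Gram
   determinant sqrt(det(G G^T)). *)
Definition xi_int k n (G : 'M[R]_(k.+1, n.+1)) (h : 'rV[R]_(n.+1) -> \bar R)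
  : \bar R :=
  ((Num.sqrt (\det (G *m G^T)))%:E * ((k.+1)%:R%:E *
     iint (fun t : 'rV[R]_(k.+1) =>
        if ((0 < vnorm (t *m G)) && (vnorm (t *m G) <= 1))%R
        then h ((vnorm (t *m G))^-1 *: (t *m G)) else 0%E)))%E.

Definition radon k n (f : 'rV[R]_(n.+1) -> R) (G : 'M[R]_(k.+1, n.+1)) : \bar R :=
  (xi_int G (fun x => (Num.max (f x) 0)%:E)
   - xi_int G (fun x => (Num.max (- f x) 0)%:E))%E.

(* Integral over Xi_k(S^n) of a nonnegative phi w.r.t. an O(n+1)-invariant
   measure: the subspace V is the row space of a standard Gaussian random
   (k+1) x (n+1) matrix (whose law is invariant under rotations), restricted
   to d(0, xi) < pi/2.  phi is evaluated on a matrix G representing xi. *)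
Definition Xi_int k n (phi : 'M[R]_(k.+1, n.+1) -> \bar R) : \bar R :=
  iint (fun v : 'rV[R]_(k.+1 * n.+1) =>
    let G := vec_mx v in
    if (\rank G == k.+1)%N && (dist0 G < pi / 2)
    then ((expR (- (\sum_i \sum_j G i j ^+ 2) / 2))%:E * phi G)%E
    else 0%E).

Definition normS n (p a1 a2 : R) (f : 'rV[R]_(n.+1) -> R) : \bar R :=
  (sph_int (fun x : 'rV[R]_(n.+1) =>
     (powR `|f x| p * powR (sin (sphdist (origin n) x)) a1
       * powR `|cos (sphdist (origin n) x)| a2)%:E) `^ p^-1)%E.

Definition normXi k n (r b1 b2 : R) (phi : 'M[R]_(k.+1, n.+1) -> \bar R) : \bar R :=
  (Xi_int (fun G : 'M[R]_(k.+1, n.+1) =>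
     (`|phi G| `^ r * (powR (sin (dist0 G)) b1 * powR (cos (dist0 G)) b2)%:E))
   `^ r^-1)%E.

Definition radon_ineq (k n : nat) (p r a1 a2 b1 b2 : R) : Prop :=
  exists C : R, forall F : R -> R,
    measurable_fun (`[0%R, 1%R] : set R) F ->
    let f := fun x : 'rV[R]_(n.+1) => F `|x 0 ord_max| in
    (normS p a1 a2 f < +oo)%E ->
    (normXi r b1 b2 (radon (k := k) f) <= C%:E * normS p a1 a2 f)%E.

Definition condN (k n : nat) (p r a1 a2 b1 b2 : R) : Prop :=
  [/\ k%:R - n%:R < b1,
      (a1 + n%:R) / p - (b1 + n%:R - k%:R) / r <= k%:R,
      (a2 + 1) / p <= (b2 + k%:R + 1) / r
    & p = 1 + a2 -> (a2 + 1) / p < (b2 + k%:R + 1) / r].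

End RadonDefs.

(* Main.v *)
Require Import Defs.
From HB Require Import structures.
From mathcomp Require Import all_boot all_order all_algebra.
From mathcomp Require Import all_classical all_reals all_analysis.
From mathcomp Require Import measurable_realfun.
From mathcomp Require Import ring lra.
Set Implicit Arguments. Unset Strict Implicit. Unset Printing Implicit Defensive.
Import Order.TTheory GRing.Theory Num.Theory.
Import numFieldNormedType.Exports.
Local Open Scope classical_set_scope.
Local Open Scope ring_scope.
Local Opaque integral.

(* With u = tan^2 d(0,x) and v = tan^2 d(0,xi), polar coordinates turn the norm
   of an even radial f into a weighted L^p norm in du/u, and R_k into
     (1+v)^(1/2) int_v^oo Phi(u) (u-v)^(k/2-1) (1+u)^(-(k+1)/2) du;
   the measure on Xi_k becomes explicit by computing one Gaussian double integral
   twice, rotating either the matrix or the vector.  In the logarithmic variables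
   z = ln u and v, absorbing the weights into the kernel gives
     (1-e^(v-z))^(k/2-1) exp(- b (z-v) + D (z - ln(1+e^z))
        + (b-a) (ln(1+e^z) - ln(1+e^v)) - E ln(1+e^v))   for v < z,
   where b = (b1+n-k)/(2r), a = 1/2 - (a2+1)/(2p), and D >= 0, E >= 0 are the two
   inequalities of (N).  Under (N) the kernel is at most a constant times
   (1 + 1/(z-v))^s e^(-c (z-v)) with s = 1/2 if k = 1 and s = 0 otherwise (if
   p = 1 + a2, hence p = 1, the strict inequality E > 0 gives decay in |v| instead
   for z > 0): the
   bound follows from Schur's test when p = r > 1, from the
   Hardy-Littlewood-Sobolev inequality when 1 < p < r, and from uniform L^r
   bounds of the kernel in v when p = 1.  Indicators of [m, m+1] show that each
   condition of (N) is necessary. *)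

(** * One-dimensional substitutions *)

(** The variable tan^2 is used because cosines multiply in right-angled spherical triangles: if t is
    tan^2 of the distance inside [xi] from its point nearest the origin, then 1 + u = (1 + v)(1 +
    t), so u is affine in t and the kernel is a power of u - v. Sphere areas and similar constants
    are never evaluated: it suffices that they are positive and independent of the functions. The
    restrictions in (B) come from the diagonal, where for k = 1 the kernel is like (z-v)^(-1/2): its
    r-th power is integrable there exactly when r < 2, and it is locally dominated by
    (z-v)^(1/p-1/r-1) exactly when 1/p - 1/r <= 1/2. Away from the diagonal, the rates b and a give
    the decay because ln(1+e^z) - ln(1+e^v) lies between 0 and z - v; when a = 0 nothing decays in z
    - v for v > 0, whence the strict inequality. Jensen's inequality is used in a form that loses a
    factor 2^s, proved by splitting at a level and optimizing the level; the same optimization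
    yields Hardy-Littlewood-Sobolev. *)

Lemma measurable_inv (R : realType) : measurable_fun [set: R] (fun x : R => x^-1).
Proof.
(* Off 0, inversion is up to sign a [powR] with exponent -1, and [powR] is measurable; at 0 the
   convention is 0^-1 = 0. *)
have -> : (fun x : R => x^-1) =
    fun x => if 0 < x then powR x (-1) else if x < 0 then - powR (- x) (-1) else 0.
  apply/funext => x; case: ltgtP => x0.
  - by rewrite powR_inv1 ?ltW.
  - by rewrite powR_inv1 ?invrN ?opprK// oppr_ge0 ltW.
  - by rewrite -x0 invr0.
apply: measurable_fun_ifT.
- exact: measurable_fun_ltr.
- exact: measurable_powR.
- apply: measurable_fun_ifT => //; first exact: measurable_fun_ltr.
  apply: measurable_funN; apply: (measurableT_comp (@measurable_powR _ _)).
  exact: oppr_measurable.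
Qed.

Lemma measurable_fun_EFin d (T : measurableType d) (R : realType) (D : set T)
    (f : T -> R) : measurable_fun D f -> measurable_fun D (fun x => (f x)%:E).
Proof. by move=> mf; exact/measurable_EFinP. Qed.

(** Decomposes a measurability goal by the head symbol of the body; the unguided [apply] calls come
    last, since higher-order unification may choose a useless splitting. Hypotheses are composed
    with only when their function is not a literal abstraction. *)
Ltac mstep := first
  [ exact: measurable_cst | exact: measurable_id | assumption
  | exact: measurable_fst | exact: measurable_snd
  | lazymatch goal with
    | |- measurable_fun _ (fun x => @?b x && @?c x) => apply: measurable_and
    | |- measurable_fun _ (fun x => (@?b x < @?c x)%R) => apply: measurable_fun_ltr
    | |- measurable_fun _ (fun x => (@?b x <= @?c x)%R) => apply: measurable_fun_ler
    | |- measurable_fun _ (fun x => EFin (@?b x)) => apply: measurable_fun_EFin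
    | |- measurable_fun _ (fun x => (@?b x * @?c x)%E) => apply: emeasurable_funM
    | |- measurable_fun _ (fun x => (@?b x + @?c x)%E) => apply: emeasurable_funD
    | |- measurable_fun _ (fun x => (@?b x * @?c x)%R) => apply: measurable_funM
    | |- measurable_fun _ (fun x => (@?b x - @?c x)%R) => apply: measurable_funB
    | |- measurable_fun _ (fun x => (@?b x + @?c x)%R) => apply: measurable_funD
    | |- measurable_fun _ (fun x => (- @?c x)%R) => apply: measurable_funN
    | |- measurable_fun _ (fun x => (@?c x ^+ _)%R) => apply: measurable_funX
    | |- measurable_fun _ (fun x => expR (@?b x)) =>
        apply: (measurableT_comp (@measurable_expR _))
    | |- measurable_fun _ (fun x => ln (@?b x)) =>
        apply: (measurableT_comp (@measurable_ln _))
    | |- measurable_fun _ (fun x => powR (@?b x) _) =>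
        apply: (measurableT_comp (@measurable_powR _ _))
    | |- measurable_fun _ (fun x => poweR (@?b x) _) =>
        apply: (measurableT_comp (@measurable_poweR _ _))
    | |- measurable_fun _ (fun x => (@?b x)^-1%R) =>
        apply: (measurableT_comp (@measurable_inv _))
    | _ => fail
    end
  | exact: measurable_expR | exact: measurable_ln
  | exact: measurable_powR | exact: measurable_inv | exact: oppr_measurable
  | match goal with
    | H : measurable_fun setT ?h |- _ =>
      lazymatch h with (fun _ => _) => fail | _ => apply: (measurableT_comp H) end
    end
  | apply: measurable_fun_ifT
  | apply: measurable_fun_ltr | apply: measurable_fun_ler
  | apply: emeasurable_funM | apply: emeasurable_funD
  | apply: measurable_funB | apply: measurable_funD | apply: measurable_funM
  | apply: measurable_funN ].

Ltac mfun := repeat mstep.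

Section NonnegIntegral.
Context d (T : measurableType d) (R : realType).
Variable m : {measure set T -> \bar R}.
Local Open Scope ereal_scope.
Implicit Types f g : T -> \bar R.

(** The integral of a nonnegative function is a supremum over the simple functions below it, so
    monotonicity holds for arbitrary nonnegative functions and pointwise estimates can be integrated
    directly. *)
Lemma ge0_integral_le f g : (forall x, 0 <= f x) -> (forall x, f x <= g x) ->
  \int[m]_x f x <= \int[m]_x g x.
Proof.
move=> f0 fg; have g0 x : 0 <= g x by exact: le_trans (fg x).
rewrite !ge0_integralE//; apply: le_ereal_sup => _ [h hf <-]; exists h => // x.
by apply: (le_trans (hf x)); rewrite !patch_setT.
Qed.

Lemma ge0_integral_scale f (k : R) : measurable_fun setT f ->
  (forall x, 0 <= f x) -> (0 <= k)%R ->
  \int[m]_x (k%:E * f x) = k%:E * \int[m]_x f x.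
Proof. by move=> mf f0 k0; rewrite ge0_integralZl_EFin. Qed.

Lemma ge0_integral_add f g : measurable_fun setT f -> measurable_fun setT g ->
  (forall x, 0 <= f x) -> (forall x, 0 <= g x) ->
  \int[m]_x (f x + g x) = \int[m]_x f x + \int[m]_x g x.
Proof. by move=> mf mg f0 g0; rewrite ge0_integralD. Qed.

End NonnegIntegral.

Section LebesgueR.
Context (R : realType).
Local Open Scope ereal_scope.
Notation mu := (@lebesgue_measure R).

Lemma ge0_tonelli d (T : measurableType d)
    (m1 : {sigma_finite_measure set T -> \bar R}) (f : T -> R -> \bar R) :
  measurable_fun setT (fun z : T * R => f z.1 z.2) ->
  (forall x y, 0 <= f x y) ->
  \int[m1]_x \int[mu]_y f x y = \int[mu]_y \int[m1]_x f x y.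
Proof.
by move=> mf f0; exact: (@fubini_tonelli _ _ _ _ _ m1 mu (fun z => f z.1 z.2)).
Qed.

Lemma measurable_integral_param d (T : measurableType d) (f : T -> R -> \bar R) :
  measurable_fun setT (fun z : T * R => f z.1 z.2) ->
  (forall x y, 0 <= f x y) ->
  measurable_fun setT (fun x => \int[mu]_y f x y).
Proof.
move=> mf f0.
exact: (@measurable_fun_fubini_tonelli_F _ _ _ _ _ mu (fun z => f z.1 z.2)).
Qed.

(** Uniqueness of Lebesgue measure: the rescaled pushforward under x -> a x + c gives each interval
    ]l, r] its length. *)
Lemma lebesgue_affine (a c : R) (A : set R) : (a != 0)%R -> measurable A ->
  mu A = `|a|%R%:E * mu ((fun x : R => (a * x + c)%R) @^-1` A).
Proof.
move=> a0 mA.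
have mphi : measurable_fun [set: measurableTypeR R]
    (fun x : measurableTypeR R => (a * x + c)%R : measurableTypeR R).
  apply: measurable_funD => //; exact: measurable_funM.
have an : (0 <= `|a|)%R by exact: normr_ge0.
pose m2 : {measure set (measurableTypeR R) -> \bar R} := mscale (NngNum an)
  (measure_function_pushforward__canonical__measure_function_Measure mu mphi).
rewrite (@lebesgue_measure_unique R m2 _ A mA)// => X [[l r] _ <-] /=.
rewrite /m2 /mscale /= /pushforward.
(* For a < 0 the preimage is half-open at the other end. *)
have -> : (fun x => (a * x + c)%R) @^-1` `]l, r] =
   if (0 < a)%R then `]((l - c) / a)%R, ((r - c) / a)%R]%classic
   else `[((r - c) / a)%R, ((l - c) / a)%R[%classic :> set R.
  case: ifPn => [ap|]; rewrite eqEsubset; split => x /=; rewrite !in_itv /=.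
  - by rewrite ltr_pdivrMr// ler_pdivlMr// ltrBlDr lerBrDr mulrC.
  - by rewrite ltr_pdivrMr// ler_pdivlMr// ltrBlDr lerBrDr mulrC.
  - move=> H; have an0 : (a < 0)%R by rewrite lt_neqAle a0 leNgt.
    by rewrite ler_ndivrMr// ltr_ndivlMr// lerBrDr ltrBlDr mulrC andbC.
  - move=> H; have an0 : (a < 0)%R by rewrite lt_neqAle a0 leNgt.
    move: H.
    by rewrite ler_ndivrMr// ltr_ndivlMr// lerBrDr ltrBlDr mulrC andbC.
case: ifPn => ap; rewrite !lebesgue_measure_itv/= !lte_fin.
  rewrite ltr_pM2r ?invr_gt0// ltrD2r; case: ifPn => lr; last by rewrite mule0.
  rewrite -!EFinB -EFinM gtr0_norm//; congr (_%:E).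
  by field; rewrite a0.
have an0 : (a < 0)%R by rewrite lt_neqAle a0 leNgt.
rewrite ltr_nM2r ?invr_lt0// ltrD2r; case: ifPn => lr; last by rewrite mule0.
rewrite -!EFinB -EFinM ltr0_norm//; congr (_%:E).
by field; rewrite a0.
Qed.

Lemma ge0_integral_affine (f : R -> \bar R) (a c : R) :
  measurable_fun setT f -> (forall x, 0 <= f x) -> (a != 0)%R ->
  \int[mu]_x f (a * x + c)%R = (`|a|^-1)%R%:E * \int[mu]_x f x.
Proof.
move=> mf f0 a0.
have mphi : measurable_fun [set: measurableTypeR R]
    (fun x : measurableTypeR R => (a * x + c)%R : measurableTypeR R).
  apply: measurable_funD => //; exact: measurable_funM.
have ap : (0 < `|a|)%R by rewrite normr_gt0.
have an : (0 <= `|a|^-1)%R by rewrite invr_ge0 ltW.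
have := @ge0_integral_pushforward _ _ _ _ _ _ mphi mu setT f measurableT mf.
rewrite preimage_setT => /(_ (fun y _ => f0 y)) <-.
rewrite -[RHS](@ge0_integral_mscale _ (measurableTypeR R) _ mu setT measurableT (NngNum an) f) //.
apply: eq_measure_integral => A mA _.
transitivity (mu ((fun x : R => (a * x + c)%R) @^-1` A)) => //.
transitivity (`|a|^-1%:E * mu A) => //; rewrite (lebesgue_affine c a0 mA).
by rewrite muleA -EFinM mulVf ?mul1e// lt0r_neq0.
Qed.

Lemma ge0_integral_shift (f : R -> \bar R) (c : R) :
  measurable_fun setT f -> (forall x, 0 <= f x) ->
  \int[mu]_x f (x + c)%R = \int[mu]_x f x.
Proof.
move=> mf f0; have := @ge0_integral_affine f 1 c mf f0 (oner_neq0 R).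
by rewrite normr1 invr1 mul1e => <-; apply: eq_integral => x _; rewrite mul1r.
Qed.

Lemma ge0_integral_dilate (f : R -> \bar R) (a : R) :
  measurable_fun setT f -> (forall x, 0 <= f x) -> (a != 0)%R ->
  \int[mu]_x f (a * x)%R = (`|a|^-1)%R%:E * \int[mu]_x f x.
Proof.
move=> mf f0 a0; rewrite -(@ge0_integral_affine f a 0 mf f0 a0).
by apply: eq_integral => x _; rewrite addr0.
Qed.


(** Test weight that proves the substitution u = e^x by Tonelli: inserting w(u e^(-x)) and
    integrating in either order splits off a constant, [W1] or [W2]. *)
Let w (u : R) : R := if ((1 < u) && (u <= 2))%R then 1%R else 0%R.

Let mw : measurable_fun setT w.
Proof. by rewrite /w; mfun. Qed.

Let w0 u : (0 <= w u)%R. Proof. by rewrite /w; case: ifP. Qed.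

Let W1 : \bar R := \int[mu]_s (if (0 < s)%R then (w s / s)%R else 0%R)%:E.
Let W2 : \bar R := \int[mu]_x (w (expR x))%:E.

(* Both sides compute the double integral of [g u * w (u / e^x)] over
   [u > 0] and [x : R]. *)
Let exp_substitution_const (g : R -> \bar R) : measurable_fun setT g ->
  (forall x, 0 <= g x) ->
  W1 * (\int[mu]_x ((expR x)%:E * g (expR x))) =
  W2 * (\int[mu]_u (if (0 < u)%R then g u else 0)).
Proof.
move=> mg g0.
have mgp : measurable_fun setT (fun u : R => if (0 < u)%R then g u else 0).
  by mfun.
have gp0 u : 0 <= (if (0 < u)%R then g u else 0) by case: ifP.
pose H (x u : R) := (if (0 < u)%R then g u else 0) * (w (u * expR (- x)))%:E.
have H0 x u : 0 <= H x u by rewrite mule_ge0// lee_fin.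
have mH : measurable_fun setT (fun z : R * R => H z.1 z.2).
  apply: emeasurable_funM; first by mfun.
  by apply/measurable_EFinP; apply: (measurableT_comp mw); mfun.
transitivity (\int[mu]_x \int[mu]_u H x u); last first.
  rewrite ge0_tonelli//.
  rewrite -ge0_integralZl//; last by rewrite integral_ge0// => ? _; rewrite lee_fin.
  apply: eq_integral => u _; rewrite /H; case: ifPn => u0; last first.
    by rewrite mule0; under eq_integral do rewrite mul0e; rewrite integral0.
  rewrite ge0_integralZl//; first last.
  - by move=> x _; rewrite lee_fin.
  - by apply/measurable_EFinP; apply: (measurableT_comp mw); mfun.
  rewrite muleC; congr (_ * _).
  (* For fixed u > 0 the map x -> ln u - x removes u from the weight and leaves [W2]. *)
  have -> : \int[mu]_x (w (u * expR (- x)))%:E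
      = \int[mu]_x (fun x => (w (expR x))%:E) (-1 * x + ln u)%R.
    by apply: eq_integral => x _; rewrite expRD lnK// mulN1r mulrC.
  rewrite (@ge0_integral_affine (fun x => (w (expR x))%:E))//; first last.
  - by move=> x; rewrite lee_fin.
  - by apply/measurable_EFinP; apply: (measurableT_comp mw); mfun.
  by rewrite normrN1 invr1 mul1e.
(* For fixed x, the dilation u = s e^x removes x from the weight and produces the Jacobian e^x. *)
have wE (x s : R) : \int[mu]_u H x u =
    \int[mu]_s ((expR x)%:E * (if (0 < s)%R then g (s * expR x)%R else 0) * (w s)%:E).
  have e0 : (expR x != 0)%R by rewrite gt_eqF// expR_gt0.
  have mHx : measurable_fun setT (H x).
    apply: emeasurable_funM; first by mfun.
    by apply/measurable_EFinP; apply: (measurableT_comp mw); mfun.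
  have := @ge0_integral_dilate (H x) (expR x) mHx (H0 x) e0.
  rewrite gtr0_norm ?expR_gt0//.
  move=> /(congr1 (fun z => (expR x)%:E * z)).
  rewrite muleA -EFinM divff// mul1e => <-.
  rewrite -ge0_integralZl ?lee_fin ?expR_ge0//; last first.
    by apply: measurableT_comp mHx _; mfun.
  apply: eq_integral => y _; rewrite /H pmulr_rgt0 ?expR_gt0//.
  rewrite -muleA; congr (_ * _); rewrite (mulrC y).
  by congr (_ * (w _)%:E); rewrite expRN; field.
transitivity (\int[mu]_x \int[mu]_s
  ((expR x)%:E * (if (0 < s)%R then g (s * expR x)%R else 0) * (w s)%:E)); last first.
  by apply: eq_integral => x _; rewrite wE.
rewrite ge0_tonelli; first last.
- move=> x y; rewrite !mule_ge0 ?lee_fin ?expR_ge0//; by case: ifP.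
- apply: emeasurable_funM; last first.
    by apply/measurable_EFinP; apply: (measurableT_comp mw); mfun.
  apply: emeasurable_funM; first by mfun.
  apply: measurable_fun_ifT; [by mfun| |by mfun].
  by apply: (measurableT_comp mg); mfun.
have mA : measurable_fun setT (fun x : R => (expR x)%:E * g (expR x)).
  by apply: emeasurable_funM; [mfun|apply: (measurableT_comp mg); mfun].
have A0 x : 0 <= (expR x)%:E * g (expR x).
  by rewrite mule_ge0 ?lee_fin ?expR_ge0.
rewrite -ge0_integralZr//; first last.
- by rewrite integral_ge0.
- by move=> x _; rewrite lee_fin; case: ifPn => // x0; rewrite divr_ge0// ltW.
- by apply/measurable_EFinP; apply: measurable_fun_ifT => //;
    [mfun|apply: measurable_funM => //; mfun].
apply: eq_integral => s _; case: ifPn => s0; last first.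
  rewrite mul0e; under eq_integral do rewrite mule0 mul0e.
  by rewrite integral0.
(* Now s is fixed and x is translated by ln s; rewriting e^x as e^(x + ln s) / s leaves the factor
   1/s of [W1]. *)
have -> : \int[mu]_x ((expR x)%:E * g (s * expR x)%R * (w s)%:E) =
   \int[mu]_x ((w s / s)%:E * (fun x => (expR x)%:E * g (expR x)) (x + ln s)%R).
  apply: eq_integral => x _; rewrite expRD lnK// EFinM.
  rewrite muleC (mulrC (expR x)) !muleA; congr (_ * _).
  rewrite -!EFinM; congr (_%:E); field; exact: lt0r_neq0.
rewrite ge0_integral_scale; first last.
- by rewrite divr_ge0// ltW.
- by move=> x; exact: A0.
- by apply: (measurableT_comp mA); mfun.
exact: (congr1 (fun I => (w s / s)%:E * I) (esym (ge0_integral_shift (ln s) mA A0))).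
Qed.

(** The identity just proved, valid for every g, reduces the claim to [W1] = [W2] = ln 2. [W2] is
    the length of an interval. [W1] is found by testing the identity on the indicator of ]1, e],
    where both integrals equal e - 1, one of them by the fundamental theorem of calculus. *)
Lemma ge0_integral_exp (g : R -> \bar R) : measurable_fun setT g ->
  (forall x, 0 <= g x) ->
  \int[mu]_x ((expR x)%:E * g (expR x)) =
  \int[mu]_u (if (0 < u)%R then g u else 0).
Proof.
have W2E : W2 = (ln 2)%:E.
  have -> : W2 = \int[mu]_(x in `]0%R, ln 2]) (cst 1) x.
    rewrite integral_mkcond; apply: eq_integral => x _.
    rewrite /w patchE mem_setE in_itv/= -(expR_gt1 x).
    rewrite -[X in (_ <= X)%R](@lnK R 2%R) ?posrE// ler_expR.
    by case: ifP.
  rewrite integral_cst//= lebesgue_measure_itv/= lte_fin ln_gt0 ?ltr1n//.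
  by rewrite mul1e -EFinB subr0.
have W20 : (ln 2 : R) != 0%R by rewrite gt_eqF// ln_gt0// ltr1n.
suff W1E : W1 = (ln 2)%:E.
  move=> mg g0; have := exp_substitution_const mg g0; rewrite W1E W2E.
  move=> /(congr1 (fun z => ((ln 2)^-1)%:E * z)).
  by rewrite !muleA -!EFinM mulVf// !mul1e.
have e1 : (1 < expR 1 :> R)%R by rewrite expR_gt1.
pose g0 (u : R) : \bar R := if ((1 < u) && (u <= expR 1))%R then 1 else 0.
have mg0 : measurable_fun setT g0 by rewrite /g0; mfun.
have := exp_substitution_const mg0; rewrite W2E.
have -> : \int[mu]_u (if (0 < u)%R then g0 u else 0) = (expR 1 - 1)%:E.
  transitivity (\int[mu]_(x in `]1%R, expR 1]) (cst 1) x).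
    rewrite [RHS]integral_mkcond; apply: eq_integral => x _.
    rewrite patchE mem_setE in_itv/= /g0; case: ifPn => x0; first by case: ifP.
    case: ifPn => // /andP[x1]; suff : (0 < x)%R by rewrite (negPf x0).
    by apply: lt_trans x1.
  by rewrite integral_cst//= lebesgue_measure_itv/= lte_fin e1 mul1e.
have -> : \int[mu]_x ((expR x)%:E * g0 (expR x)) = (expR 1 - 1)%:E.
  transitivity (\int[mu]_(x in `]0%R, 1%R]) (expR x)%:E).
    rewrite [RHS]integral_mkcond; apply: eq_integral => x _.
    rewrite patchE mem_setE in_itv/= /g0 expR_gt1 ler_expR.
    by case: ifP; rewrite ?mule1 ?mule0.
  rewrite integral_itv_obnd_cbnd; last first.
    by apply/measurable_EFinP/measurable_funTS; exact: measurable_expR.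
  rewrite (@continuous_FTC2 _ expR expR)//; first by rewrite expR0.
  - exact/continuous_subspaceT/continuous_expR.
  - split.
    + by move=> x _; exact: derivable_expR.
    + exact/cvg_at_right_filter/continuous_expR.
    + exact/cvg_at_left_filter/continuous_expR.
  - by move=> x _; rewrite derive1E derive_val.
move=> /(_ _)/(congr1 (fun z => z * ((expR 1 - 1)^-1)%:E)).
rewrite -!muleA -EFinM divff ?mule1; last by rewrite gt_eqF// subr_gt0.
by apply => x; rewrite /g0; case: ifP.
Qed.

End LebesgueR.

(** * Iterated integrals over row vectors *)

Section IteratedIntegral.
Context (R : realType).
Local Open Scope ereal_scope.
Notation mu := (@lebesgue_measure R).

Lemma measurable_fun_ext d d' (T : measurableType d) (U : measurableType d')
    (g f : T -> U) : (forall t, f t = g t) ->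
  measurable_fun setT g -> measurable_fun setT f.
Proof. by move=> /funext ->. Qed.

Definition mmx d (T : measurableType d) a b (x : T -> 'M[R]_(a, b)) :=
  forall i j, measurable_fun setT (fun t => x t i j).

(* Borel measurability of [g], tested on measurable families of vectors. *)
Definition bmeas m (g : 'rV[R]_m -> \bar R) :=
  forall d (T : measurableType d) (x : T -> 'rV[R]_m), mmx x ->
    measurable_fun setT (fun t => g (x t)).

(** Joint measurability with a parameter, tested in the same way. The parameter space is arbitrary
    because inductions on m move the first coordinate into it. *)
Definition pmeas d0 (T0 : measurableType d0) m (g : T0 -> 'rV[R]_m -> \bar R) :=
  forall d (T : measurableType d) (y : T -> T0) (x : T -> 'rV[R]_m),
    measurable_fun setT y -> mmx x -> measurable_fun setT (fun t => g (y t) (x t)).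

Definition bmeas2 a b (g : 'rV[R]_a -> 'rV[R]_b -> \bar R) :=
  forall d (T : measurableType d) (x : T -> 'rV[R]_a) (y : T -> 'rV[R]_b),
    mmx x -> mmx y -> measurable_fun setT (fun t => g (x t) (y t)).

Lemma mmx_cst d (T : measurableType d) a b (A : 'M[R]_(a, b)) :
  mmx (fun _ : T => A).
Proof. by move=> i j; exact: measurable_cst. Qed.

Lemma mmx_row_mx d (T : measurableType d) c a b (x : T -> 'M[R]_(c, a))
    (y : T -> 'M[R]_(c, b)) :
  mmx x -> mmx y -> mmx (fun t => row_mx (x t) (y t)).
Proof.
move=> mx my i j; have [k ->|k ->] := split_ordP j.
  by apply: measurable_fun_ext (mx i k) => t; rewrite row_mxEl.
by apply: measurable_fun_ext (my i k) => t; rewrite row_mxEr.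
Qed.

Lemma mmx_const d (T : measurableType d) a b (y : T -> R) :
  measurable_fun setT y -> mmx (fun t => (\matrix_(i < a, j < b) y t)%R).
Proof. by move=> my i j; apply: measurable_fun_ext my => t; rewrite mxE. Qed.

Lemma mmx_mul d (T : measurableType d) a b c (x : T -> 'M[R]_(a, b))
    (y : T -> 'M[R]_(b, c)) :
  mmx x -> mmx y -> mmx (fun t => x t *m y t)%R.
Proof.
move=> mx my i j.
apply: (measurable_fun_ext (g := fun t => \sum_k (x t i k * y t k j))%R) => [t|].
  by rewrite mxE.
by apply: measurable_sum => k; exact: measurable_funM.
Qed.

Lemma mmx_add d (T : measurableType d) a b (x y : T -> 'M[R]_(a, b)) :
  mmx x -> mmx y -> mmx (fun t => x t + y t)%R.
Proof.
move=> mx my i j.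
apply: (measurable_fun_ext (g := fun t => x t i j + y t i j)%R) => [t|].
  by rewrite mxE.
exact: measurable_funD.
Qed.

Lemma mmx_tr d (T : measurableType d) a b (x : T -> 'M[R]_(a, b)) :
  mmx x -> mmx (fun t => (x t)^T)%R.
Proof. by move=> mx i j; apply: measurable_fun_ext (mx j i) => t; rewrite mxE. Qed.

Lemma mmx_cons d (T : measurableType d) m (y : T -> R) (x : T -> 'rV[R]_m) :
  measurable_fun setT y -> mmx x ->
  mmx (fun t => row_mx (\row_(_ < 1) y t) (x t) : 'rV[R]_m.+1).
Proof.
by move=> my mx; apply: (@mmx_row_mx _ _ 1 1 m) => //; exact: mmx_const.
Qed.

Lemma bmeas_pmeas d0 (T0 : measurableType d0) m (g : T0 -> 'rV[R]_m -> \bar R) t :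
  pmeas g -> bmeas (g t).
Proof. by move=> mg d T x mx; apply: mg => //; exact: measurable_cst. Qed.

Lemma iint_ge0 m (g : 'rV[R]_m -> \bar R) : (forall x, 0 <= g x) -> 0 <= iint g.
Proof.
elim: m g => [|m IH] g g0 //=.
by apply: integral_ge0 => t _; apply: IH => v.
Qed.

Lemma iint_le m (g h : 'rV[R]_m -> \bar R) :
  (forall x, 0 <= g x) -> (forall x, g x <= h x) -> iint g <= iint h.
Proof.
elim: m g h => [|m IH] g h g0 gh //=.
by apply: ge0_integral_le => t; [apply: iint_ge0 => v|apply: IH => v].
Qed.

Lemma pmeas_slice d0 (T0 : measurableType d0) m (g : T0 -> 'rV[R]_m.+1 -> \bar R) :
  pmeas g -> pmeas (fun (z : T0 * R) v =>
    g z.1 (row_mx (\row_(_ < 1) z.2) v : 'rV[R]_m.+1)).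
Proof.
move=> mg d T y x my mx; apply: mg.
  by apply: measurableT_comp my; exact: measurable_fst.
apply: mmx_cons => //.
by apply: measurableT_comp my; exact: measurable_snd.
Qed.

Lemma bmeas_slice m (g : 'rV[R]_m.+1 -> \bar R) : bmeas g ->
  pmeas (fun (s : R) v => g (row_mx (\row_(_ < 1) s) v : 'rV[R]_m.+1)).
Proof.
by move=> mg d T y x my mx; apply: mg; exact: mmx_cons.
Qed.

Lemma measurable_iint d0 (T0 : measurableType d0) m (g : T0 -> 'rV[R]_m -> \bar R) :
  pmeas g -> (forall t x, 0 <= g t x) -> measurable_fun setT (fun t => iint (g t)).
Proof.
elim: m d0 T0 g => [|m IH] d0 T0 g mg g0 /=.
  by apply: mg; [exact: measurable_id|exact: mmx_cst].
apply: measurable_integral_param; last by move=> *; apply: iint_ge0.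
exact: (IH _ _ _ (pmeas_slice mg)).
Qed.

Lemma iint_tonelli d0 (T0 : measurableType d0)
    (m1 : {sigma_finite_measure set T0 -> \bar R}) m
    (g : T0 -> 'rV[R]_m -> \bar R) :
  pmeas g -> (forall t x, 0 <= g t x) ->
  \int[m1]_t iint (g t) = iint (fun v => \int[m1]_t g t v).
Proof.
elim: m g => [|m IH] g mg g0 //=.
rewrite ge0_tonelli; first last.
- by move=> *; apply: iint_ge0.
- exact: (measurable_iint (pmeas_slice mg)).
apply: eq_integral => s _; apply: IH => // d T y x my mx.
by apply: mg => //; apply: mmx_cons => //; exact: measurable_cst.
Qed.

Lemma iint_swap a b (g : 'rV[R]_a -> 'rV[R]_b -> \bar R) :
  bmeas2 g -> (forall u v, 0 <= g u v) ->
  iint (fun u => iint (g u)) = iint (fun v => iint (fun u => g u v)).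
Proof.
elim: a g => [|a IH] g mg g0 //=.
transitivity (\int[mu]_s iint (fun v => iint (fun u : 'rV[R]_a =>
    g (row_mx (\row_(_ < 1) s) u : 'rV[R]_a.+1) v))).
  apply: eq_integral => s _; apply: IH => // d T x y mx my.
  by apply: mg => //; apply: mmx_cons => //; exact: measurable_cst.
rewrite iint_tonelli//; last by move=> *; apply: iint_ge0.
move=> d T y x my mx.
apply: (measurable_iint (g := fun t u => g (row_mx (\row_(_ < 1) y t) u : 'rV[R]_a.+1) (x t))) => //.
move=> d' T' y' x' my' mx'; apply: mg => [|i j].
  apply: mmx_cons => //; exact: (measurableT_comp my my').
exact: (measurableT_comp (mx i j) my').
Qed.

Lemma iintZl m (g : 'rV[R]_m -> \bar R) (k : \bar R) : bmeas g ->
  (forall x, 0 <= g x) -> 0 <= k -> iint (fun x => k * g x) = k * iint g.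
Proof.
elim: m g => [|m IH] g mg g0 k0 //=.
rewrite -ge0_integralZl//; last 2 first.
- exact: (measurable_iint (bmeas_slice mg)).
- by move=> t _; exact: iint_ge0.
apply: eq_integral => t _; apply: IH => //.
exact: (bmeas_pmeas t (bmeas_slice mg)).
Qed.

Lemma iintD m (g h : 'rV[R]_m -> \bar R) : bmeas g -> bmeas h ->
  (forall x, 0 <= g x) -> (forall x, 0 <= h x) ->
  iint (fun x => g x + h x) = iint g + iint h.
Proof.
elim: m g h => [|m IH] g h mg mh g0 h0 //=.
rewrite -ge0_integral_add; first last.
- by move=> t; exact: iint_ge0.
- by move=> t; exact: iint_ge0.
- exact: (measurable_iint (bmeas_slice mh)).
- exact: (measurable_iint (bmeas_slice mg)).
apply: eq_integral => t _; apply: IH => //.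
  exact: (bmeas_pmeas t (bmeas_slice mg)).
exact: (bmeas_pmeas t (bmeas_slice mh)).
Qed.

Lemma iint_shift m (g : 'rV[R]_m -> \bar R) (w : 'rV[R]_m) : bmeas g ->
  (forall x, 0 <= g x) -> iint (fun x => g (x + w)%R) = iint g.
Proof.
elim: m g w => [|m IH] g w mg g0 /=; first by congr (g _); rewrite [w]thinmx0 addr0.
pose h (s : R) := iint (fun v : 'rV[R]_m => g (row_mx (\row_(_ < 1) s) v : 'rV[R]_m.+1)).
rewrite -[RHS](@ge0_integral_shift R h (w 0%R 0%R)); last 2 first.
- exact: (measurable_iint (bmeas_slice mg)).
- by move=> t; exact: iint_ge0.
apply: eq_integral => s _; rewrite /h.
rewrite -(IH (fun v : 'rV[R]_m => g (row_mx (\row_(_ < 1) (s + w 0 0)%R) v)) (rsubmx (w : 'rV_(1 + m))))//; last exact: (bmeas_pmeas _ (bmeas_slice mg)).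
congr iint; apply/funext => v; congr g.
rewrite -[w in LHS](@hsubmxK _ 1 1 m w).
apply: (etrans (@add_row_mx _ 1 1 m _ _ _ _)); congr row_mx.
apply/rowP => i; rewrite !mxE (ord1 i); congr (_ + w _ _)%R.
exact/val_inj.
Qed.

Lemma iint_row_mx a b (g : 'rV[R]_(a + b) -> \bar R) :
  iint g = iint (fun u : 'rV[R]_a => iint (fun v : 'rV[R]_b => g (row_mx u v))).
Proof.
elim: a g => [|a IH] g /=.
  congr iint; apply/funext => v; congr g; apply/rowP => i; rewrite mxE.
  by case: splitP => [[]//|j ij]; congr (v 0%R _); exact/val_inj.
apply: eq_integral => s _; rewrite IH; congr iint; apply/funext => u.
congr iint; apply/funext => v; congr g.
rewrite row_mxA (_ : esym (addnA 1%N a b) = erefl) ?castmx_id//.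
Qed.

End IteratedIntegral.

(** * Linear changes of variables in iterated integrals *)

Section LinearChange.
Context (R : realType).
Local Open Scope ereal_scope.
Notation mu := (@lebesgue_measure R).

(** A predicate on matrices because it is stable under products, so it only has to be checked on the
    factors of a Gaussian elimination. *)
Definition linear_change m (A : 'M[R]_m) := forall g : 'rV[R]_m -> \bar R,
  bmeas g -> (forall x, 0 <= g x) ->
  iint (fun x => g (x *m A)%R) = (`|(\det A)%R|^-1)%R%:E * iint g.

Lemma bmeas_mulmx a b (g : 'rV[R]_b -> \bar R) (A : 'M[R]_(a, b)) :
  bmeas g -> bmeas (fun x => g (x *m A)%R).
Proof. by move=> mg d T x mx; apply: mg; apply: mmx_mul => //; exact: mmx_cst. Qed.

Lemma linear_change1 m : linear_change (1%:M : 'M[R]_m)%R.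
Proof.
move=> g mg g0; rewrite det1 normr1 invr1 mul1e.
by congr iint; apply/funext => x; rewrite mulmx1.
Qed.

Lemma linear_changeM m (A B : 'M[R]_m) :
  linear_change A -> linear_change B -> linear_change (A *m B)%R.
Proof.
move=> HA HB g mg g0.
transitivity (iint (fun x => (fun y => g (y *m B)%R) (x *m A)%R)).
  by congr iint; apply/funext => x; rewrite mulmxA.
rewrite (HA (fun y => g (y *m B)%R))//; last exact: bmeas_mulmx.
by rewrite HB// muleA -EFinM det_mulmx normrM invfM.
Qed.

(** With the first coordinate s integrated outermost, the row [u] only translates the other
    coordinates by s u; what remains is [A] on those coordinates and the dilation of s by [d]. *)
Lemma linear_change_ublock m (d : R) (u : 'rV[R]_m) (A : 'M[R]_m) :
  (d != 0)%R -> A \in unitmx -> linear_change A ->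
  linear_change (block_mx (d%:M : 'M[R]_1)%R u 0%R A : 'M[R]_m.+1).
Proof.
move=> d0 uA HA g mg g0.
pose h (s : R) := iint (fun v : 'rV[R]_m => g (row_mx (\row_(_ < 1) s) v)).
have mh : measurable_fun setT h by exact: (measurable_iint (bmeas_slice mg)).
have h0 s : 0 <= h s by exact: iint_ge0.
(* The translation is moved in front of [A], as s u A^-1, so that translation invariance applies
   before the hypothesis on [A]. *)
have E (s : R) (v : 'rV[R]_m) :
    (row_mx (\row_(_ < 1) s) v *m block_mx (d%:M : 'M[R]_1) u 0 A =
     row_mx (\row_(_ < 1) (d * s)) ((v + (s *: u) *m invmx A) *m A))%R.
  rewrite mul_row_block mulmx0 addr0 mulmxDl -mulmxA mulVmx// mulmx1.
  congr row_mx.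
    by apply/rowP => i; rewrite mul_mx_scalar !mxE.
  rewrite addrC; congr (_ + _)%R.
  by apply/rowP => i; rewrite !mxE big_ord1 !mxE.
have S (s : R) : iint (fun v : 'rV[R]_m =>
     g (row_mx (\row_(_ < 1) s) v *m block_mx (d%:M : 'M[R]_1) u 0 A)%R) =
    (`|(\det A)%R|^-1)%R%:E * h (d * s)%R.
  transitivity (iint (fun v => (fun y => g (row_mx (\row_(_ < 1) (d * s)%R) (y *m A)%R))
                                (v + (s *: u) *m invmx A)%R)).
    by congr iint; apply/funext => v; rewrite E.
  have ms := bmeas_pmeas (d * s)%R (bmeas_slice mg).
  rewrite (iint_shift (g := fun y => g (row_mx (\row_(_ < 1) (d * s)%R) (y *m A)%R)))//; last exact: bmeas_mulmx ms.
  by rewrite (HA _ ms).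
transitivity (\int[mu]_s ((`|(\det A)%R|^-1)%R%:E * h (d * s)%R)).
  by apply: eq_integral => s _; exact: S.
rewrite ge0_integral_scale; first last.
- by rewrite invr_ge0.
- by move=> x; exact: h0.
- by apply: (measurableT_comp mh); exact: measurable_funM.
rewrite (ge0_integral_dilate mh h0 d0) muleA -EFinM; congr (_%:E * _).
by rewrite (@det_ublock R 1 m) det_scalar expr1 normrM invfM mulrC.
Qed.

(** Here the first coordinate is translated by an amount depending on the others, so Tonelli is used
    to integrate it innermost. *)
Lemma linear_change_lshear m (l : 'cV[R]_m) :
  linear_change (block_mx (1%:M : 'M[R]_1)%R 0%R l 1%:M%R : 'M[R]_m.+1).
Proof.
move=> g mg g0.
rewrite (@det_lblock R 1 m) !det1 mulr1 normr1 invr1 mul1e /=.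
have E (s : R) (v : 'rV[R]_m) :
    (row_mx (\row_(_ < 1) s) v *m block_mx (1%:M : 'M[R]_1) 0 l 1%:M =
     row_mx (\row_(_ < 1) (s + (v *m l) 0 0)) v)%R.
  rewrite mul_row_block !mulmx1 mulmx0 add0r; congr row_mx.
  by apply/rowP => i; rewrite !mxE (ord1 i).
transitivity (\int[mu]_s iint (fun v : 'rV[R]_m =>
    g (row_mx (\row_(_ < 1) (s + (v *m l) 0 0)%R) v))).
  by apply: eq_integral => s _; congr iint; apply/funext => v; rewrite E.
rewrite iint_tonelli//; last first.
  move=> d T y x my mx; apply: mg; apply: mmx_cons => //.
  by apply: measurable_funD => //; apply: mmx_mul => //; exact: mmx_cst.
rewrite iint_tonelli//; last exact: bmeas_slice.
congr iint; apply/funext => v.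
apply: (@ge0_integral_shift R (fun s => g (row_mx (\row_(_ < 1) s) v))) => //.
by apply: mg; apply: mmx_cons; [exact: measurable_id|exact: mmx_cst].
Qed.

(** Gaussian elimination by induction on the size: a matrix with nonzero corner entry is a lower
    shear times an upper block matrix whose lower block is the Schur complement; a zero corner is
    first made nonzero by adding another row. *)
Lemma linear_change_unit m (A : 'M[R]_m) : A \in unitmx -> linear_change A.
Proof.
elim: m A => [|m IH] A uA.
  by rewrite [A]flatmx0 -[0%R](flatmx0 1%:M%R); exact: linear_change1.
have pivot (B : 'M[R]_m.+1) : B \in unitmx -> (B 0 0 != 0)%R -> linear_change B.
  move=> uB B0; pose B' : 'M[R]_(1 + m) := B.
  pose S : 'M[R]_m := (drsubmx B' - (B 0 0)^-1 *: (dlsubmx B' *m ursubmx B'))%R.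
  have BE : B' = ((block_mx (1%:M : 'M[R]_1) 0 ((B 0 0)^-1 *: dlsubmx B') 1%:M : 'M[R]_(1 + m)) *m
      (block_mx ((B 0 0)%:M : 'M[R]_1) (ursubmx B') 0 S : 'M[R]_(1 + m)))%R.
    rewrite mulmx_block !mul1mx !mul0mx !addr0.
    rewrite -[LHS]submxK; congr block_mx.
    - by rewrite [LHS]mx11_scalar !mxE; congr ((B _ _)%:M)%R; exact/val_inj.
    - by rewrite mul_mx_scalar scalerA divff// scale1r.
    - by rewrite /S -scalemxAl addrC subrK.
  have uS : S \in unitmx.
    move: uB; rewrite !unitmxE -/B' BE det_mulmx (@det_lblock R 1 m) (@det_ublock R 1 m) !det1 !mul1r.
    by rewrite det_scalar expr1 unitrM => /andP[].
  rewrite -[B]/B' BE; apply: linear_changeM; first exact: linear_change_lshear.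
  by apply: linear_change_ublock => //; exact: IH.
have [A0|] := eqVneq (A 0 0)%R 0%R; last exact: pivot.
pose A' : 'M[R]_(1 + m) := A.
(* Otherwise the first column would vanish, and the determinant with it. *)
have [i Ai] : exists i, (dlsubmx A' i 0 != 0)%R.
  apply/existsP; apply: contraT; rewrite negb_exists => /forallP H.
  move: uA; rewrite unitmxE unitfE (_ : (\det A)%R = 0%R) ?eqxx//.
  rewrite (expand_det_col A 0%R) big1// => j _.
  suff -> : A j 0%R = 0%R by rewrite mul0r.
  have [j0|j0] := eqVneq j 0%R; first by rewrite j0.
  have j0' : (0 < j)%N by rewrite lt0n.
  have jm : (j.-1 < m)%N by rewrite -ltnS prednK.
  have := H (Ordinal jm); rewrite negbK => /eqP <-.
  by rewrite !mxE; congr (A _ _); apply/val_inj => //=; rewrite add1n prednK.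
(* [E 1] adds row [i] of the lower block to the first row, and [E (-1)] undoes it. *)
pose E (c : R) : 'M[R]_m.+1 :=
  block_mx (1%:M : 'M[R]_1)%R (c *: delta_mx 0 i)%R 0%R 1%:M%R.
have EE : (E (-1) *m E 1 = 1%:M)%R.
  rewrite [LHS](@mulmx_block _ 1 m 1 m 1 m) ?mulmx1 ?mul1mx ?mul0mx ?mulmx0 ?addr0 ?add0r.
  by rewrite -scalerDl subrr scale0r [RHS](@scalar_mx_block _ 1 m).
have EA : A = (E (-1) *m (E 1 *m A))%R by rewrite mulmxA EE mul1mx.
have uE c : E c \in unitmx.
  by rewrite unitmxE (@det_ublock _ 1 m) !det1 mulr1 unitr1.
rewrite EA; apply: linear_changeM.
  apply: linear_change_ublock; [exact: oner_neq0|exact: unitmx1|].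
  exact: linear_change1.
apply: pivot; first by rewrite unitmx_mul uE.
rewrite (_ : (E 1 *m A) 0 0 = dlsubmx A' i 0)%R//.
have M := @mulmx_block R 1 m 1 m 1 m 1%:M%R (1 *: delta_mx 0 i)%R 0%R 1%:M%R
  (ulsubmx A') (ursubmx A') (dlsubmx A') (drsubmx A').
rewrite submxK scale1r mul1mx in M.
transitivity ((block_mx (1%:M : 'M[R]_1) (1 *: delta_mx 0 i) 0 1%:M *m A')%R 0%R 0%R) => //.
rewrite scale1r M.
have -> : (0 : 'I_m.+1)%R = lshift m (0 : 'I_1)%R by exact/val_inj.
rewrite block_mxEul mxE -rowE !mxE.
have -> : A' (lshift m 0%R) (lshift m 0%R) = 0%R.
  by rewrite -[RHS]A0 /A'; congr (A _ _); exact/val_inj.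
by rewrite add0r.
Qed.

Lemma iint_mulmx m (A : 'M[R]_m) (g : 'rV[R]_m -> \bar R) : A \in unitmx ->
  bmeas g -> (forall x, 0 <= g x) ->
  iint (fun x => g (x *m A)%R) = (`|(\det A)%R|^-1)%R%:E * iint g.
Proof. by move=> uA; exact: linear_change_unit. Qed.

Lemma iint_orthogonal m (Q : 'M[R]_m) (g : 'rV[R]_m -> \bar R) :
  (Q *m Q^T = 1%:M)%R -> bmeas g -> (forall x, 0 <= g x) ->
  iint (fun x => g (x *m Q)%R) = iint g.
Proof.
move=> QQ mg g0.
have D : (\det Q * \det Q = 1)%R by rewrite -{2}det_tr -det_mulmx QQ det1.
have uQ : Q \in unitmx.
  rewrite unitmxE unitfE; apply/eqP => d0.
  by move: D; rewrite d0 mul0r => /esym/eqP; rewrite oner_eq0.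
rewrite iint_mulmx//.
have -> : (`|(\det Q)%R| = 1)%R.
  apply/eqP; rewrite -(@eqrXn2 _ 2)// ?normr_ge0// expr1n real_normK ?num_real//.
  by rewrite expr2 D.
by rewrite invr1 mul1e.
Qed.

End LinearChange.

(** * Polar coordinates *)

Section Radial.
Context (R : realType).
Local Open Scope ereal_scope.
Notation mu := (@lebesgue_measure R).

(** If x = ln tan^2 d, this is -2 ln cos d; cosines enter all later exponents in this way. *)
Definition softplus (x : R) : R := ln (1 + expR x).

Lemma expR_softplus x : expR (softplus x) = (1 + expR x)%R.
Proof. by rewrite lnK// posrE addr_gt0// expR_gt0. Qed.

Lemma softplus_gt0 x : (0 < softplus x)%R.
Proof. by rewrite ln_gt0// ltrDl expR_gt0. Qed.

Lemma softplus_gt x : (x < softplus x)%R.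
Proof. by rewrite -ltr_expR expR_softplus ltrDr. Qed.

Lemma measurable_softplus : measurable_fun setT softplus.
Proof. by rewrite /softplus; mfun. Qed.

Lemma integral_expR_lt (c L : R) : (0 < c)%R ->
  \int[mu]_x (if (x < L)%R then expR (c * x) else 0%R)%:E = (expR (c * L) / c)%:E.
Proof.
move=> c0.
pose g (y : R) : \bar R := (expR y)%:E * (if (expR y < expR (c * L))%R then 1 else 0).
have mg : measurable_fun setT g by rewrite /g; mfun.
have g0 y : 0 <= g y by rewrite mule_ge0// ?lee_fin ?expR_ge0//; case: ifP.
transitivity (\int[mu]_x g (c * x)%R).
  apply: eq_integral => x _; rewrite /g ltr_expR ltr_pM2l//.
  by case: ifP; rewrite ?mule1 ?mule0.
rewrite ge0_integral_dilate//; last by rewrite gt_eqF.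
rewrite gtr0_norm// mulrC EFinM; congr (_ * _).
rewrite /g (@ge0_integral_exp _ (fun u => if (u < expR (c * L))%R then 1 else 0)).
- transitivity (\int[mu]_(x in `]0%R, expR (c * L)[) (cst 1) x).
    rewrite [RHS]integral_mkcond; apply: eq_integral => x _.
    by rewrite patchE mem_setE in_itv/=; do 2 case: ifP => //=.
  by rewrite integral_cst//= lebesgue_measure_itv/= lte_fin expR_gt0 mul1e sube0.
- by mfun.
- by move=> x; case: ifP.
Qed.

Lemma integral_expR_le (c L : R) : (0 < c)%R ->
  \int[mu]_x (if (x <= L)%R then expR (c * x) else 0%R)%:E = (expR (c * L) / c)%:E.
Proof.
move=> c0; rewrite -integral_expR_lt//; apply: ge0_ae_eq_integral => //.
- by mfun.
- by mfun.
- by move=> x _; rewrite lee_fin; case: ifP => // _; exact: expR_ge0.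
- by move=> x _; rewrite lee_fin; case: ifP => // _; exact: expR_ge0.
exists [set L]; split; [exact: measurable_set1|exact: lebesgue_measure_set1|].
move=> t /= H; apply: contrapT => /eqP t0; apply: H => _.
by rewrite le_eqVlt (negPf t0).
Qed.

Lemma integral_expR_gt (c L : R) : (0 < c)%R ->
  \int[mu]_x (if (L < x)%R then expR (- c * x) else 0%R)%:E = (expR (- c * L) / c)%:E.
Proof.
move=> c0; have := @integral_expR_lt c (- L) c0; rewrite mulrN -mulNr => <-.
pose g (x : R) := (if (x < - L)%R then expR (c * x) else 0%R)%:E.
have mg : measurable_fun setT g by rewrite /g; mfun.
have g0 y : 0 <= g y by rewrite lee_fin; case: ifP => // _; exact: expR_ge0.
have := @ge0_integral_dilate R g (-1) mg g0.
rewrite normrN1 invr1 mul1e oppr_eq0 oner_eq0 => /(_ isT) <-.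
by apply: eq_integral => x _; rewrite /g mulN1r ltrN2 mulrN mulNr.
Qed.

(** Each of the branches t = e^(y/2) and t = -e^(y/2) contributes half of the density e^(y/2); the
    point t = 0 is null. *)
Lemma integral_square (h : R -> \bar R) : measurable_fun setT h ->
  (forall x, 0 <= h x) ->
  \int[mu]_t h (t ^+ 2)%R = \int[mu]_y ((expR (2^-1 * y))%:E * h (expR y)).
Proof.
move=> mh h0.
pose g (t : R) := if (0 < t)%R then h (t ^+ 2)%R else 0.
have mh2 : measurable_fun setT (fun t : R => h (t ^+ 2)%R).
  by apply: (measurableT_comp mh); exact: measurable_funX.
have mg : measurable_fun setT g by rewrite /g; mfun.
have g0 t : 0 <= g t by rewrite /g; case: ifP.
have gE : \int[mu]_t g t = \int[mu]_y ((expR y)%:E * h (expR y ^+ 2)%R).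
  by rewrite (@ge0_integral_exp _ (fun t => h (t ^+ 2)%R)).
transitivity (\int[mu]_t g t + \int[mu]_t g t); last first.
  rewrite gE.
  pose k (y : R) := (expR (2^-1 * y))%:E * h (expR y).
  have mk : measurable_fun setT k by rewrite /k; mfun.
  have k0 y : 0 <= k y by rewrite mule_ge0// lee_fin expR_ge0.
  have -> : \int[mu]_y ((expR y)%:E * h (expR y ^+ 2)%R) = \int[mu]_y k (2 * y)%R.
    apply: eq_integral => y _; rewrite /k mulrA mulVf// mul1r.
    by rewrite -expRM_natl mulr_natl.
  have n2 : (2 != 0 :> R)%R by rewrite pnatr_eq0.
  rewrite (ge0_integral_dilate mk k0 n2) (ger0_norm (ler0n R 2)).
  move: (\int[mu]_x k x) => K; rewrite -ge0_muleDl ?lee_fin//.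
  by rewrite -EFinD (_ : (2^-1 + 2^-1)%R = 1%R) ?mul1e//; field.
have -> : \int[mu]_t g t + \int[mu]_t g t = \int[mu]_t (g t + g (- t)%R).
  rewrite ge0_integral_add//; last first.
    by apply: (measurableT_comp mg); exact: oppr_measurable.
  congr (_ + _); have := @ge0_integral_dilate R g (-1) mg g0.
  rewrite normrN1 invr1 mul1e oppr_eq0 oner_eq0 => /(_ isT) <-.
  by apply: eq_integral => t _; rewrite mulN1r.
apply: ge0_ae_eq_integral => //.
- by apply: emeasurable_funD => //; apply: (measurableT_comp mg); exact: oppr_measurable.
- by move=> t _; rewrite adde_ge0.
exists [set 0%R]; split; [exact: measurable_set1|exact: lebesgue_measure_set1|].
move=> t /= H; apply: contrapT => /eqP t0; apply: H => _.
by rewrite /g oppr_gt0 sqrrN; case: ltgtP t0 => //= t0 _; rewrite ?adde0 ?add0e.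
Qed.

(* Substitute [z = x + y], exchange, and use [e^y + e^(x+y) = e^(y + softplus x)]. *)
Lemma integral_ratio (a b : R) (h psi : R -> \bar R) :
  measurable_fun setT h -> (forall x, 0 <= h x) ->
  measurable_fun setT psi -> (forall x, 0 <= psi x) ->
  \int[mu]_y \int[mu]_z ((expR (a * y + b * z))%:E *
      (h (expR y + expR z)%R * psi (z - y)%R)) =
  (\int[mu]_x ((expR (b * x - (a + b) * softplus x))%:E * psi x)) *
  (\int[mu]_y ((expR ((a + b) * y))%:E * h (expR y))).
Proof.
move=> mh h0 mpsi psi0; have msp := measurable_softplus.
pose k (y : R) := (expR ((a + b) * y))%:E * h (expR y).
have mk : measurable_fun setT k by rewrite /k; mfun.
have k0 y : 0 <= k y by rewrite mule_ge0// lee_fin expR_ge0.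
have e0 (x : R) : 0 <= (expR x)%:E by rewrite lee_fin expR_ge0.
pose f (y x : R) := ((expR (b * x - (a + b) * softplus x))%:E * psi x)
    * k (y + softplus x)%R.
have mf : measurable_fun setT (fun z : R * R => f z.1 z.2) by rewrite /f; mfun.
have f0 y x : 0 <= f y x by rewrite /f !mule_ge0.
transitivity (\int[mu]_y \int[mu]_x f y x).
  apply: eq_integral => y _.
  rewrite -[LHS](@ge0_integral_shift _ _ y); first last.
  - by move=> z; rewrite !mule_ge0.
  - by mfun.
  apply: eq_integral => x _; rewrite /f /k addrK.
  rewrite [(expR (y + softplus x)%R)]expRD expR_softplus.
  have -> : (expR y + expR (x + y))%R = (expR y * (1 + expR x))%R by rewrite expRD; ring.
  rewrite -muleA (muleCA (psi x)) [h _ * _]muleC !muleA; congr (_ * _ * _).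
  by rewrite -EFinM -expRD; congr ((expR _)%:E); ring.
rewrite ge0_tonelli//.
rewrite -ge0_integralZr//; first last.
- by apply: integral_ge0 => y _; exact: k0.
- by move=> x _; rewrite mule_ge0.
- by mfun.
apply: eq_integral => x _; rewrite /f.
rewrite ge0_integralZl; first last.
- by rewrite mule_ge0.
- by move=> y _; exact: k0.
- by apply: (measurableT_comp mk); mfun.
- exact: measurableT.
by rewrite (@ge0_integral_shift _ _ (softplus x) mk k0).
Qed.

(** The Beta integral B(a, b), of which only finiteness and positivity are recorded: the integrand
    behaves like e^(bx) at minus infinity and like e^(-ax) at plus infinity. *)
Lemma integral_beta_weight (a b : R) : (0 < a)%R -> (0 < b)%R ->
  exists2 B : R, (0 < B)%R &
    \int[mu]_x (expR (b * x - (a + b) * softplus x))%:E = B%:E.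
Proof.
move=> a0 b0; have msp := measurable_softplus.
set I := \int[mu]_x _.
have Ilty : I < +oo.
  apply: (@le_lt_trans _ _ ((expR (b * 1) / b)%:E + (expR (- a * 0) / a)%:E)).
    rewrite -(@integral_expR_lt b 1)// -(@integral_expR_gt a 0)//.
    rewrite -ge0_integral_add; first last.
    - by move=> x; rewrite lee_fin; case: ifP => // _; exact: expR_ge0.
    - by move=> x; rewrite lee_fin; case: ifP => // _; exact: expR_ge0.
    - by mfun.
    - by mfun.
    apply: ge0_integral_le => x; first by rewrite lee_fin expR_ge0.
    have s0 := softplus_gt0 x; have sx := softplus_gt x.
    rewrite -EFinD lee_fin; case: ifPn => x1.
      rewrite -[leLHS]addr0 lerD//; last by case: ifP => // _; exact: expR_ge0.
      by rewrite ler_expR lerBlDr lerDl mulr_ge0// ?ltW// addr_gt0.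
    have x0 : (0 < x)%R by lra.
    rewrite x0 add0r ler_expR; nra.
  by rewrite -EFinD ltry.
have Igt : 0 < I.
  apply: (@lt_le_trans _ _ (expR (- (a + b) * softplus 1))%:E).
    by rewrite lte_fin expR_gt0.
  rewrite -[leLHS]mule1 -[X in _ * X](_ : mu `[0%R, 1%R] = 1); last first.
    by rewrite lebesgue_measure_itv/= lte_fin ltr01 oppr0 adde0.
  rewrite -integral_cst// integral_mkcond.
  apply: ge0_integral_le => x; rewrite patchE; case: ifPn => //.
  - by rewrite lee_fin expR_ge0.
  - rewrite inE/= in_itv/= => /andP[x0 x1]; rewrite lee_fin ler_expR.
    have : (softplus x <= softplus 1)%R.
      rewrite -ler_expR !expR_softplus lerD2l ler_expR//.
    nra.
  - by rewrite lee_fin expR_ge0.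
exists (fine I); first by rewrite fine_gt0// Igt.
by rewrite fineK// ge0_fin_numE// ltW.
Qed.

Definition sqn m (x : 'rV[R]_m) : R := (\sum_i x 0 i ^+ 2)%R.

Lemma sqn_ge0 m (x : 'rV[R]_m) : (0 <= sqn x)%R.
Proof. by apply: sumr_ge0 => i _; exact: sqr_ge0. Qed.

Lemma sqn_row_mx a b (u : 'rV[R]_a) (v : 'rV[R]_b) :
  sqn (row_mx u v) = (sqn u + sqn v)%R.
Proof.
rewrite /sqn big_split_ord /=; congr (_ + _)%R; apply: eq_bigr => i _.
  by rewrite row_mxEl.
by rewrite row_mxEr.
Qed.

Lemma sqn_cons m (s : R) (v : 'rV[R]_m) :
  sqn (row_mx (\row_(_ < 1) s) v : 'rV[R]_m.+1) = (s ^+ 2 + sqn v)%R.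
Proof.
rewrite [LHS](@sqn_row_mx 1 m); congr (_ + _)%R.
by rewrite /sqn big_ord1 mxE.
Qed.

Lemma measurable_sqn d (T : measurableType d) m (x : T -> 'rV[R]_m) :
  mmx x -> measurable_fun setT (fun t => sqn (x t)).
Proof. by move=> mx; apply: measurable_sum => i; exact: measurable_funX. Qed.

Lemma iintS m (g : 'rV[R]_m.+1 -> \bar R) :
  iint g = \int[mu]_s iint (fun v : 'rV[R]_m => g (row_mx (\row_(_ < 1) s) v)).
Proof. by []. Qed.

(** Polar coordinates with |x|^2 = e^y, the constant being half the area of the unit sphere. In the
    inductive step, the ratio of the squared first coordinate to the rest integrates to a Beta
    constant. *)
Lemma iint_radial m : exists2 C : R, (0 < C)%R &
  forall h : R -> \bar R, measurable_fun setT h -> (forall x, 0 <= h x) ->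
  iint (fun x : 'rV[R]_m.+1 => h (sqn x)) =
  C%:E * \int[mu]_y ((expR (m.+1%:R / 2 * y))%:E * h (expR y)).
Proof.
elim: m => [|m [C C0 IH]].
  exists 1%R => // h mh h0; rewrite mul1e /= div1r -integral_square//.
  apply: eq_integral => t _; congr h; rewrite sqn_cons.
  by rewrite /sqn big_ord0 addr0.
have [B B0 BE] := @integral_beta_weight (m.+1%:R / 2) (2^-1)%R
  ltac:(by rewrite divr_gt0) ltac:(by rewrite invr_gt0).
exists (C * B)%R; first by rewrite mulr_gt0.
move=> h mh h0.
pose G (q : R) := C%:E * \int[mu]_y ((expR (m.+1%:R / 2 * y))%:E * h (q + expR y)%R).
transitivity (\int[mu]_s G (s ^+ 2)%R).
  rewrite iintS; apply: eq_integral => s _; rewrite /G -(IH (fun q => h (s ^+ 2 + q)%R))//; last by mfun.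
  congr iint; apply/funext => v; congr h; by rewrite sqn_cons.
rewrite (@integral_square G); first last.
- move=> q; apply: mule_ge0; first by rewrite lee_fin ltW.
  by apply: integral_ge0 => y _; rewrite mule_ge0// lee_fin expR_ge0.
- apply: emeasurable_funM; first exact: measurable_cst.
  apply: (@measurable_integral_param R _ R (fun q y : R => (expR (m.+1%:R / 2 * y))%:E *
    h (q + expR y)%R)); first by mfun.
  by move=> *; rewrite mule_ge0// lee_fin expR_ge0.
have e0 (x : R) : 0 <= (expR x)%:E by rewrite lee_fin expR_ge0.
pose H (z y : R) := (expR (m.+1%:R / 2 * y + 2^-1 * z))%:E *
    (h (expR y + expR z)%R * 1).
have H0 z y : 0 <= H z y by rewrite !mule_ge0.
transitivity (\int[mu]_z (C%:E * \int[mu]_y H z y)).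
  apply: eq_integral => z _; rewrite /G muleCA; congr (_ * _).
  rewrite -ge0_integral_scale; first last.
  - exact: expR_ge0.
  - by move=> y; rewrite mule_ge0.
  - by mfun.
  apply: eq_integral => y _; rewrite /H mule1 muleA -EFinM -expRD.
  by rewrite [(expR y + _)%R]addrC [(_ / _ * y + _)%R]addrC.
have mH : measurable_fun setT (fun w : R * R => H w.1 w.2) by rewrite /H; mfun.
rewrite ge0_integral_scale; last 3 first.
- exact: measurable_integral_param.
- by move=> x; rewrite integral_ge0.
- exact: ltW.
rewrite ge0_tonelli//.
rewrite (integral_ratio _ _ mh h0 (measurable_cst (1 : \bar R)))//.
under eq_integral do rewrite mule1.
rewrite BE; have -> : \int[mu]_y ((expR ((m.+1%:R / 2 + 2^-1) * y))%:E * h (expR y)) =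
    \int[mu]_y ((expR (m.+2%:R / 2 * y))%:E * h (expR y)).
  apply: eq_integral => y _; rewrite (_ : m.+1%:R / 2 + 2^-1 = m.+2%:R / 2 :> R)%R//.
  by rewrite -[in RHS]natr1; field.
by rewrite muleA -EFinM.
Qed.

(* Only the values of [Phi] at positive arguments matter, so the null sets
   [sqn u = 0] and [sqn v = 0] need no separate treatment. *)
Lemma iint_polar a b : exists2 C : R, (0 < C)%R &
  forall (Phi : R -> R -> \bar R) (h psi : R -> \bar R),
  measurable_fun setT (fun z : R * R => Phi z.1 z.2) -> (forall x y, 0 <= Phi x y) ->
  measurable_fun setT h -> (forall x, 0 <= h x) ->
  measurable_fun setT psi -> (forall x, 0 <= psi x) ->
  (forall y z, Phi (expR y) (expR z) = h (expR y + expR z)%R * psi (z - y)%R) ->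
  iint (fun u : 'rV[R]_a.+1 => iint (fun v : 'rV[R]_b.+1 =>
    Phi (sqn u) (sqn v))) =
  C%:E * ((\int[mu]_x ((expR (b.+1%:R / 2 * x
             - (a.+1 + b.+1)%:R / 2 * softplus x))%:E * psi x)) *
          (\int[mu]_y ((expR ((a.+1 + b.+1)%:R / 2 * y))%:E * h (expR y)))).
Proof.
have [Ca Ca0 HA] := iint_radial a; have [Cb Cb0 HB] := iint_radial b.
exists (Ca * Cb)%R; first by rewrite mulr_gt0.
move=> Phi h psi mPhi Phi0 mh h0 mpsi psi0 PhiE.
have e0 (x : R) : 0 <= (expR x)%:E by rewrite lee_fin expR_ge0.
have mPhi1 q : measurable_fun setT (Phi q).
  exact: (measurableT_comp mPhi
    (measurable_fun_pair (measurable_cst q) (@measurable_id _ _ setT))).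
pose G (q : R) := Cb%:E * \int[mu]_z ((expR (b.+1%:R / 2 * z))%:E * Phi q (expR z)).
transitivity (iint (fun u : 'rV[R]_a.+1 => G (sqn u))).
  by congr iint; apply/funext => u; exact: HB.
have mG : measurable_fun setT G.
  apply: emeasurable_funM; first exact: measurable_cst.
  apply: (@measurable_integral_param R _ R (fun q z : R =>
    (expR (b.+1%:R / 2 * z))%:E * Phi q (expR z))).
    apply: emeasurable_funM; first by mfun.
    exact: (measurableT_comp mPhi (measurable_fun_pair measurable_fst
      (measurableT_comp (@measurable_expR R) measurable_snd))).
  by move=> *; rewrite !mule_ge0.
have G0 q : 0 <= G q.
  apply: mule_ge0; first by rewrite lee_fin ltW.
  by apply: integral_ge0 => z _; rewrite !mule_ge0.
rewrite HA// EFinM -muleA; congr (_ * _).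
pose H (y z : R) := (expR (a.+1%:R / 2 * y + b.+1%:R / 2 * z))%:E *
    (h (expR y + expR z)%R * psi (z - y)%R).
have H0 z y : 0 <= H z y by rewrite !mule_ge0.
transitivity (\int[mu]_y (Cb%:E * \int[mu]_z H y z)).
  apply: eq_integral => y _; rewrite /G muleCA; congr (_ * _).
  rewrite -ge0_integral_scale; first last.
  - exact: expR_ge0.
  - by move=> z; rewrite !mule_ge0.
  - apply: emeasurable_funM; first by mfun.
    by apply: (measurableT_comp (mPhi1 _)); mfun.
  by apply: eq_integral => z _; rewrite /H PhiE muleA -EFinM -expRD.
have mH : measurable_fun setT (fun w : R * R => H w.1 w.2) by rewrite /H; mfun.
rewrite ge0_integral_scale; last 3 first.
- exact: measurable_integral_param.
- by move=> x; rewrite integral_ge0.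
- exact: ltW.
rewrite (integral_ratio _ _ mh h0 mpsi psi0).
have <- : (a.+1%:R / 2 + b.+1%:R / 2 = (a.+1 + b.+1)%:R / 2 :> R)%R.
  by rewrite natrD; field.
reflexivity.
Qed.

End Radial.

(** * Orthogonal reduction of matrices *)

Section Geometry.
Context (R : realType).

Lemma vdotE m (x y : 'rV[R]_m) : vdot x y = (x *m y^T) 0 0.
Proof. by rewrite mxE; apply: eq_bigr => i _; rewrite mxE. Qed.

Lemma sqn_vdot m (x : 'rV[R]_m) : sqn x = vdot x x.
Proof. by apply: eq_bigr => i _; rewrite expr2. Qed.

Lemma vdotC m (x y : 'rV[R]_m) : vdot x y = vdot y x.
Proof. by apply: eq_bigr => i _; rewrite mulrC. Qed.

Lemma vdotBr m (x y z : 'rV[R]_m) : vdot x (y - z) = vdot x y - vdot x z.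
Proof.
by rewrite /vdot -sumrB; apply: eq_bigr => i _; rewrite !mxE mulrBr.
Qed.

Lemma vdotZr m a (x y : 'rV[R]_m) : vdot x (a *: y) = a * vdot x y.
Proof.
by rewrite /vdot mulr_sumr; apply: eq_bigr => i _; rewrite !mxE mulrCA.
Qed.

Lemma vdotBl m (x y z : 'rV[R]_m) : vdot (y - z) x = vdot y x - vdot z x.
Proof. by rewrite vdotC vdotBr !(vdotC x). Qed.

Lemma vdotZl m a (x y : 'rV[R]_m) : vdot (a *: y) x = a * vdot y x.
Proof. by rewrite vdotC vdotZr (vdotC x). Qed.

Lemma vdot_row_mx a b (u u' : 'rV[R]_a) (v v' : 'rV[R]_b) :
  vdot (row_mx u v) (row_mx u' v') = vdot u u' + vdot v v'.
Proof.
rewrite /vdot big_split_ord /=; congr (_ + _); apply: eq_bigr => i _.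
  by rewrite !row_mxEl.
by rewrite !row_mxEr.
Qed.

Lemma sqn_eq0 m (x : 'rV[R]_m) : (sqn x == 0) = (x == 0).
Proof.
apply/eqP/eqP => [/eqP|->]; last first.
  by rewrite /sqn big1// => i _; rewrite mxE expr0n.
rewrite psumr_eq0; last by move=> i _; exact: sqr_ge0.
move=> /allP H; apply/rowP => i; rewrite mxE.
by have := H i (mem_index_enum i); rewrite sqrf_eq0 => /eqP.
Qed.

Lemma sqnZ m a (x : 'rV[R]_m) : sqn (a *: x) = a ^+ 2 * sqn x.
Proof.
by rewrite /sqn mulr_sumr; apply: eq_bigr => i _; rewrite mxE exprMn.
Qed.

Definition orthogonal_mx m (Q : 'M[R]_m) := Q *m Q^T = 1%:M.

Lemma orthogonal_mxV m (Q : 'M[R]_m) : orthogonal_mx Q -> Q^T *m Q = 1%:M.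
Proof. exact: mulmx1C. Qed.

Lemma orthogonal_mx_tr m (Q : 'M[R]_m) : orthogonal_mx Q -> orthogonal_mx Q^T.
Proof. by move=> /orthogonal_mxV; rewrite /orthogonal_mx trmxK. Qed.

Lemma orthogonal_mx1 m : orthogonal_mx (1%:M : 'M[R]_m).
Proof. by rewrite /orthogonal_mx trmx1 mulmx1. Qed.

Lemma orthogonal_mxM m (P Q : 'M[R]_m) :
  orthogonal_mx P -> orthogonal_mx Q -> orthogonal_mx (P *m Q).
Proof.
move=> oP oQ; rewrite /orthogonal_mx trmx_mul mulmxA -(mulmxA P) oQ mulmx1.
exact: oP.
Qed.

Lemma vdot_orthogonal m (Q : 'M[R]_m) x y : orthogonal_mx Q ->
  vdot (x *m Q) (y *m Q) = vdot x y.
Proof.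
by move=> oQ; rewrite !vdotE trmx_mul mulmxA -(mulmxA x) oQ mulmx1.
Qed.

Lemma sqn_orthogonal m (Q : 'M[R]_m) x : orthogonal_mx Q -> sqn (x *m Q) = sqn x.
Proof. by move=> oQ; rewrite !sqn_vdot vdot_orthogonal. Qed.

(** The reflection in the hyperplane orthogonal to u - w exchanges two vectors of equal length. *)
Lemma householder m (u w : 'rV[R]_m) : sqn u = sqn w ->
  exists2 Q : 'M[R]_m, orthogonal_mx Q & u *m Q = w.
Proof.
move=> uw; have [->|d0] := eqVneq u w.
  by exists 1%:M; [exact: orthogonal_mx1|rewrite mulmx1].
have [d dE] : exists d, d = u - w by exists (u - w).
pose s := sqn d.
have s0 : s != 0 by rewrite sqn_eq0 dE subr_eq0.
have ds x : x *m d^T *m d = vdot x d *: d.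
  by rewrite [x *m d^T]mx11_scalar -vdotE mul_scalar_mx.
have dd : d^T *m d *m (d^T *m d) = s *: (d^T *m d).
  by rewrite -mulmxA (mulmxA d) ds -scalemxAr -sqn_vdot.
pose Q := 1%:M - (2 / s) *: (d^T *m d).
have QT : Q^T = Q by rewrite /Q linearB /= linearZ /= trmx_mul trmxK trmx1.
exists Q.
  rewrite /orthogonal_mx QT /Q mulmxBl mul1mx mulmxBr mulmx1 -scalemxAl -scalemxAr dd.
  move: (d^T *m d) => M; apply/matrixP => i j; rewrite !mxE.
  by move: (_%:R : R) => z; field.
rewrite /Q mulmxBr mulmx1 -scalemxAr mulmxA ds scalerA.
(* Equal lengths give |u - w|^2 = 2 <u, u - w>, so the reflection subtracts exactly u - w from u. *)
have ud : s = 2 * vdot u d.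
  by rewrite /s dE sqn_vdot !vdotBr !vdotBl -!sqn_vdot (vdotC w u) uw; ring.
have -> : 2 / s * vdot u d = 1 by rewrite mulrAC -ud divff.
by rewrite scale1r dE opprB addrC subrK.
Qed.

(** A Householder reflection sends the first row to a multiple of the first basis vector, and the
    induction treats the other rows in the remaining coordinates. Geometrically, the row space is
    rotated into the span of the first m coordinates, where lengths and projections can be read
    off. *)
Lemma lq_decomposition m l (G : 'M[R]_(m, m + l)) :
  exists2 Q : 'M[R]_(m + l), orthogonal_mx Q &
  exists B : 'M[R]_m, G *m Q = row_mx B 0.
Proof.
elim: m G => [|m IH] G.
  by exists 1%:M; [exact: orthogonal_mx1|exists 0; rewrite [LHS]flatmx0 [RHS]flatmx0].
pose G1 : 'M[R]_(1 + m, 1 + (m + l)) := G.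
pose g := usubmx G1; pose c := Num.sqrt (sqn g).
have [Q1 oQ1 gQ1] : exists2 Q : 'M[R]_(1 + (m + l)), orthogonal_mx Q &
    g *m Q = row_mx (c%:M : 'M[R]_1) 0.
  apply: householder; rewrite sqn_row_mx [sqn 0](_ : _ = 0) ?addr0; last first.
    by apply/eqP; rewrite sqn_eq0.
  by rewrite {2}/sqn big_ord1 mxE eqxx mulr1n sqr_sqrtr// sqn_ge0.
pose D := dsubmx G1 *m Q1.
have [Q2 oQ2 [B' B'E]] := IH (rsubmx D).
pose Q2' : 'M[R]_(1 + (m + l)) := block_mx (1%:M : 'M[R]_1) 0 0 Q2.
have oQ2' : orthogonal_mx Q2'.
  rewrite /orthogonal_mx /Q2' tr_block_mx mulmx_block !trmx0 !mulmx0 !mul0mx.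
  by rewrite trmx1 mulmx1 oQ2 !addr0 add0r -scalar_mx_block.
exists (Q1 *m Q2' : 'M[R]_(1 + (m + l))); first exact: orthogonal_mxM.
exists (block_mx (c%:M : 'M[R]_1) 0 (lsubmx D) B').
have E : G1 *m (Q1 *m Q2') =
    col_mx (row_mx (c%:M : 'M[R]_1) 0) (row_mx (lsubmx D) (row_mx B' 0)).
  rewrite -[G1]vsubmxK mulmxA mul_col_mx -/g gQ1 -/D -[D]hsubmxK /Q2'.
  rewrite -[X in X *m _]/(block_mx _ _ _ _) mulmx_block.
  by rewrite !mulmx1 !mulmx0 !mul0mx !addr0 !add0r hsubmxK B'E -[LHS]/(col_mx _ _).
have Z : row_mx (row_mx (c%:M : 'M[R]_1) (0 : 'M[R]_(1, m))) (0 : 'M[R]_(1, l)) =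
    row_mx (c%:M : 'M[R]_1) (0 : 'M[R]_(1, m + l)).
  rewrite -[0 in RHS](@row_mx0 _ 1 m l) row_mxA.
  by rewrite (_ : esym (addnA 1 m l) = erefl) ?castmx_id.
transitivity (G1 *m (Q1 *m Q2')) => //; rewrite E -Z row_mxA.
rewrite (_ : esym (addnA 1 m l) = erefl) ?castmx_id//.
transitivity (block_mx (row_mx (c%:M : 'M[R]_1) (0 : 'M[R]_(1, m))) (0 : 'M[R]_(1, l))
  (row_mx (lsubmx D) B') (0 : 'M[R]_(m, l))); first by rewrite block_mxEv.
by rewrite block_mxEh col_mx0 -block_mxEv.
Qed.

(** For [G] of full row rank, the squared length of the orthogonal projection of [u] to the row
    space of [G]. The closed formula makes measurability in [G] accessible. *)
Definition proj m l (G : 'M[R]_(m, l)) (u : 'rV[R]_l) : R :=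
  (u *m G^T *m invmx (G *m G^T) *m G *m u^T) 0 0.

Section LQ.
Context m l (G : 'M[R]_(m, m + l)) (Q : 'M[R]_(m + l)) (B : 'M[R]_m).
Hypotheses (oQ : orthogonal_mx Q) (GQ : G *m Q = row_mx B 0).

Lemma lq_gram : G *m G^T = B *m B^T.
Proof.
have -> : G *m G^T = G *m Q *m (G *m Q)^T.
  by rewrite trmx_mul mulmxA -(mulmxA G) oQ mulmx1.
by rewrite GQ tr_row_mx mul_row_col trmx0 mulmx0 addr0.
Qed.

Lemma lq_rank : \rank G = \rank B.
Proof.
have uQ : Q \in unitmx by case: (mulmx1_unit oQ).
rewrite -(@mxrankMfree _ _ _ _ G Q) ?row_free_unit// GQ.
by rewrite -mxrank_tr tr_row_mx trmx0 -addsmxE addsmx0 mxrank_tr.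
Qed.

Lemma lq_mul (u : 'rV[R]_(m + l)) : u *m G^T = lsubmx (u *m Q) *m B^T.
Proof.
have -> : u *m G^T = u *m Q *m (G *m Q)^T.
  by rewrite trmx_mul mulmxA -(mulmxA u) oQ mulmx1.
by rewrite GQ tr_row_mx trmx0 -{1}[u *m Q]hsubmxK mul_row_col mulmx0 addr0.
Qed.

Lemma lq_proj (u : 'rV[R]_(m + l)) : B \in unitmx ->
  proj G u = sqn (lsubmx (u *m Q)).
Proof.
move=> uB; rewrite /proj lq_gram lq_mul.
have -> : lsubmx (u *m Q) *m B^T *m invmx (B *m B^T) *m G *m u^T =
    lsubmx (u *m Q) *m (B^T *m invmx (B *m B^T) *m B) *m (lsubmx (u *m Q))^T.
  rewrite -!mulmxA; do 3 congr (_ *m _).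
  by rewrite -[G *m u^T]trmxK trmx_mul trmxK lq_mul trmx_mul trmxK.
have -> : B^T *m invmx (B *m B^T) *m B = 1%:M.
  apply: mulmx1C; rewrite mulmxA mulmxV// unitmx_mul unitmx_tr.
  by rewrite uB.
by rewrite mulmx1 -vdotE -sqn_vdot.
Qed.

Lemma lq_mulmx (t : 'rV[R]_m) : t *m G *m Q = row_mx (t *m B) 0.
Proof. by rewrite -mulmxA GQ mul_mx_row mulmx0. Qed.

Lemma lq_sqn (t : 'rV[R]_m) : sqn (t *m G) = sqn (t *m B).
Proof.
rewrite -(sqn_orthogonal _ oQ) lq_mulmx sqn_row_mx.
by rewrite [X in _ + X](_ : _ = 0) ?addr0//; apply/eqP; rewrite sqn_eq0.
Qed.

Lemma lq_vdot (t : 'rV[R]_m) (u : 'rV[R]_(m + l)) :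
  vdot (t *m G) u = vdot (t *m B) (lsubmx (u *m Q)).
Proof.
rewrite -(vdot_orthogonal _ _ oQ) lq_mulmx -{1}[u *m Q]hsubmxK vdot_row_mx.
by rewrite [X in _ + X]big1 ?addr0// => i _; rewrite mxE mul0r.
Qed.

End LQ.

Lemma vdot_origin n (x : 'rV[R]_n.+1) : vdot x (origin R n) = x 0 ord_max.
Proof.
rewrite /vdot (bigD1 ord_max)//= big1 ?addr0; first by rewrite mxE eqxx mulr1.
by move=> i /negPf io; rewrite mxE io mulr0.
Qed.

Lemma sqn_origin n : sqn (origin R n) = 1.
Proof. by rewrite sqn_vdot vdot_origin mxE eqxx. Qed.

Lemma cauchy_schwarz m (x y : 'rV[R]_m) : vdot x y ^+ 2 <= sqn x * sqn y.
Proof.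
have [->|y0] := eqVneq y 0.
  rewrite /vdot big1 ?expr0n ?mulr_ge0 ?sqn_ge0// => i _.
  by rewrite mxE mulr0.
have sy : 0 < sqn y by rewrite lt_neqAle eq_sym sqn_eq0 y0 sqn_ge0.
have := sqn_ge0 (x - (vdot x y / sqn y) *: y).
rewrite sqn_vdot !vdotBr !vdotBl !vdotZr !vdotZl -!sqn_vdot (vdotC y x).
rewrite (_ : _ - _ = sqn x - vdot x y ^+ 2 / sqn y); last first.
  by field; rewrite gt_eqF.
by rewrite subr_ge0 ler_pdivrMr.
Qed.

Lemma sqrt_expR (t : R) : Num.sqrt (expR t) = expR (t / 2).
Proof.
have -> : expR t = expR (t / 2) ^+ 2 by rewrite -expRM_natl; congr expR; field.
by rewrite sqrtr_sqr ger0_norm ?expR_ge0.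
Qed.

Lemma measurable_sqrtr : measurable_fun setT (@Num.sqrt R).
Proof.
apply: (measurable_fun_ext (g := fun x : R => if 0 <= x then powR x 2^-1 else 0)).
  move=> x; case: ifPn => x0; first by rewrite powR12_sqrt.
  by rewrite ler0_sqrtr// ltW// ltNge.
by apply: measurable_fun_ifT; mfun.
Qed.

Lemma vnormE m (x : 'rV[R]_m) : vnorm x = Num.sqrt (sqn x).
Proof. by []. Qed.

Lemma sqrr_vnorm m (x : 'rV[R]_m) : vnorm x ^+ 2 = sqn x.
Proof. by rewrite vnormE sqr_sqrtr// sqn_ge0. Qed.

End Geometry.

(** * Zonal integrals on spheres *)

Section Zonal.
Context (R : realType).
Notation mu := (@lebesgue_measure R).

Lemma measurable_vnorm d (T : measurableType d) m (x : T -> 'rV[R]_m) :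
  mmx x -> measurable_fun setT (fun t => vnorm (x t)).
Proof.
by move=> mx; exact: (measurableT_comp (@measurable_sqrtr R) (measurable_sqn mx)).
Qed.

Lemma measurable_vdot d (T : measurableType d) m (x y : T -> 'rV[R]_m) :
  mmx x -> mmx y -> measurable_fun setT (fun t => vdot (x t) (y t)).
Proof.
by move=> mx my; apply: measurable_sum => i; apply: measurable_funM.
Qed.

(** A rotation puts [w] on the first axis, so the integrand depends on the ratio of the first
    squared coordinate to the rest; x is the logarithm of tan^2 of the angle to that axis. The
    cutoff to the ball involves only the total radius and factors out as a constant. *)
Lemma ball_zonal m : exists2 C : R, 0 < C &
  forall (w : 'rV[R]_m.+2) (phi : R -> \bar R),
  measurable_fun setT phi -> (forall t, 0 <= phi t)%E ->
  iint (fun s : 'rV[R]_m.+2 => if (0 < vnorm s) && (vnorm s <= 1)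
    then phi `|vdot s w / vnorm s| else 0%E) =
  (C%:E * \int[mu]_x ((expR (m.+1%:R / 2 * x - m.+2%:R / 2 * softplus x))%:E *
    phi (Num.sqrt (sqn w) * expR (- (softplus x / 2)))%R))%E.
Proof.
have [C C0 HC] := iint_polar R 0 m.
have m2 : 0 < (m.+2%:R / 2 : R) by rewrite divr_gt0.
exists (C * (expR (m.+2%:R / 2 * 0) / (m.+2%:R / 2))).
  by rewrite mulr_gt0// divr_gt0// expR_gt0.
move=> w phi mphi phi0; set W := Num.sqrt (sqn w).
have msp := @measurable_softplus R.
have msq := @measurable_sqrtr R.
have W0 : 0 <= W by exact: sqrtr_ge0.
pose g (s : 'rV[R]_m.+2) := if (0 < vnorm s) && (vnorm s <= 1)
    then phi `|vdot s w / vnorm s| else 0%E.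
have g0 s : (0 <= g s)%E by rewrite /g; case: ifP.
have mg : bmeas g.
  move=> d T x mx; have mn := measurable_vnorm mx.
  have mv := measurable_vdot mx (@mmx_cst R d T _ _ w).
  apply: measurable_fun_ifT; first by mfun.
    apply: (measurableT_comp mphi); apply: (measurableT_comp (@normr_measurable R setT)).
    by mfun.
  exact: measurable_cst.
pose e0 : 'rV[R]_(1 + m.+1) := row_mx (const_mx 1) 0.
have sw : sqn (W *: e0 : 'rV[R]_m.+2) = sqn w.
  rewrite sqnZ sqr_sqrtr ?sqn_ge0// [sqn e0](@sqn_row_mx R 1 m.+1).
  rewrite {2}/sqn big_ord1 mxE expr1n [X in _ * (_ + X)](_ : _ = 0) ?addr0 ?mulr1//.
  by apply/eqP; rewrite sqn_eq0.
have [Q oQ wQ] := householder sw.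
pose Phi (s t : R) := if (0 < Num.sqrt (s + t)) && (Num.sqrt (s + t) <= 1)
    then phi (W * (Num.sqrt s / Num.sqrt (s + t))) else 0%E.
pose h (q : R) : \bar R := if q <= 1 then 1%E else 0%E.
pose psi x := phi (W * expR (- (softplus x / 2))).
transitivity (iint (fun u : 'rV[R]_1 => iint (fun v : 'rV[R]_m.+1 =>
    Phi (sqn u) (sqn v)))).
  rewrite -[LHS](iint_orthogonal oQ mg g0) [LHS](@iint_row_mx R 1 m.+1).
  congr iint; apply/funext => u; congr iint; apply/funext => v.
  rewrite /g vnormE sqn_orthogonal// -[in vdot _ _]wQ vdot_orthogonal// vdotZr.
  rewrite [sqn (row_mx u v)](@sqn_row_mx R 1 m.+1) [vdot _ _](@vdot_row_mx R 1 m.+1).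
  rewrite [vdot v 0](_ : _ = 0) ?addr0; last first.
    by rewrite /vdot big1// => i _; rewrite mxE mulr0.
  rewrite /Phi; case: ifP => // _; congr phi.
  rewrite /vdot /sqn !big_ord1 mxE mulr1 !normrM normfV (ger0_norm W0).
  by rewrite sqrtr_sqr [`|Num.sqrt _|]ger0_norm ?sqrtr_ge0// mulrA.
rewrite (HC Phi h psi); first last.
- move=> y z; rewrite /Phi /h /psi.
  have -> : expR y + expR z = expR (y + softplus (z - y)).
    by rewrite expRD expR_softplus mulrDr mulr1 -expRD (addrC y) subrK.
  rewrite sqrtr_gt0 expR_gt0 /= -[X in Num.sqrt _ <= X](@sqrtr1 R) ler_sqrt//.
  rewrite !sqrt_expR; case: ifP => _; last by rewrite mul0e.
  by rewrite mul1e -expRB; congr (phi (_ * expR _)); field.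
- by move=> x; exact: phi0.
- by rewrite /psi; mfun.
- by move=> x; rewrite /h; case: ifP.
- by rewrite /h; mfun.
- by move=> x y; rewrite /Phi; case: ifP.
- by rewrite /Phi; mfun.
have -> : (\int[mu]_y ((expR ((1 + m.+1)%:R / 2 * y))%:E * h (expR y)) =
   (expR (m.+2%:R / 2 * 0) / (m.+2%:R / 2))%:E)%E.
  rewrite -integral_expR_le//; apply: eq_integral => y _.
  by rewrite /h expR_le1; case: ifP => _; rewrite ?mule1 ?mule0.
by rewrite [X in (_ * X)%E]muleC muleA -EFinM.
Qed.

Lemma vnorm_unit m (x : 'rV[R]_m) : 0 < vnorm x -> vnorm ((vnorm x)^-1 *: x) = 1.
Proof.
move=> x0; rewrite [LHS]vnormE sqnZ -sqrr_vnorm -exprMn mulVf ?gt_eqF//.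
by rewrite expr1n sqrtr1.
Qed.

Lemma abs_vdot_le1 m (x y : 'rV[R]_m) : vnorm x = 1 -> sqn y = 1 ->
  `|vdot x y| <= 1.
Proof.
move=> x1 y1; have := cauchy_schwarz x y.
rewrite y1 -sqrr_vnorm x1 expr1n mulr1 => H.
by rewrite -(@ler_pXn2r _ 2)// ?nnegrE// expr1n real_normK ?num_real.
Qed.

Lemma sph_int_zonal n : exists2 C : R, 0 < C & forall phi : R -> \bar R,
  measurable_fun setT phi -> (forall t, 0 <= phi t)%E ->
  sph_int (fun x : 'rV[R]_n.+2 => phi `|x 0 ord_max|) =
  (C%:E * \int[mu]_x ((expR (n.+1%:R / 2 * x - n.+2%:R / 2 * softplus x))%:E *
    phi (expR (- (softplus x / 2)))%R))%E.
Proof.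
have [C C0 HC] := ball_zonal n.
exists (n.+2%:R * C); first by rewrite mulr_gt0.
move=> phi mphi phi0; rewrite EFinM -muleA /sph_int.
have := HC (origin R n.+1) phi mphi phi0; rewrite sqn_origin sqrtr1.
under eq_integral do rewrite mul1r.
move=> <-; congr (_ * iint _)%E; apply/funext => s; case: ifP => // _.
by rewrite vdot_origin mxE mulrC.
Qed.

(** On the row space the last coordinate is the inner product with the projected origin, whose
    length is the square root of [proj]. The Gram factor equals |det B| and cancels the Jacobian of
    t -> t B, so one constant serves all subspaces. *)
Lemma xi_int_zonal k : exists2 C : R, 0 < C &
  forall l (G : 'M[R]_(k.+2, k.+2 + l)) (phi : R -> \bar R), \rank G = k.+2 ->
  measurable_fun setT phi -> (forall t, 0 <= phi t)%E ->
  xi_int (n := k.+1 + l) G (fun x => phi `|x 0 ord_max|) =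
  (C%:E * \int[mu]_x ((expR (k.+1%:R / 2 * x - k.+2%:R / 2 * softplus x))%:E *
    phi (Num.sqrt (proj G (origin R (k.+1 + l))) * expR (- (softplus x / 2)))%R))%E.
Proof.
have [C C0 HC] := ball_zonal k.
exists (k.+2%:R * C); first by rewrite mulr_gt0.
move=> l G phi rG mphi phi0.
have [Q oQ [B GQ]] := lq_decomposition G.
have uB : B \in unitmx by rewrite -row_free_unit -row_leq_rank -(lq_rank oQ GQ) rG.
have dB : \det B != 0 by move: uB; rewrite unitmxE unitfE.
set e := origin R _.
pose g (s : 'rV[R]_k.+2) := if (0 < vnorm s) && (vnorm s <= 1)
    then phi `|vdot s (lsubmx (e *m Q)) / vnorm s| else 0%E.
have g0 s : (0 <= g s)%E by rewrite /g; case: ifP.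
have mg : bmeas g.
  move=> d T x mx; have mn := measurable_vnorm mx.
  have mv := measurable_vdot mx (@mmx_cst R d T _ _ (lsubmx (e *m Q))).
  apply: measurable_fun_ifT; first by mfun.
    apply: (measurableT_comp mphi); apply: (measurableT_comp (@normr_measurable R setT)).
    by mfun.
  exact: measurable_cst.
rewrite /xi_int (lq_gram oQ GQ) det_mulmx det_tr -expr2 sqrtr_sqr.
have -> : iint (fun t : 'rV[R]_k.+2 =>
   if (0 < vnorm (t *m G)) && (vnorm (t *m G) <= 1)
   then phi `|((vnorm (t *m G))^-1 *: (t *m G)) 0 ord_max| else 0%E) =
   iint (fun t => g (t *m B)).
  congr iint; apply/funext => t; rewrite /g -(lq_vdot oQ GQ) /e vdot_origin.
  by rewrite !vnormE (lq_sqn oQ GQ) mxE mulrC.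
rewrite iint_mulmx// HC// -(lq_proj oQ GQ e uB).
move: (\int[mu]_x _)%E => I; rewrite !muleA -!EFinM; congr (_%:E * _)%E.
by field; rewrite normr_eq0.
Qed.

Lemma le_acos (x y : R) : -1 <= x -> x <= y -> y <= 1 -> acos y <= acos x.
Proof.
move=> x1 xy y1.
have ix : x \in `[-1, 1] by rewrite in_itv/= x1 (le_trans xy y1).
have iy : y \in `[-1, 1] by rewrite in_itv/= y1 (le_trans x1 xy).
move: (ix) (iy); rewrite !in_itv/= => jx jy.
rewrite leNgt; apply/negP => lt.
have := xy; rewrite leNgt => /negP; apply.
rewrite -(acosK ix) -(acosK iy) ltr_cos// in_itv/=.
  by rewrite acos_ge0// acos_lepi.
by rewrite acos_ge0// acos_lepi.
Qed.

(** Cauchy-Schwarz bounds the cosine of the distance by the length of the projected origin, and the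
    normalized projection attains the bound. *)
Lemma dist0E k l (G : 'M[R]_(k.+1, k.+1 + l)) : \rank G = k.+1 ->
  0 <= proj G (origin R (k + l)) <= 1 /\
  dist0 (n := k + l) G = acos (Num.sqrt (proj G (origin R (k + l)))).
Proof.
move=> rG; have [Q oQ [B GQ]] := lq_decomposition G.
have uB : B \in unitmx by rewrite -row_free_unit -row_leq_rank -(lq_rank oQ GQ) rG.
set e := origin R _; set w := lsubmx (e *m Q).
rewrite (lq_proj oQ GQ e uB) -/w.
have w1 : sqn w <= 1.
  have := @sqn_origin R (k + l); rewrite -/e -(sqn_orthogonal e oQ).
  rewrite -[e *m Q]hsubmxK [X in X = _ -> _](@sqn_row_mx R k.+1 l) -/w => <-.
  by rewrite lerDl sqn_ge0.
split; first by rewrite sqn_ge0.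
have sw1 : Num.sqrt (sqn w) <= 1 by rewrite -[leRHS](@sqrtr1 R) ler_sqrt.
have sw0 := sqrtr_ge0 (sqn w).
have sw1N : -1 <= Num.sqrt (sqn w) by apply: le_trans sw0; rewrite lerN10.
have lbd x : gsphere (n := k + l) G x -> acos (Num.sqrt (sqn w)) <= sphdist e x.
  move=> [x1 [t xE]].
  have vx : vdot e x = vdot (t *m B) w by rewrite vdotC xE (lq_vdot oQ GQ).
  have sx : sqn (t *m B) = 1.
    by rewrite -(lq_sqn oQ GQ) -xE -sqrr_vnorm x1 expr1n.
  have vle : `|vdot e x| <= Num.sqrt (sqn w).
    have := cauchy_schwarz (t *m B) w; rewrite sx mul1r -vx => H.
    by rewrite -sqrtr_sqr ler_sqrt ?sqn_ge0.
  rewrite /sphdist; apply: le_acos => //.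
    by have := le_trans vle sw1; rewrite ler_norml => /andP[].
  exact: le_trans (ler_norm _) vle.
have [x xG xE] : exists2 x, gsphere (n := k + l) G x &
    sphdist e x = acos (Num.sqrt (sqn w)).
  have mem (t : 'rV[R]_k.+1) : sqn t = 1 ->
      gsphere (n := k + l) G (t *m invmx B *m G).
    move=> t1; split; last by exists (t *m invmx B).
    by rewrite vnormE (lq_sqn oQ GQ) -mulmxA mulVmx// mulmx1 t1 sqrtr1.
  have dot (t : 'rV[R]_k.+1) : vdot e (t *m invmx B *m G) = vdot t w.
    by rewrite vdotC (lq_vdot oQ GQ) -mulmxA mulVmx// mulmx1.
  (* A vanishing projection means that [xi] lies in the equator: all its points are at distance pi/2
     and any of them serves. *)
  have [w0|w0] := eqVneq (sqn w) 0.
    have e1 : sqn (row_mx (const_mx 1) 0 : 'rV[R]_(1 + k)) = 1.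
      rewrite sqn_row_mx {1}/sqn big_ord1 mxE expr1n [X in _ + X](_ : _ = 0) ?addr0//.
      by apply/eqP; rewrite sqn_eq0.
    exists ((row_mx (const_mx 1) 0 : 'rV[R]_(1 + k)) *m invmx B *m G).
      exact: mem.
    rewrite /sphdist [vdot _ _]dot w0 sqrtr0; congr acos.
    move/eqP: w0; rewrite sqn_eq0 => /eqP ->.
    by rewrite /vdot big1// => i _; rewrite [X in _ * X]mxE mulr0.
  have wp : 0 < sqn w by rewrite lt_neqAle eq_sym w0 sqn_ge0.
  have sp : 0 < Num.sqrt (sqn w) by rewrite sqrtr_gt0.
  have ss : Num.sqrt (sqn w) ^+ 2 = sqn w by rewrite sqr_sqrtr// ltW.
  exists (((Num.sqrt (sqn w))^-1 *: w) *m invmx B *m G).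
    by apply: mem; rewrite sqnZ -{2}ss -exprMn mulVf ?expr1n// gt_eqF.
  rewrite /sphdist dot vdotZl -sqn_vdot -{2}ss expr2 mulrA mulVf ?mul1r//.
  by rewrite gt_eqF.
apply/eqP; rewrite eq_le; apply/andP; split.
  rewrite -xE; apply: ge_inf; last by exists x.
  by exists (acos (Num.sqrt (sqn w))) => _ [y yG <-]; exact: lbd.
apply: lb_le_inf; first by exists (sphdist e x), x.
by move=> _ [y yG <-]; exact: lbd.
Qed.

End Zonal.

(** * Measurability in the matrix, and negligibility of singular shifts *)

Section RandomSubspace.
Context (R : realType).
Notation mu := (@lebesgue_measure R).

Lemma vec_mxE m n (v : 'rV[R]_(m * n)) i j : vec_mx v i j = v 0 (mxvec_index i j).
Proof. by rewrite -mxvecE vec_mxK. Qed.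

Lemma mmx_vec_mx d (T : measurableType d) m n (x : T -> 'rV[R]_(m * n)) :
  mmx x -> mmx (fun t => vec_mx (x t)).
Proof.
move=> mx i j; apply: measurable_fun_ext (mx 0 (mxvec_index i j)) => t.
exact: vec_mxE.
Qed.

Lemma mmx_det d (T : measurableType d) m (x : T -> 'M[R]_m) :
  mmx x -> measurable_fun setT (fun t => \det (x t)).
Proof.
move=> mx; apply: measurable_sum => s; apply: measurable_funM => //.
by apply: measurable_prod => i _; exact: mx.
Qed.

(** The cofactor formula is measurable where the determinant is nonzero. The other branch is
    [x t i j] because [invmx] returns a singular matrix unchanged. *)
Lemma mmx_inv d (T : measurableType d) m (x : T -> 'M[R]_m) :
  mmx x -> mmx (fun t => invmx (x t)).
Proof.
move=> mx i j; have md := mmx_det mx.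
apply: (measurable_fun_ext (g := fun t => if 0 < `|\det (x t)| then
  (\det (x t))^-1 * cofactor (x t) j i else x t i j)).
  move=> t; rewrite /invmx unitmxE unitfE normr_gt0; case: ifP => // _.
  by rewrite !mxE.
apply: measurable_fun_ifT => //.
  apply: measurable_fun_ltr => //.
  by apply: (measurableT_comp (@normr_measurable R setT)).
apply: measurable_funM; first by mfun.
apply: measurable_funM => //; apply: mmx_det => a b.
by apply: measurable_fun_ext (mx (lift j a) (lift i b)) => t; rewrite !mxE.
Qed.

Lemma measurable_proj d (T : measurableType d) m n (x : T -> 'M[R]_(m, n))
    (u : T -> 'rV[R]_n) : mmx x -> mmx u ->
  measurable_fun setT (fun t => proj (x t) (u t)).
Proof.
move=> mx mu'; have mt := mmx_tr mx.
exact: (mmx_mul (mmx_mul (mmx_mul (mmx_mul mu' mt) (mmx_inv (mmx_mul mx mt))) mx)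
  (mmx_tr mu')).
Qed.

(** With G Q = [B 0] the Gram determinant is (det B)^2 and [G] has the rank of [B]. This turns full
    rank into a polynomial, hence measurable, condition. *)
Lemma rank_gram m l (G : 'M[R]_(m, m + l)) :
  (\rank G == m) = (0 < `|\det (G *m G^T)|).
Proof.
have [Q oQ [B GQ]] := lq_decomposition G.
rewrite (lq_gram oQ GQ) det_mulmx det_tr normr_gt0 mulf_eq0 orbb.
by rewrite -unitfE -unitmxE -row_free_unit -row_leq_rank (lq_rank oQ GQ) eqn_leq rank_leq_row.
Qed.

Lemma sqn_mxvec m n (A : 'M[R]_(m, n)) : sqn (mxvec A) = \sum_i \sum_j A i j ^+ 2.
Proof.
rewrite /sqn (reindex _ (curry_mxvec_bij m n)) /= pair_bigA /=.
by apply: eq_bigr => -[i j] _ /=; rewrite mxvecE.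
Qed.

Lemma sqn_mxvec_row m n (A : 'M[R]_(m, n)) : sqn (mxvec A) = \sum_i sqn (row i A).
Proof.
by rewrite sqn_mxvec; apply: eq_bigr => i _; apply: eq_bigr => j _; rewrite mxE.
Qed.

Lemma sqnD m (x y : 'rV[R]_m) : sqn (x + y) = sqn x + 2 * vdot x y + sqn y.
Proof.
rewrite /sqn /vdot mulr_sumr -!big_split /=; apply: eq_bigr => i _.
by rewrite mxE; ring.
Qed.

(** Polarization recovers inner products from lengths; on basis vectors they are the entries of M
    M^T. *)
Lemma isometry_orthogonal m (M : 'M[R]_m) : (forall v, sqn (v *m M) = sqn v) ->
  orthogonal_mx M.
Proof.
move=> iM; have vM (x y : 'rV[R]_m) : vdot (x *m M) (y *m M) = vdot x y.
  have := iM (x + y); rewrite mulmxDl !sqnD !iM => H.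
  by apply: (@mulfI _ 2) => //; lra.
apply/matrixP => i j; have := vM (delta_mx 0 i) (delta_mx 0 j).
rewrite -!rowE => E; rewrite [LHS]mxE.
transitivity (vdot (row i M) (row j M)).
  by apply: eq_bigr => a _; rewrite !mxE.
rewrite E /vdot (bigD1 i)//= big1 => [|a /negPf ai]; last by rewrite !mxE ai mul0r.
by rewrite !mxE !eqxx /= mul1r addr0.
Qed.

Lemma proj_orthogonal m n (G : 'M[R]_(m, n)) (Q : 'M[R]_n) u : orthogonal_mx Q ->
  proj G (u *m Q) = proj (G *m Q^T) u.
Proof.
move=> oQ; rewrite /proj.
have -> : G *m Q^T *m (G *m Q^T)^T = G *m G^T.
  by rewrite trmx_mul trmxK mulmxA -(mulmxA G) (orthogonal_mxV oQ) mulmx1.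
by rewrite !trmx_mul !trmxK !mulmxA.
Qed.

Lemma projZ m n (G : 'M[R]_(m, n)) a u : proj G (a *: u) = a ^+ 2 * proj G u.
Proof.
rewrite /proj linearZ /= -scalemxAr -!scalemxAl !mxE mulrA.
by congr (_ * _).
Qed.

Lemma finite_roots (p : {poly R}) : p != 0 -> finite_set [set x | root p x].
Proof.
have [n] := ubnP (size p); elim: n p => // n IH p; rewrite ltnS => sp p0.
have [[a ra]|nr] := pselect (exists a, root p a); last first.
  rewrite (_ : [set _ | _] = set0); first exact: finite_set0.
  by apply/seteqP; split => // x /= rx; case: nr; exists x.
have [q qE] := factor_theorem p a ra.
have q0 : q != 0 by apply: contraNneq p0 => q0; rewrite qE q0 mul0r.
have sq : (size q < n)%N.
  apply: leq_trans sp; rewrite qE size_Mmonic ?monicXsubC// size_XsubC addn2 /=.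
  exact: ltnSn.
apply: (@sub_finite_set _ _ ([set a] `|` [set x | root q x])).
  move=> x /=; rewrite qE rootM root_XsubC => /orP[->|/eqP ->]; [by right|by left].
by rewrite finite_setU; split; [exact: finite_set1|exact: IH].
Qed.

(** If A + s is singular, then s is an eigenvalue of -A, a root of its characteristic polynomial;
    there are finitely many. *)
Lemma negligible_singular_shift m (A : 'M[R]_m) :
  (\int[mu]_s (if (\det (A + s%:M) == 0)%R then 1 else 0))%E = 0%E.
Proof.
pose D := [set s : R | \det (A + s%:M) == 0].
have fD : finite_set D.
  apply: (@sub_finite_set _ _ [set s | root (char_poly (- A)) s]).
    move=> s /= /eqP d0; rewrite -eigenvalue_root_char; apply/eigenvalueP.
    have : ~~ row_free (A + s%:M).
      by rewrite row_free_unit unitmxE unitfE d0 eqxx.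
    rewrite -kermx_eq0 => /rowV0Pn[v /sub_kermxP vA v0]; exists v => //.
    apply/eqP; rewrite mulmxN -mul_mx_scalar eq_sym -subr_eq0 opprK.
    by rewrite addrC -mulmxDr vA.
  by apply: finite_roots; rewrite monic_neq0// char_poly_monic.
rewrite (_ : (fun s : R => if _ then _ else _) = (fun s => (\1_D s)%:E)); last first.
  apply/funext => s; rewrite indicE; case: ifPn => H.
    by rewrite mem_set.
  by rewrite memNset //= ; apply/negP.
rewrite integral_indic ?setIT//.
  by apply: countable_lebesgue_measure0; exact: finite_set_countable.
apply: countable_measurable => //; exact: finite_set_countable.
Qed.

End RandomSubspace.

(** * Zonal integrals on the Grassmannian *)

Section Grassmannian.
Context (R : realType).
Notation mu := (@lebesgue_measure R).

Lemma iint0 m : iint (fun _ : 'rV[R]_m => 0%E) = 0%E.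
Proof. by elim: m => [|m IH] //=; rewrite IH integral0. Qed.

(** From (|t| - 1)^2 >= 0 the integrand is at most e^(1/2) e^(-|t|). *)
Lemma integral_gauss1 : exists2 c : R, 0 < c &
  (\int[mu]_t (expR (- (t ^+ 2) / 2))%:E)%E = c%:E.
Proof.
set I := (\int[mu]_t _)%E.
have e2 : 0 <= expR (2^-1 : R) by exact: expR_ge0.
have Ilty : (I < +oo)%E.
  apply: (@le_lt_trans _ _
    ((expR 2^-1)%:E * ((expR (1 * 0) / 1)%:E + (expR (- 1 * (- 1)) / 1)%:E))%E).
    rewrite -(@integral_expR_lt R 1 0)// -(@integral_expR_gt R 1 (-1))//.
    have q1 (x : R) : (0 <= (if x < 0 then expR (1 * x) else 0)%:E)%E.
      by rewrite lee_fin; case: ifP => // _; exact: expR_ge0.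
    have q2 (x : R) : (0 <= (if -1 < x then expR (- 1 * x) else 0)%:E)%E.
      by rewrite lee_fin; case: ifP => // _; exact: expR_ge0.
    rewrite -ge0_integral_add//; [|by mfun|by mfun].
    rewrite -ge0_integral_scale//; [|by mfun|by move=> x; rewrite adde_ge0].
    apply: ge0_integral_le => x; first by rewrite lee_fin expR_ge0.
    have := q1 x; have := q2 x; rewrite !lee_fin => h2 h1.
    have [x0|x0] := ltP x 0.
      apply: (@le_trans _ _ (expR 2^-1 * expR (1 * x))).
        rewrite -expRD ler_expR; have := sqr_ge0 (x + 1); rewrite expr2 => H.
        by rewrite expr2; lra.
      by rewrite ler_wpM2l// lerDl.
    have -> : -1 < x by lra.
    rewrite add0r -expRD ler_expR; have := sqr_ge0 (x - 1); rewrite expr2 => H.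
    by rewrite expr2; lra.
  by rewrite -EFinD -EFinM ltry.
have Igt : (0 < I)%E.
  apply: (@lt_le_trans _ _ (expR (- 1 / 2))%:E); first by rewrite lte_fin expR_gt0.
  rewrite -[leLHS]mule1 -[X in (_ * X)%E](_ : mu `[0%R, 1%R] = 1%E); last first.
    by rewrite lebesgue_measure_itv/= lte_fin ltr01 oppr0 adde0.
  rewrite -integral_cst// integral_mkcond.
  apply: ge0_integral_le => x; rewrite patchE; case: ifPn => //.
  - by rewrite lee_fin expR_ge0.
  - rewrite inE/= in_itv/= => /andP[x0 x1]; rewrite lee_fin ler_expR.
    by rewrite ler_pM2r ?invr_gt0// lerN2 expr_le1.
  - by rewrite lee_fin expR_ge0.
exists (fine I); first by rewrite fine_gt0// Igt.
by rewrite fineK// ge0_fin_numE// ltW.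
Qed.

Lemma measurable_gauss d (T : measurableType d) m (x : T -> 'rV[R]_m) :
  mmx x -> measurable_fun setT (fun t => expR (- sqn (x t) / 2)).
Proof. by move=> mx; have ms := measurable_sqn mx; mfun. Qed.

Lemma iint_gauss m : exists2 c : R, 0 < c &
  iint (fun v : 'rV[R]_m => (expR (- sqn v / 2))%:E) = c%:E.
Proof.
have [c1 c10 c1E] := integral_gauss1.
elim: m => [|m [c c0 cE]].
  by exists 1 => //=; rewrite /sqn big_ord0 oppr0 mul0r expR0.
exists (c1 * c); first by rewrite mulr_gt0.
rewrite iintS EFinM -c1E -ge0_integralZr; first last.
- by rewrite lee_fin ltW.
- by move=> x _; rewrite lee_fin expR_ge0.
- by mfun.
- exact: measurableT.
apply: eq_integral => s _; rewrite -cE -iintZl; first last.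
- by rewrite lee_fin expR_ge0.
- by move=> x; rewrite lee_fin expR_ge0.
- by move=> d T x mx; apply: measurable_fun_EFin; exact: measurable_gauss.
congr iint; apply/funext => v; rewrite -EFinM -expRD sqn_cons.
by congr (expR _)%:E; lra.
Qed.

Section FullRank.
Context (m l : nat).
Notation N := (m + l)%N.

Lemma measurable_singular d (T : measurableType d) (x : T -> 'rV[R]_(m * N)) :
  mmx x -> measurable_fun setT
    (fun t => if \det (lsubmx (vec_mx (x t))) == 0 then 1%E else 0%E : \bar R).
Proof.
move=> mx; apply: measurable_fun_ifT; [|by mfun|by mfun].
apply: measurable_fun_eqr; last by mfun.
apply: mmx_det => i j.
by apply: measurable_fun_ext (mmx_vec_mx mx i (lshift l j)) => t; rewrite mxE.
Qed.

(* Averaging over the translations [G + s [1 0]], which are singular for only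
   finitely many [s]. *)
Lemma iint_singular : iint (fun v : 'rV[R]_(m * N) =>
  if \det (lsubmx (vec_mx v)) == 0 then 1%E else 0%E) = 0%E.
Proof.
set Z := fun v : 'rV[R]_(m * N) => _.
have Z0 v : (0 <= Z v)%E by rewrite /Z; case: ifP.
have mZ : bmeas Z by move=> d T x mx; exact: measurable_singular.
pose j : 'rV[R]_(m * N) := mxvec (row_mx 1%:M 0).
pose c (s : R) : \bar R := if (0 < s) && (s <= 1) then 1%E else 0%E.
have c0 s : (0 <= c s)%E by rewrite /c; case: ifP.
have mc : measurable_fun setT c by rewrite /c; mfun.
have c1 : (\int[mu]_s c s)%E = 1%E.
  transitivity (\int[mu]_(s in `]0%R, 1%R]) (cst 1%E) s)%E.
    rewrite [RHS]integral_mkcond; apply: eq_integral => x _.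
    by rewrite patchE mem_setE in_itv/= /c; case: ifP.
  by rewrite integral_cst//= lebesgue_measure_itv/= lte_fin ltr01 mul1e oppr0 adde0.
have E s : (c s * iint Z)%E = iint (fun v => c s * Z (v + s *: j)%R)%E.
  rewrite iintZl//; first by rewrite iint_shift.
  by move=> d T x mx; apply: mZ; apply: mmx_add => //; exact: mmx_cst.
have -> : iint Z = (\int[mu]_s (c s * iint Z))%E.
  rewrite ge0_integralZr ?c1 ?mul1e//; exact: iint_ge0.
under eq_integral do rewrite E.
rewrite iint_tonelli; first last.
- by move=> s v; rewrite mule_ge0.
- move=> d T y x my mx; apply: emeasurable_funM; first by mfun.
  apply: mZ; apply: mmx_add => // a b.
  apply: (measurable_fun_ext (g := fun t => y t * j a b)) => [t|]; first by rewrite mxE.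
  by mfun.
rewrite -[RHS](iint0 (m * N)); congr iint; apply/funext => v.
apply/eqP; rewrite eq_le; apply/andP; split; last first.
  by apply: integral_ge0 => s _; rewrite mule_ge0.
rewrite -(negligible_singular_shift (lsubmx (vec_mx v))).
apply: ge0_integral_le => s; first by rewrite mule_ge0.
rewrite /Z linearD /= linearZ /= /j mxvecK.
rewrite (_ : lsubmx _ = lsubmx (vec_mx v) + s%:M); last first.
  rewrite linearD /= linearZ /= row_mxKl; congr (_ + _).
  by rewrite scale_scalar_mx mulr1.
rewrite /c; case: ifP => _; rewrite ?mul1e ?mul0e//; by case: ifP.
Qed.

Lemma measurable_full_rank d (T : measurableType d) (x : T -> 'rV[R]_(m * N)) :
  mmx x -> measurable_fun setT (fun t => \rank (vec_mx (x t) : 'M[R]_(m, N)) == m).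
Proof.
move=> mx; have mv := mmx_vec_mx mx.
apply: (measurable_fun_ext (g := fun t => 0 < `|\det (vec_mx (x t) *m (vec_mx (x t))^T)|)).
  by move=> t; rewrite rank_gram.
apply: measurable_fun_ltr; first by mfun.
apply: (measurableT_comp (@normr_measurable R setT)); apply: mmx_det.
exact: mmx_mul mv (mmx_tr mv).
Qed.

(** The unnormalized Gaussian density of [Xi_int], cut off where the row space has too small a
    dimension. *)
Definition rank_gauss (v : 'rV[R]_(m * N)) : R :=
  if \rank (vec_mx v : 'M[R]_(m, N)) == m then expR (- sqn v / 2) else 0.

Lemma rank_gauss_ge0 v : 0 <= rank_gauss v.
Proof. by rewrite /rank_gauss; case: ifP => // _; exact: expR_ge0. Qed.

Lemma measurable_rank_gauss d (T : measurableType d) (x : T -> 'rV[R]_(m * N)) :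
  mmx x -> measurable_fun setT (fun t => rank_gauss (x t)).
Proof.
move=> mx; apply: measurable_fun_ifT; first exact: measurable_full_rank.
  exact: measurable_gauss.
exact: measurable_cst.
Qed.

(** A rank-deficient matrix has a singular left square block, and such matrices are negligible, so
    the cutoff loses no Gaussian mass. *)
Lemma full_rank_gauss : exists2 c : R, 0 < c &
  iint (fun v => (rank_gauss v)%:E) = c%:E.
Proof.
have [c c0 cE] := iint_gauss (m * N).
exists c => //; apply/eqP; rewrite eq_le -cE; apply/andP; split.
  apply: iint_le => v; rewrite lee_fin ?rank_gauss_ge0// /rank_gauss.
  by case: ifP => // _; exact: expR_ge0.
rewrite -[leRHS]adde0 -iint_singular -iintD; first last.
- by move=> v; case: ifP.
- by move=> v; rewrite lee_fin rank_gauss_ge0.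
- by move=> d T x mx; exact: measurable_singular.
- by move=> d T x mx; apply: measurable_fun_EFin; exact: measurable_rank_gauss.
apply: iint_le => v; first by rewrite lee_fin expR_ge0.
rewrite /rank_gauss; case: ifPn => rv.
  by rewrite -[leLHS]adde0 leeD2l//; case: ifP.
rewrite add0e ifT; first by rewrite lee_fin expR_le1; have := sqn_ge0 v; lra.
apply: contraNT rv => dn; rewrite eqn_leq rank_leq_row /=.
have uL : lsubmx (vec_mx v : 'M[R]_(m, N)) \in unitmx by rewrite unitmxE unitfE.
have : row_free (lsubmx (vec_mx v : 'M[R]_(m, N))) by rewrite row_free_unit.
rewrite -row_leq_rank => /leq_trans; apply.
have -> : lsubmx (vec_mx v : 'M[R]_(m, N)) = vec_mx v *m (col_mx 1%:M 0 : 'M[R]_(N, m)).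
  by rewrite -{2}[vec_mx v]hsubmxK mul_row_col mulmx1 mulmx0 addr0.
exact: mxrankM_maxl.
Qed.

(** Right multiplication by [Q] is linear on vectorized matrices and preserves the sum of squares,
    hence is itself orthogonal: the rotation invariance of the Gaussian law. *)
Lemma rank_gauss_orthogonal (Q : 'M[R]_N) : orthogonal_mx Q ->
  exists2 M : 'M[R]_(m * N), orthogonal_mx M &
  forall v, vec_mx (v *m M) = vec_mx v *m Q :> 'M[R]_(m, N)
    /\ rank_gauss (v *m M) = rank_gauss v.
Proof.
move=> oQ; pose M : 'M[R]_(m * N) := lin_mx (mulmxr Q).
have ME (v : 'rV[R]_(m * N)) : vec_mx (v *m M) = vec_mx v *m Q :> 'M[R]_(m, N).
  by rewrite -{1}[v]vec_mxK /M mul_vec_lin mxvecK.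
have sM (v : 'rV[R]_(m * N)) : sqn (v *m M) = sqn v.
  rewrite -[v *m M]vec_mxK ME sqn_mxvec_row -[in RHS](vec_mxK v) sqn_mxvec_row.
  by apply: eq_bigr => i _; rewrite row_mul sqn_orthogonal.
exists M; first exact: isometry_orthogonal.
move=> v; split => //; rewrite /rank_gauss ME sM mxrankMfree//.
by rewrite row_free_unit; case: (mulmx1_unit oQ).
Qed.

End FullRank.

(* The double integral of [rank_gauss v * wt (sqn u) * Psi (proj G u / sqn u)],
   with [G = vec_mx v], is computed by rotating [G] for fixed [u] and by
   rotating [u] for fixed [G]. *)
Lemma grassmannian_zonal k l : exists2 C : R, 0 < C &
  forall Psi : R -> \bar R, measurable_fun setT Psi -> (forall t, 0 <= Psi t)%E ->
  iint (fun v : 'rV[R]_(k.+1 * (k.+1 + l.+1)) =>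
    (rank_gauss v)%:E * Psi (proj (vec_mx v) (origin R (k + l.+1))))%E =
  (C%:E * \int[mu]_x ((expR (l.+1%:R / 2 * x
      - (k.+1 + l.+1)%:R / 2 * softplus x))%:E * Psi (expR (- softplus x))))%E.
Proof.
set m := k.+1; set N := (m + l.+1)%N.
have [kap kap0 kapE] := full_rank_gauss m l.+1.
have [Cr Cr0 HCr] := iint_radial R (k + l.+1).
have [C C0 HC] := iint_polar R k l.
have N0 : 0 < (N%:R / 2 : R) by rewrite divr_gt0.
(* The cutoff gives the integral in [u] a finite positive value, to be divided out at the end, and
   it excludes u = 0, where the quotient by [sqn u] has no meaning. *)
pose wt (q : R) : \bar R := if (0 < q) && (q <= 1) then 1%E else 0%E.
have wt0 q : (0 <= wt q)%E by rewrite /wt; case: ifP.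
have mwt : measurable_fun setT wt by rewrite /wt; mfun.
pose W := expR (N%:R / 2 * 0) / (N%:R / 2) : R.
have W0 : 0 < W by rewrite divr_gt0// expR_gt0.
have WE : (\int[mu]_y ((expR (N%:R / 2 * y))%:E * wt (expR y)) = W%:E)%E.
  rewrite -integral_expR_le//; apply: eq_integral => y _.
  by rewrite /wt expR_gt0 expR_le1 /=; case: ifP => _; rewrite ?mule1 ?mule0.
have c1E : iint (fun u : 'rV[R]_N => wt (sqn u)) = (Cr * W)%:E.
  by rewrite [LHS](HCr wt mwt wt0) WE.
exists (kap * (Cr * W)^-1 * (C * W)).
  by rewrite !mulr_gt0// invr_gt0 mulr_gt0.
move=> Psi mPsi Psi0; have msp := @measurable_softplus R.
set e := origin R _.
set I := iint _.
set K := (\int[mu]_x _)%E.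
have I0 : (0 <= I)%E.
  by apply: iint_ge0 => v; rewrite mule_ge0 ?lee_fin ?rank_gauss_ge0.
pose J (v : 'rV[R]_(m * N)) (u : 'rV[R]_N) : \bar R :=
  ((rank_gauss v)%:E * (wt (sqn u) * Psi (proj (vec_mx v) u / sqn u)%R))%E.
have J0 v u : (0 <= J v u)%E.
  by rewrite /J !mule_ge0// lee_fin rank_gauss_ge0.
have mJ : bmeas2 J.
  move=> d T x y mx my; apply: emeasurable_funM.
    by apply: measurable_fun_EFin; exact: measurable_rank_gauss.
  have ms := measurable_sqn my; have mp := measurable_proj (mmx_vec_mx mx) my.
  by mfun.
have mg : bmeas (fun v : 'rV[R]_(m * N) => (rank_gauss v)%:E * Psi (proj (vec_mx v) e))%E.
  move=> d T x mx; apply: emeasurable_funM.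
    by apply: measurable_fun_EFin; exact: measurable_rank_gauss.
  by have mp := measurable_proj (mmx_vec_mx mx) (@mmx_cst R d T _ _ e); mfun.
(* For fixed [u], a rotation takes the origin to u/|u|; it is transferred to the matrix, whose law
   it preserves. *)
have way1 : iint (fun u => iint (fun v => J v u)) = ((Cr * W)%:E * I)%E.
  rewrite -c1E muleC -iintZl//; last first.
    by move=> d T x mx; have ms := measurable_sqn mx; mfun.
  congr iint; apply/funext => u; rewrite muleC.
  have [u0|u0] := boolP ((0 < sqn u) && (sqn u <= 1)); last first.
    rewrite /J /wt (negPf u0) mul0e -[RHS](iint0 (m * N)).
    by congr iint; apply/funext => v; rewrite mul0e mule0.
  have [Q oQ uQ] : exists2 Q : 'M[R]_N, orthogonal_mx Q & e *m Q = (vnorm u)^-1 *: u.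
    apply: householder; rewrite [LHS]sqn_origin sqnZ -sqrr_vnorm exprVn mulVf//.
    by rewrite sqrr_vnorm; case/andP: u0 => /gt_eqF ->.
  have pu (G : 'M[R]_(m, N)) : proj G u / sqn u = proj (G *m Q^T) e.
    rewrite -proj_orthogonal// uQ projZ exprVn sqrr_vnorm mulrC //.
  have [M oM HM] := @rank_gauss_orthogonal m l.+1 Q^T (orthogonal_mx_tr oQ).
  rewrite /J /wt u0 mul1e /I -[RHS](iint_orthogonal oM mg)//; last first.
    by move=> v; rewrite mule_ge0 ?lee_fin ?rank_gauss_ge0.
  by congr iint; apply/funext => v; have [-> ->] := HM v; rewrite mul1e pu.
(* For fixed [G], the rotation of the LQ decomposition turns the projection into the first k + 1
   coordinates u1, and the quotient into |u1|^2 / (|u1|^2 + |u2|^2). *)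
have way2 : iint (fun v => iint (fun u => J v u)) = (kap%:E * ((C * W)%:E * K))%E.
  have K0 : (0 <= K)%E.
    by apply: integral_ge0 => x _; rewrite mule_ge0 ?lee_fin ?expR_ge0.
  rewrite -kapE muleC -iintZl; first last.
  - by rewrite mule_ge0// lee_fin mulr_ge0// ltW.
  - by move=> v; rewrite lee_fin rank_gauss_ge0.
  - by move=> d T x mx; apply: measurable_fun_EFin; exact: measurable_rank_gauss.
  congr iint; apply/funext => v; rewrite muleC /J.
  rewrite iintZl; first last.
  - by rewrite lee_fin rank_gauss_ge0.
  - by move=> u; rewrite mule_ge0.
  - move=> d T x mx; have ms := measurable_sqn mx.
    by have mp := measurable_proj (@mmx_cst R d T _ _ (vec_mx v : 'M[R]_(m, N))) mx; mfun.
  rewrite /rank_gauss; case: ifPn => [/eqP rv|_]; last by rewrite !mul0e.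
  congr (_ * _)%E.
  have [Q oQ [B GQ]] := lq_decomposition (vec_mx v : 'M[R]_(m, N)).
  have uB : B \in unitmx by rewrite -row_free_unit -row_leq_rank -(lq_rank oQ GQ) rv.
  pose f (u : 'rV[R]_N) := (wt (sqn u) * Psi (sqn (lsubmx u) / sqn u)%R)%E.
  transitivity (iint (fun u => f (u *m Q))).
    congr iint; apply/funext => u.
    by rewrite /f sqn_orthogonal// (lq_proj oQ GQ u uB).
  rewrite iint_orthogonal//; first last.
  - by move=> u; rewrite mule_ge0.
  - move=> d T x mx; have ms := measurable_sqn mx.
    have ml : measurable_fun setT (fun t => sqn (lsubmx (x t))).
      apply: measurable_sqn => i j.
      by apply: measurable_fun_ext (mx i (lshift l.+1 j)) => t; rewrite mxE.
    by rewrite /f; mfun.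
  rewrite iint_row_mx.
  pose Phi (s t : R) := (wt (s + t)%R * Psi (s / (s + t))%R)%E.
  transitivity (iint (fun u : 'rV[R]_k.+1 => iint (fun v : 'rV[R]_l.+1 =>
      Phi (sqn u) (sqn v)))).
    congr iint; apply/funext => u1; congr iint; apply/funext => u2.
    by rewrite /f sqn_row_mx row_mxKl.
  rewrite (HC Phi wt (fun x => Psi (expR (- softplus x)))); first last.
  - move=> y z; rewrite /Phi.
    have -> : expR y + expR z = expR (y + softplus (z - y)).
      by rewrite expRD expR_softplus mulrDr mulr1 -expRD (addrC y) subrK.
    by rewrite -expRB; congr (_ * Psi (expR _))%E; ring.
  - by move=> x; exact: Psi0.
  - by mfun.
  - exact: wt0.
  - exact: mwt.
  - by move=> x y; rewrite mule_ge0.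
  - by rewrite /Phi; mfun.
  by rewrite WE [X in (_ * X)%E]muleC muleA -EFinM.
have CW : (Cr * W) != 0 by rewrite gt_eqF// mulr_gt0.
have := iint_swap mJ J0; rewrite way1 way2.
move=> /(congr1 (fun z => ((Cr * W)^-1)%:E * z)%E).
rewrite !muleA -!EFinM mulVf// mul1e => <-; congr (_%:E * _)%E; ring.
Qed.

End Grassmannian.

(** * Reduction to one variable *)

Section Reduction.
Context (R : realType).
Notation mu := (@lebesgue_measure R).

(* In the variables [v = ln (tan^2 d(0,xi))] and [z = ln (tan^2 d(0,x))], [Top] is
   the Radon transform of a radial profile [Phi] (up to a constant), and [wgt] is the
   density of both measures and their weights; [cosr z] is [cos d(0,x)]. *)
Definition ekern (ka v z : R) : R :=
  if v < z then expR (ka * z + (ka - 1) * ln (1 - expR (v - z))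
                      - (ka + 2^-1) * softplus z + 2^-1 * softplus v) else 0.

Lemma ekern_ge0 ka v z : 0 <= ekern ka v z.
Proof. by rewrite /ekern; case: ifP => // _; exact: expR_ge0. Qed.

Lemma measurable_ekern d (T : measurableType d) ka (v z : T -> R) :
  measurable_fun setT v -> measurable_fun setT z ->
  measurable_fun setT (fun t => ekern ka (v t) (z t)).
Proof.
by move=> mv mz; have msp := @measurable_softplus R; rewrite /ekern; mfun.
Qed.

(** Three substitutions: t = e^x, the affine map u = e^v + t (1 + e^v), and u = e^z. The condition t
    > 0 becomes v < z, and the remaining powers of 1 + e^v combine into its square root. *)
Lemma integral_ekern (ka v : R) (Phi : R -> \bar R) :
  measurable_fun setT Phi -> (forall z, 0 <= Phi z)%E ->
  (\int[mu]_x ((expR (ka * x - (ka + 2^-1) * softplus x))%:E *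
      Phi (ln (expR v + expR x * (1 + expR v)))) =
   \int[mu]_z ((ekern ka v z)%:E * Phi z))%E.
Proof.
move=> mPhi Phi0; set b := 1 + expR v.
have b0 : 0 < b by rewrite addr_gt0// expR_gt0.
have lnb : ln b = softplus v by [].
have ev0 := expR_gt0 v.
have msp := @measurable_softplus R.
pose g (t : R) := ((expR ((ka - 1) * ln t - (ka + 2^-1) * ln (1 + t)))%:E *
   Phi (ln (expR v + t * b)))%E.
have mg : measurable_fun setT g by rewrite /g; mfun.
have g0 t : (0 <= g t)%E by rewrite mule_ge0// lee_fin expR_ge0.
pose G (t : R) := if 0 < t then g t else 0%E.
have mG : measurable_fun setT G by rewrite /G; mfun.
have G0 t : (0 <= G t)%E by rewrite /G; case: ifP.
pose H (u : R) := ((b^-1)%:E * G (b^-1 * u + - expR v / b)%R)%E.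
have mH : measurable_fun setT H.
  by apply: emeasurable_funM; [mfun|apply: (measurableT_comp mG); mfun].
have bV0 : 0 <= b^-1 by rewrite invr_ge0 ltW.
have H0 u : (0 <= H u)%E by rewrite mule_ge0.
transitivity (\int[mu]_x ((expR x)%:E * g (expR x)))%E.
  apply: eq_integral => x _; rewrite /g muleA -EFinM -expRD expRK.
  by congr ((expR _)%:E * _)%E; rewrite /softplus; ring.
rewrite (ge0_integral_exp mg g0).
have -> : (\int[mu]_t G t = \int[mu]_u H u)%E.
  rewrite ge0_integral_scale//; last by apply: (measurableT_comp mG); mfun.
  have bn : b^-1 != 0 by rewrite invr_eq0 gt_eqF.
  rewrite (ge0_integral_affine _ mG G0 bn) muleA -EFinM ger0_norm// divff//.
  by rewrite mul1e.
(* The support t > 0 lies in u > e^v > 0, so restricting to u > 0 changes nothing. *)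
have HE u : (if 0 < u then H u else 0%E) = H u.
  case: ifPn => //; rewrite -leNgt => u0; rewrite /H /G ifF ?mule0//.
  apply/negbTE; rewrite -leNgt mulNr.
  have -> : b^-1 * u - expR v / b = (u - expR v) / b by ring.
  by rewrite pmulr_lle0 ?invr_gt0// subr_le0 (le_trans u0)// ltW.
transitivity (\int[mu]_u (if (0 < u)%R then H u else 0))%E.
  by apply: eq_integral => u _; rewrite HE.
rewrite -(ge0_integral_exp mH H0); apply: eq_integral => z _.
rewrite /H /G /ekern.
have -> : b^-1 * expR z + - expR v / b = (expR z - expR v) / b by ring.
rewrite pmulr_lgt0 ?invr_gt0// subr_gt0 ltr_expR.
case: ifPn => vz; last by rewrite !mule0 mul0e.
have d0 : 0 < expR z - expR v by rewrite subr_gt0 ltr_expR.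
rewrite /g divfK ?gt_eqF// [expR v + _]addrC subrK expRK !muleA; congr (_ * _)%E.
rewrite -!EFinM; congr (_%:E).
have -> : 1 + (expR z - expR v) / b = (1 + expR z) / b.
  by rewrite /b; field; rewrite -/b gt_eqF.
have z0 : 0 < 1 + expR z by rewrite addr_gt0// expR_gt0.
have -> : expR z - expR v = expR z * (1 - expR (v - z)).
  by rewrite mulrBr mulr1 -expRD (addrC z) subrK.
have q0 : 0 < 1 - expR (v - z) by rewrite subr_gt0 expR_lt1 subr_lt0.
rewrite !ln_div ?posrE ?mulr_gt0 ?expR_gt0// lnM ?posrE ?expR_gt0// expRK lnb.
rewrite -[b^-1](@lnK R) ?posrE ?invr_gt0// lnV ?posrE// lnb -!expRD.
by congr expR; rewrite /softplus; field.
Qed.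

Definition Top (ka : R) (Phi : R -> R) (v : R) : \bar R :=
  (\int[mu]_z (ekern ka v z * Phi z)%:E)%E.

Definition wgt (a s z : R) : R := expR (a * z - s * softplus z).

Lemma measurable_wgt a s : measurable_fun setT (wgt a s).
Proof. by have msp := @measurable_softplus R; rewrite /wgt; mfun. Qed.

Lemma measurable_Top ka (Phi : R -> R) : measurable_fun setT Phi -> (forall z, 0 <= Phi z) ->
  measurable_fun setT (Top ka Phi).
Proof.
move=> mPhi P0; apply: (measurable_integral_param (f := fun v z => (ekern ka v z * Phi z)%:E)).
  apply: measurable_fun_EFin; apply: measurable_funM; last by mfun.
  by apply: measurable_ekern; mfun.
by move=> v z; rewrite lee_fin mulr_ge0// ekern_ge0.
Qed.

Lemma Top_ge0 ka (Phi : R -> R) v : (forall z, 0 <= Phi z) -> (0 <= Top ka Phi v)%E.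
Proof.
by move=> P0; apply: integral_ge0 => z _; rewrite lee_fin mulr_ge0// ekern_ge0.
Qed.

Definition cosr (z : R) : R := expR (- (softplus z / 2)).

(** The spherical Pythagorean theorem, in the form (1 + e^v)(1 + e^x) = 1 + (e^v + e^x (1 +
    e^v)). *)
Lemma cosr_mul v x :
  cosr v * cosr x = cosr (ln (expR v + expR x * (1 + expR v))).
Proof.
have p0 : 0 < expR v + expR x * (1 + expR v).
  by rewrite addr_gt0 ?mulr_gt0 ?addr_gt0 ?expR_gt0.
rewrite /cosr -expRD /softplus lnK ?posrE//.
have -> : 1 + (expR v + expR x * (1 + expR v)) = (1 + expR v) * (1 + expR x) by ring.
by rewrite lnM ?posrE ?addr_gt0 ?expR_gt0//; congr expR; field.
Qed.

Lemma cosr_gt0 z : 0 < cosr z. Proof. exact: expR_gt0. Qed.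

Lemma cosr_le1 z : cosr z <= 1.
Proof. by rewrite /cosr expR_le1 oppr_le0 divr_ge0// ltW// softplus_gt0. Qed.

Lemma measurable_cosr : measurable_fun setT cosr.
Proof. by have msp := @measurable_softplus R; rewrite /cosr; mfun. Qed.

Lemma sqr_cosr z : cosr z ^+ 2 = expR (- softplus z).
Proof. by rewrite /cosr -expRM_natl; congr expR; field. Qed.

Lemma sinr z : Num.sqrt (1 - cosr z ^+ 2) = expR ((z - softplus z) / 2).
Proof.
rewrite sqr_cosr -sqrt_expR; congr Num.sqrt.
rewrite expRB expRN expR_softplus; field.
by rewrite gt_eqF// addr_gt0// expR_gt0.
Qed.

Lemma powR_expR (x a : R) : powR (expR x) a = expR (a * x).
Proof. by rewrite mulrC expRM. Qed.

Lemma sqrt_expR_softplus x : Num.sqrt (expR (- softplus x)) = cosr x.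
Proof. by rewrite sqrt_expR /cosr mulNr. Qed.

Lemma sqrt_unit_itv (y : R) : y <= 1 -> -1 <= Num.sqrt y <= 1.
Proof.
move=> y1; apply/andP; split; last by rewrite -[leRHS](@sqrtr1 R) ler_sqrt.
by apply: le_trans (sqrtr_ge0 _); rewrite lerN10.
Qed.

Lemma acos_sqrt_lt (y : R) : 0 <= y <= 1 -> (acos (Num.sqrt y) < pi / 2) = (0 < y).
Proof.
move=> /andP[y0 y1]; have s1 := sqrt_unit_itv y1.
rewrite -ltr_cos ?in_itv/= ?acos_ge0 ?acos_lepi//; last first.
  by rewrite divr_ge0 ?pi_ge0//= ler_pdivrMr// ler_peMr ?pi_ge0// ler1n.
by rewrite cos_pihalf acosK ?in_itv// sqrtr_gt0.
Qed.

Lemma norm_max0 (x : R) : `|x| = Num.max x 0 + Num.max (- x) 0.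
Proof.
case: (lerP 0 x) => [x0|/ltW x0].
  by rewrite ger0_norm// max_r ?oppr_le0// addr0.
by rewrite ler0_norm// max_l ?oppr_ge0// add0r.
Qed.

Section Norms.
Context (k l : nat).
Local Notation n := (k.+1 + l.+1)%N.

(** [F] is only assumed measurable on [0, 1]; this extension by 0 is measurable on the whole line
    and agrees with [F] at all values taken on the sphere. *)
Definition F01 (F : R -> R) (t : R) : R := if (0 <= t) && (t <= 1) then F t else 0.

Lemma measurable_F01 (F : R -> R) : measurable_fun (`[0, 1] : set R) F ->
  measurable_fun setT (F01 F).
Proof.
move=> mF; have -> : F01 F = F \_ `[0, 1].
  by apply/funext => t; rewrite /F01 patchE mem_setE in_itv.
by apply: (measurable_restrictT _ _).1 mF; exact: measurable_itv.
Qed.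

Lemma F01_cosr F z : F01 F (cosr z) = F (cosr z).
Proof. by rewrite /F01 ltW ?cosr_gt0// cosr_le1. Qed.

Lemma F01_unit F (x : 'rV[R]_n.+1) : vnorm x = 1 ->
  F01 F `|x 0 ord_max| = F `|x 0 ord_max|.
Proof.
move=> x1; rewrite /F01 normr_ge0 -vdot_origin abs_vdot_le1//.
exact: sqn_origin.
Qed.

(** The exponents collect the surface density e^(nz/2) (1 + e^z)^(-(n+1)/2) with sin = e^((z -
    softplus z)/2) and cos = e^(-softplus z/2). *)
Lemma normS_log : exists2 C : R, 0 < C & forall (F : R -> R) (p a1 a2 : R),
  measurable_fun (`[0, 1] : set R) F ->
  normS p a1 a2 (fun x : 'rV[R]_n.+1 => F `|x 0 ord_max|) =
  ((C%:E * \int[mu]_z (wgt ((a1 + n%:R) / 2) ((n.+1%:R + a1 + a2) / 2) z *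
      powR `|F (cosr z)| p)%:E) `^ p^-1)%E.
Proof.
have [C C0 HC] := sph_int_zonal R (k + l.+1); exists C => // F p a1 a2 mF.
rewrite /normS; congr (_ `^ _)%E.
pose phi (t : R) : \bar R := (powR `|F01 F t| p * powR (Num.sqrt (1 - t ^+ 2)) a1
   * powR t a2)%:E.
have mF1 := measurable_F01 mF; have msq := @measurable_sqrtr R.
have mabs : measurable_fun setT (fun t => `|F01 F t|).
  exact: (measurableT_comp (@normr_measurable R setT) mF1).
have mphi : measurable_fun setT phi.
  apply: measurable_fun_EFin; apply: measurable_funM; last by mfun.
  apply: measurable_funM; last by mfun.
  exact: (measurableT_comp (@measurable_powR R p) mabs).
have phi0 t : (0 <= phi t)%E by rewrite lee_fin !mulr_ge0// powR_ge0.
transitivity (sph_int (fun x : 'rV[R]_n.+1 => phi `|x 0 ord_max|)).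
  rewrite /sph_int; congr (_ * iint _)%E; apply/funext => y.
  case: ifPn => // /andP[y0 _]; set x := (vnorm y)^-1 *: y.
  have x1 : vnorm x = 1 by exact: vnorm_unit.
  have xl : `|x 0 ord_max| <= 1 by rewrite -vdot_origin abs_vdot_le1// sqn_origin.
  have := xl; rewrite ler_norml => xi.
  have xI : x 0 ord_max \in `[-1, 1] by rewrite in_itv.
  rewrite /phi (F01_unit F x1) /sphdist vdotC vdot_origin (sin_acos xi) (acosK xI).
  by rewrite real_normK ?num_real.
rewrite (HC phi mphi phi0); congr (_ * _)%E; apply: eq_integral => z _.
rewrite /phi -/(cosr z) F01_cosr sinr /cosr !powR_expR -EFinM; congr (_%:E).
rewrite /wgt mulrCA [RHS]mulrC -!mulrA; congr (_ * _).
by rewrite -!expRD; congr expR; rewrite -[in RHS]natr1; field.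
Qed.

Definition pos_part (F : R -> R) z := Num.max (F (cosr z)) 0.

Lemma measurable_pos_part F : measurable_fun (`[0, 1] : set R) F ->
  measurable_fun setT (pos_part F).
Proof.
move=> mF; apply: (measurable_fun_ext (g := fun z => Num.max (F01 F (cosr z)) 0)).
  by move=> z; rewrite F01_cosr.
apply: measurable_maxr; last by mfun.
exact: (measurableT_comp (measurable_F01 mF) measurable_cosr).
Qed.

Lemma pos_part_ge0 F z : 0 <= pos_part F z.
Proof. by rewrite /pos_part le_max lexx orbT. Qed.

(** Here the dimension is k + 1 and the codimension l + 1. The two integrals whose difference
    defines [radon] become one [Top] each; they are kept apart because both may be infinite. *)
Lemma normXi_log : exists CX CT : R, [/\ 0 < CX, 0 < CT &
  forall (F : R -> R) (r b1 b2 : R),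
  measurable_fun (`[0, 1] : set R) F -> 
  normXi r b1 b2 (radon (k := k.+1) (fun x : 'rV[R]_n.+1 => F `|x 0 ord_max|)) =
  ((CX%:E * \int[mu]_x ((wgt ((b1 + l.+1%:R) / 2) ((n.+1%:R + b1 + b2) / 2) x)%:E *
      `|CT%:E * Top (k.+1%:R / 2) (pos_part F) x
        - CT%:E * Top (k.+1%:R / 2) (pos_part (fun t => - F t)%R) x| `^ r)) `^ r^-1)%E].
Proof.
have [CT CT0 HCT] := xi_int_zonal R k.
have [CX CX0 HCX] := grassmannian_zonal R k.+1 l.
exists CX, CT; split => // F r b1 b2 mF.
have mFN : measurable_fun (`[0, 1] : set R) (fun t => - F t) by exact: measurable_funN.
rewrite /normXi; congr (_ `^ _)%E.
have msp := @measurable_softplus R; have msq := @measurable_sqrtr R.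
have mc := measurable_cosr.
pose phi (H : R -> R) (t : R) : \bar R := (Num.max (F01 H t) 0)%:E.
have phi0 H t : (0 <= phi H t)%E by rewrite lee_fin le_max lexx orbT.
have mphi H : measurable_fun (`[0, 1] : set R) H -> measurable_fun setT (phi H).
  move=> mH; apply: measurable_fun_EFin; apply: measurable_maxr; last by mfun.
  exact: measurable_F01.
pose TT (H : R -> R) (y : R) := (CT%:E * \int[mu]_x
  ((expR (k.+1%:R / 2 * x - k.+2%:R / 2 * softplus x))%:E *
   phi H (Num.sqrt y * cosr x)%R))%E.
have mTT H : measurable_fun (`[0, 1] : set R) H -> measurable_fun setT (TT H).
  move=> mH; have mp := mphi _ mH; apply: emeasurable_funM; first by mfun.
  have mker : measurable_fun setT (fun w : R * R =>
      ((expR (k.+1%:R / 2 * w.2 - k.+2%:R / 2 * softplus w.2))%:E *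
       phi H (Num.sqrt w.1 * cosr w.2)%R)%E).
    by apply: emeasurable_funM; [mfun|apply: (measurableT_comp mp); mfun].
  apply: (measurable_integral_param (f := fun (y x : R) =>
    ((expR (k.+1%:R / 2 * x - k.+2%:R / 2 * softplus x))%:E *
     phi H (Num.sqrt y * cosr x)%R)%E) mker).
  by move=> y x; rewrite mule_ge0// lee_fin expR_ge0.
(* The value 0 for y <= 0 encodes the exclusion of subspaces at distance pi/2, where the projection
   vanishes. *)
pose Psi (y : R) : \bar R := if 0 < y then (`|TT F y - TT (fun t => - F t)%R y| `^ r *
   (powR (Num.sqrt (1 - y)) b1 * powR (Num.sqrt y) b2)%:E)%E else 0%E.
have mPsi : measurable_fun setT Psi.
  apply: measurable_fun_ifT; [by mfun| |by mfun].
  apply: emeasurable_funM; last by mfun.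
  apply: (measurableT_comp (@measurable_poweR R r)).
  apply: (measurableT_comp (@abse_measurable R setT)).
  by apply: emeasurable_funB; apply: mTT.
have Psi0 y : (0 <= Psi y)%E.
  by rewrite /Psi; case: ifP => // _; rewrite mule_ge0 ?poweR_ge0// lee_fin mulr_ge0// powR_ge0.
have xiE (H : R -> R) (G : 'M[R]_(k.+2, k.+2 + l.+1)) : \rank G = k.+2 ->
    measurable_fun (`[0, 1] : set R) H ->
    xi_int (n := k.+1 + l.+1) G (fun x => (Num.max (H `|x 0 ord_max|) 0)%:E) =
    TT H (proj G (origin R (k.+1 + l.+1))).
  move=> rG mH; rewrite /TT -(HCT _ G (phi H) rG (mphi _ mH) (phi0 H)).
  rewrite /xi_int; congr (_ * (_ * iint _))%E; apply/funext => t.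
  case: ifPn => // /andP[t0 _]; rewrite /phi F01_unit//.
  exact: vnorm_unit.
transitivity (iint (fun v : 'rV[R]_(k.+2 * (k.+2 + l.+1)) =>
    (rank_gauss v)%:E * Psi (proj (vec_mx v) (origin R (k.+1 + l.+1)))))%E.
  rewrite /Xi_int; congr iint; apply/funext => v /=.
  rewrite /rank_gauss; case: ifPn => /=; last first.
    rewrite negb_and => /orP[/negPf ->|dn]; first by rewrite mul0e.
    case: ifPn => [/eqP rv|]; last by rewrite mul0e.
    have [/andP[y0 y1] dE] := @dist0E R k.+1 l.+1 (vec_mx v) rv.
    rewrite /Psi ifF ?mule0//; apply: contraNF dn => yp.
    by rewrite dE acos_sqrt_lt ?y0 ?y1.
  move=> /andP[rv]; rewrite rv; move/eqP: rv => rv.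
  have [/andP[y0 y1] dE] := @dist0E R k.+1 l.+1 (vec_mx v) rv.
  set y := proj _ _ in y0 y1 dE *.
  have s1 := sqrt_unit_itv y1; rewrite dE acos_sqrt_lt ?y0// => yp.
  rewrite /Psi yp -sqn_mxvec vec_mxK; congr (_ * (_ * _))%E.
    by rewrite /radon (xiE F)// (xiE (fun t => - F t)).
  have sI : Num.sqrt y \in `[-1, 1] by rewrite in_itv.
  by rewrite (sin_acos s1) (acosK sI) sqr_sqrtr.
rewrite (HCX Psi mPsi Psi0); congr (_ * _)%E; apply: eq_integral => x _.
have TE (H : R -> R) : measurable_fun (`[0, 1] : set R) H ->
    TT H (expR (- softplus x)) = (CT%:E * Top (k.+1%:R / 2) (pos_part H) x)%E.
  move=> mH; congr (_ * _)%E; rewrite sqrt_expR_softplus.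
  have mpp := measurable_pos_part mH.
  transitivity (\int[mu]_z ((ekern (k.+1%:R / 2) x z)%:E * (pos_part H z)%:E))%E => //.
  rewrite -(@integral_ekern (k.+1%:R / 2) x (fun z => (pos_part H z)%:E)).
  - have -> : k.+1%:R / 2 + 2^-1 = k.+2%:R / 2 :> R by rewrite -[in RHS]natr1; field.
    by apply: eq_integral => z _; rewrite cosr_mul /phi F01_cosr.
  - by mfun.
  - by move=> z; rewrite lee_fin pos_part_ge0.
rewrite /Psi expR_gt0 (TE _ mF) (TE _ mFN).
move: (_ `^ r)%E => A; rewrite muleCA [RHS]muleC; congr (_ * _)%E.
rewrite -EFinM sqrt_expR_softplus -sqr_cosr sinr /cosr !powR_expR /wgt addSn.
by move: n.+1%:R => N; rewrite -!expRD; congr (expR _)%:E; field.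
Qed.

(** Only nonnegative profiles occur; signs are dealt with once, in the passage from [radon_ineq]. *)
Definition ineq1D (ka p r al sa be sb : R) : Prop := exists C : R, forall Phi : R -> R,
  measurable_fun setT Phi -> (forall z, 0 <= Phi z) ->
  (\int[mu]_z (wgt al sa z * powR (Phi z) p)%:E < +oo)%E ->
  ((\int[mu]_x ((wgt be sb x)%:E * Top ka Phi x `^ r)) `^ r^-1 <=
   C%:E * (\int[mu]_z (wgt al sa z * powR (Phi z) p)%:E) `^ p^-1)%E.

(** The map t -> ln (t^-2 - 1) inverts [cosr], so every profile on the line comes from an even
    radial function. *)
Lemma measurable_radial_profile (Phi : R -> R) : measurable_fun setT Phi ->
  measurable_fun (`[0, 1] : set R) (fun t => Phi (ln (t ^- 2 - 1))).
Proof. by move=> mPhi; apply: measurable_funTS; mfun. Qed.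

Lemma radial_profile_cosr (Phi : R -> R) z : Phi (ln (cosr z ^- 2 - 1)) = Phi z.
Proof.
congr Phi; rewrite sqr_cosr expRN invrK expR_softplus.
by rewrite [1 + _]addrC addrK expRK.
Qed.

Lemma poweR_scale_int (c x : R) (I : \bar R) : 0 < c -> (0 <= I)%E ->
  ((c%:E * I) `^ x = (powR c x)%:E * I `^ x)%E.
Proof. by move=> c0 I0; rewrite poweRM// lee_fin ltW. Qed.

(** One direction transplants a nonnegative profile, whose negative part contributes nothing; the
    other applies the one-dimensional bound to |F| and uses |A - B| <= A + B, which stays true when
    both transforms are infinite. *)
Lemma radon_ineq_log (p r a1 a2 b1 b2 : R) : 1 <= p -> 1 <= r ->
  radon_ineq k.+1 n p r a1 a2 b1 b2 <->
  ineq1D (k.+1%:R / 2) p r ((a1 + n%:R) / 2) ((n.+1%:R + a1 + a2) / 2)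
    ((b1 + l.+1%:R) / 2) ((n.+1%:R + b1 + b2) / 2).
Proof.
move=> p1 r1; have p0 : 0 < p by exact: lt_le_trans p1.
have r0 : 0 < r by exact: lt_le_trans r1.
have [CS CS0 HS] := normS_log; have [CX [CT [CX0 CT0 HX]]] := normXi_log.
set ka := k.+1%:R / 2; set al := (a1 + _) / 2; set sa := (_ + a2) / 2.
set be := (b1 + _) / 2; set sb := (_ + b2) / 2.
have mw := @measurable_wgt be sb; have mw' := @measurable_wgt al sa.
have w0 a s z : (0 <= (wgt a s z)%:E)%E by rewrite lee_fin expR_ge0.
have IA0 (Phi : R -> R) : (0 <= \int[mu]_z (wgt al sa z * powR (Phi z) p)%:E)%E.
  by apply: integral_ge0 => z _; rewrite lee_fin mulr_ge0 ?expR_ge0 ?powR_ge0.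
have IB0 (T : R -> \bar R) : (0 <= \int[mu]_x ((wgt be sb x)%:E * T x `^ r))%E.
  by apply: integral_ge0 => z _; rewrite mule_ge0// poweR_ge0.
have ri0 : 0 <= r^-1 by rewrite invr_ge0 ltW.
have pin : p^-1 != 0 by rewrite invr_eq0 gt_eqF.
pose D := powR (CX * powR CT r) r^-1.
have D0 : 0 < D by rewrite powR_gt0// mulr_gt0// powR_gt0.
pose E := powR CS p^-1; have E0 : 0 < E by rewrite powR_gt0.
have scaleT (Phi : R -> R) : measurable_fun setT Phi -> (forall z, 0 <= Phi z) ->
  ((CX%:E * \int[mu]_x ((wgt be sb x)%:E * (CT%:E * Top ka Phi x) `^ r)) `^ r^-1 =
   D%:E * (\int[mu]_x ((wgt be sb x)%:E * Top ka Phi x `^ r)) `^ r^-1)%E.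
  move=> mPhi P0; have mT := measurable_Top ka mPhi P0.
  have T0 x := @Top_ge0 ka Phi x P0.
  have -> : (\int[mu]_x ((wgt be sb x)%:E * (CT%:E * Top ka Phi x) `^ r) =
     (powR CT r)%:E * \int[mu]_x ((wgt be sb x)%:E * Top ka Phi x `^ r))%E.
    rewrite -ge0_integral_scale; first last.
    - exact: powR_ge0.
    - by move=> x; rewrite mule_ge0// poweR_ge0.
    - by mfun.
    by apply: eq_integral => x _; rewrite poweR_scale_int// muleCA.
  rewrite muleA -EFinM poweR_scale_int//.
  by rewrite mulr_gt0// powR_gt0.
split=> -[C HC].
- exists (D^-1 * (C * E)) => Phi mPhi P0 Ilty.
  pose F t := Phi (ln (t ^- 2 - 1)).
  have mF := measurable_radial_profile mPhi.
  have FE z : F (cosr z) = Phi z by exact: radial_profile_cosr.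
  have ppE : pos_part F = Phi.
    by apply/funext => z; rewrite /pos_part FE; apply/max_idPl.
  have ppN : pos_part (fun t => - F t) = fun=> 0.
    by apply/funext => z; rewrite /pos_part FE; apply/max_idPr; rewrite oppr_le0.
  have SE : normS p a1 a2 (fun x : 'rV[R]_n.+1 => F `|x 0 ord_max|) =
      (E%:E * (\int[mu]_z (wgt al sa z * powR (Phi z) p)%:E) `^ p^-1)%E.
    rewrite (HS F p a1 a2 mF) -/al -/sa.
    have -> : (\int[mu]_z (wgt al sa z * powR `|F (cosr z)| p)%:E =
        \int[mu]_z (wgt al sa z * powR (Phi z) p)%:E)%E.
      by apply: eq_integral => z _; rewrite FE ger0_norm.
    exact: (poweR_scale_int _ CS0 (IA0 Phi)).
  have XE : normXi r b1 b2 (radon (k := k.+1) (fun x : 'rV[R]_n.+1 => F `|x 0 ord_max|)) =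
      (D%:E * (\int[mu]_x ((wgt be sb x)%:E * Top ka Phi x `^ r)) `^ r^-1)%E.
    rewrite (HX F r b1 b2 mF) -/be -/sb -/ka -scaleT// ppE ppN.
    congr ((_ * _) `^ _)%E; apply: eq_integral => x _.
    have -> : Top ka (fun=> 0) x = 0%E.
      by rewrite /Top; under eq_integral do rewrite mulr0; rewrite integral0.
    rewrite mule0 sube0 gee0_abs// mule_ge0 ?lee_fin ?(ltW CT0)//.
    exact: Top_ge0.
  have := HC F mF; rewrite /= SE XE => /(_ _) H.
  rewrite -[leLHS]mul1e -(mulVf (lt0r_neq0 D0)) EFinM -muleA EFinM -muleA.
  rewrite lee_pmul2l ?lte_fin ?invr_gt0// EFinM -muleA; apply: H.
  by rewrite lte_mul_pinfty ?lee_fin ?(ltW E0)// poweR_lty.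
(* The absolute value is taken because [C] may be negative. *)
- exists (D * (`|C| * E^-1)) => F mF /=.
  pose Phi (z : R) : R := `|F (cosr z)|.
  have mPhi : measurable_fun setT Phi.
    apply: (measurable_fun_ext (g := fun z => `|F01 F (cosr z)|)).
      by move=> z; rewrite F01_cosr.
    apply: (measurableT_comp (@normr_measurable R setT)).
    exact: (measurableT_comp (measurable_F01 mF) measurable_cosr).
  have P0 z : 0 <= Phi z by exact: normr_ge0.
  have mFN : measurable_fun (`[0, 1] : set R) (fun t => - F t) by exact: measurable_funN.
  have m1 := measurable_pos_part mF; have m2 := measurable_pos_part mFN.
  have SE : normS p a1 a2 (fun x : 'rV[R]_n.+1 => F `|x 0 ord_max|) =
      (E%:E * (\int[mu]_z (wgt al sa z * powR (Phi z) p)%:E) `^ p^-1)%E.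
    by rewrite (HS F p a1 a2 mF) -/al -/sa poweR_scale_int.
  rewrite SE => Slty.
  have Ilty : (\int[mu]_z (wgt al sa z * powR (Phi z) p)%:E < +oo)%E.
    apply: (lty_poweRy pin); rewrite ltNge leye_eq; apply/negP => /eqP Iy.
    by move: Slty; rewrite Iy gt0_muley ?lte_fin// ltxx.
  have TE x : (CT%:E * Top ka Phi x = CT%:E * Top ka (pos_part F) x
      + CT%:E * Top ka (pos_part (fun t => - F t)%R) x)%E.
    rewrite -ge0_muleDr ?Top_ge0//; [|exact: pos_part_ge0..].
    congr (_ * _)%E; rewrite /Top -ge0_integral_add.
    - apply: eq_integral => z _; rewrite -EFinD -mulrDr; congr (_ * _)%:E.
      exact: norm_max0.
    - by apply: measurable_fun_EFin; apply: measurable_funM => //; apply: measurable_ekern; mfun.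
    - by apply: measurable_fun_EFin; apply: measurable_funM => //; apply: measurable_ekern; mfun.
    - by move=> z; rewrite lee_fin mulr_ge0 ?ekern_ge0 ?pos_part_ge0.
    - by move=> z; rewrite lee_fin mulr_ge0 ?ekern_ge0 ?pos_part_ge0.
  rewrite (HX F r b1 b2 mF) -/be -/sb -/ka.
  apply: (@le_trans _ _ ((CX%:E * \int[mu]_x ((wgt be sb x)%:E *
      (CT%:E * Top ka Phi x) `^ r)) `^ r^-1)%E).
    apply: gt0_ler_poweR => //.
    + by rewrite in_itv/= leey andbT mule_ge0 ?lee_fin ?(ltW CX0)// IB0.
    + by rewrite in_itv/= leey andbT mule_ge0 ?lee_fin ?(ltW CX0)// IB0.
    apply: lee_wpmul2l; first by rewrite lee_fin ltW.
    apply: ge0_integral_le => x; first by rewrite mule_ge0// poweR_ge0.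
    apply: lee_wpmul2l => //; apply: gt0_ler_poweR; first exact: ltW.
    + by rewrite in_itv/= leey andbT.
    + by rewrite in_itv/= leey andbT mule_ge0 ?lee_fin ?(ltW CT0)// Top_ge0.
    rewrite TE; apply: (le_trans (lee_abs_sub _ _)).
    rewrite !gee0_abs// mule_ge0 ?lee_fin ?(ltW CT0)// Top_ge0//; exact: pos_part_ge0.
  rewrite scaleT//; apply: (@le_trans _ _ (D%:E * (`|C|%:E *
      (\int[mu]_z (wgt al sa z * powR (Phi z) p)%:E) `^ p^-1))%E).
    apply: lee_wpmul2l; first by rewrite lee_fin ltW.
    apply: (le_trans (HC Phi mPhi P0 Ilty)).
    by apply: lee_wpmul2r; rewrite ?poweR_ge0// lee_fin ler_norm.
  move: ((\int[mu]_z (wgt al sa z * powR (Phi z) p)%:E) `^ p^-1)%E => X.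
  rewrite !muleA -!EFinM (_ : D * (`|C| / E) * E = D * `|C|)//.
  by field; rewrite gt_eqF.
Qed.

End Norms.
End Reduction.

(** * A Hardy-Littlewood-Sobolev inequality *)

Section HLS.
Context (R : realType).
Notation mu := (@lebesgue_measure R).

(** The level lam = (Q/M)^(1/s) makes both terms of the hypothesis equal, with sum 2 lam M. For Q =
    0 the level tends to 0; for Q infinite the right-hand side is infinite. *)
Lemma poweR_opt (h Q : \bar R) (M s : R) : 0 < M -> 1 <= s ->
  (0 <= h)%E -> (0 <= Q)%E ->
  (forall lam, 0 < lam -> (h <= (lam * M)%:E + (powR lam (1 - s))%:E * Q)%E) ->
  (h `^ s <= (powR 2 s * powR M (s - 1))%:E * Q)%E.
Proof.
move=> M0 s1 h0 Q0 H; have s0 : 0 < s by exact: lt_le_trans s1.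
have C0 : 0 < powR 2 s * powR M (s - 1) by rewrite mulr_gt0// powR_gt0.
case: Q Q0 H => [q| |]// q0 H; last by rewrite gt0_muley ?lte_fin// leey.
rewrite lee_fin in q0; have [q00|qn0] := eqVneq q 0.
  have -> : h = 0%E.
    apply/eqP; rewrite eq_le h0 andbT; apply/lee_addgt0Pr => e e0; rewrite add0e.
    have := H (e / M); rewrite q00 mule0 adde0 divfK ?gt_eqF//; apply.
    exact: divr_gt0.
  by rewrite poweR0r ?gt_eqF// q00 mule0.
have qp : 0 < q by rewrite lt_neqAle eq_sym qn0.
have qM : 0 < q / M by exact: divr_gt0.
pose lam := powR (q / M) s^-1.
have lam0 : 0 < lam by exact: powR_gt0.
have E1 : powR lam (1 - s) * q = lam * M.
  have -> : powR lam (1 - s) = lam / powR lam s.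
    by rewrite powRB ?powRr1 ?(ltW lam0)//; apply/implyP => _; rewrite gt_eqF.
  have -> : powR lam s = q / M.
    by rewrite -powRrM mulVf ?gt_eqF// powRr1 // ltW.
  by field; rewrite !gt_eqF.
have hle : (h <= (2 * (lam * M))%:E)%E.
  by apply: (le_trans (H lam lam0)); rewrite -EFinM -EFinD lee_fin E1; lra.
apply: (@le_trans _ _ ((2 * (lam * M))%:E `^ s)%E).
  by apply: gt0_ler_poweR; rewrite ?(ltW s0)// in_itv/= leey andbT// lee_fin !mulr_ge0 ?ltW.
rewrite poweR_EFin -EFinM lee_fin !powRM ?mulr_ge0 ?(ltW lam0) ?(ltW M0)//.
rewrite -mulrA ler_pM2l ?powR_gt0// -[powR lam s]powRrM mulVf ?gt_eqF// powRr1 ?(ltW qM)//.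
rewrite powRB; last by apply/implyP => _; rewrite gt_eqF.
rewrite powRr1 ?(ltW M0)// le_eqVlt; apply/orP; left; apply/eqP.
by field; rewrite gt_eqF.
Qed.

(** For t > lam, write t = t^s t^(1-s) and use t^(1-s) <= lam^(1-s). *)
Lemma le_powR_split (t lam s : R) : 0 < lam -> 0 <= t -> 1 <= s ->
  t <= lam + powR lam (1 - s) * powR t s.
Proof.
move=> l0 t0 s1; have [tl|lt] := leP t lam.
  by rewrite (le_trans tl)// lerDl mulr_ge0// powR_ge0.
have tp : 0 < t by exact: lt_trans lt.
have s0 : 0 < s by exact: lt_le_trans s1.
suff H : t <= powR lam (1 - s) * powR t s by lra.
rewrite -(@mulr_powRB1 _ t s)// mulrCA ler_peMr// -(opprB s) powRN mulrC.
rewrite ler_pdivlMr ?powR_gt0// mul1r; apply: ge0_ler_powR; rewrite ?nnegrE//.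
- by rewrite subr_ge0.
- exact: ltW.
- exact: ltW.
Qed.

(** Jensen's inequality for the measure h2 dx of mass at most [M], with a loss of 2^s: the splitting
    of [h1] at a level is integrated and the level optimized. *)
Lemma weak_jensen (h1 h2 : R -> R) (M s : R) : measurable_fun setT h1 ->
  measurable_fun setT h2 -> (forall x, 0 <= h1 x) -> (forall x, 0 <= h2 x) ->
  0 < M -> 1 <= s -> (\int[mu]_x (h2 x)%:E <= M%:E)%E ->
  ((\int[mu]_x (h1 x * h2 x)%:E) `^ s <=
   (powR 2 s * powR M (s - 1))%:E * \int[mu]_x (powR (h1 x) s * h2 x)%:E)%E.
Proof.
move=> m1 m2 h10 h20 M0 s1 H; apply: poweR_opt => //.
- by apply: integral_ge0 => x _; rewrite lee_fin mulr_ge0.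
- by apply: integral_ge0 => x _; rewrite lee_fin mulr_ge0// powR_ge0.
move=> lam l0; have lp := powR_ge0 lam (1 - s).
apply: (@le_trans _ _ (\int[mu]_x (lam%:E * (h2 x)%:E +
   (powR lam (1 - s))%:E * (powR (h1 x) s * h2 x)%:E))%E).
  apply: ge0_integral_le => x; first by rewrite lee_fin mulr_ge0.
  rewrite -!EFinM -EFinD lee_fin mulrA -mulrDl ler_wpM2r//.
  exact: le_powR_split.
rewrite ge0_integral_add; [|by mfun|by mfun| |]; last 2 first.
- by move=> x; rewrite mule_ge0// lee_fin ?(ltW l0).
- by move=> x; rewrite mule_ge0// lee_fin// mulr_ge0// powR_ge0.
rewrite ge0_integral_scale; [|by mfun|by move=> x; rewrite lee_fin|exact: ltW].
rewrite ge0_integral_scale; [|by mfun| |exact: lp]; last first.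
  by move=> x; rewrite lee_fin mulr_ge0// powR_ge0.
by apply: leeD2r; rewrite EFinM lee_wpmul2l// lee_fin ltW.
Qed.

Lemma powRE (x a : R) : 0 < x -> powR x a = expR (a * ln x).
Proof. by move=> x0; rewrite /powR gt_eqF. Qed.

Lemma integral_powR_near (c d : R) : 0 < c -> 0 < d ->
  (\int[mu]_t (if (0 < t) && (t <= d) then powR t (c - 1) else 0)%:E)%E =
  (powR d c / c)%:E.
Proof.
move=> c0 d0; pose g (t : R) : \bar R := (if t <= d then powR t (c - 1) else 0)%:E.
transitivity (\int[mu]_t (if (0 < t)%R then g t else 0))%E.
  by apply: eq_integral => t _; rewrite /g; case: (0 < t).
rewrite -ge0_integral_exp; last 2 first.
- by rewrite /g; mfun.
- by move=> t; rewrite lee_fin; case: ifP => // _; exact: powR_ge0.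
rewrite powRE// -integral_expR_le//; apply: eq_integral => x _.
rewrite /g -{1}(lnK d0) ler_expR; case: ifP => _; last by rewrite mule0.
by rewrite powRE ?expR_gt0// expRK -EFinM -expRD; congr (expR _)%:E; ring.
Qed.

Lemma integral_powR_tail (c d : R) : 0 < c -> 0 < d ->
  (\int[mu]_t (if d < t then powR t (- c - 1) else 0)%:E)%E =
  (powR d (- c) / c)%:E.
Proof.
move=> c0 d0; pose g (t : R) : \bar R := (if d < t then powR t (- c - 1) else 0)%:E.
transitivity (\int[mu]_t (if (0 < t)%R then g t else 0))%E.
  apply: eq_integral => t _; rewrite /g; case: ifPn => [dt|_].
    by rewrite (lt_trans d0 dt).
  by case: ifP.
rewrite -ge0_integral_exp; last 2 first.
- by rewrite /g; mfun.
- by move=> t; rewrite lee_fin; case: ifP => // _; exact: powR_ge0.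
rewrite powRE// -integral_expR_gt//; apply: eq_integral => x _.
rewrite /g -{1}(lnK d0) ltr_expR; case: ifP => _; last by rewrite mule0.
by rewrite powRE ?expR_gt0// expRK -EFinM -expRD; congr (expR _)%:E; ring.
Qed.

Lemma integral_translate (f : R -> \bar R) (v : R) : measurable_fun setT f ->
  (forall x, 0 <= f x)%E -> (\int[mu]_z f (z - v)%R = \int[mu]_x f x)%E.
Proof. by move=> mf f0; rewrite -(ge0_integral_shift (- v) mf f0). Qed.

Lemma integral_reflect (f : R -> \bar R) (z : R) : measurable_fun setT f ->
  (forall x, 0 <= f x)%E -> (\int[mu]_v f (z - v)%R = \int[mu]_x f x)%E.
Proof.
move=> mf f0; have n1 : (-1 : R) != 0 by rewrite oppr_eq0 oner_eq0.
have := @ge0_integral_affine R f (-1) z mf f0 n1.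
rewrite normrN1 invr1 mul1e => <-.
by apply: eq_integral => v _; rewrite mulN1r addrC.
Qed.

Lemma powR_le (a x y : R) : 0 <= a -> 0 <= x -> x <= y -> powR x a <= powR y a.
Proof.
by move=> a0 x0 xy; apply: ge0_ler_powR; rewrite ?nnegrE// (le_trans x0).
Qed.

(** The one-sided Riesz (Riemann-Liouville) kernel of order [th], without its Gamma factor. *)
Definition riesz (th t : R) : R := if 0 < t then powR t (th - 1) else 0.

Lemma riesz_ge0 th t : 0 <= riesz th t.
Proof. by rewrite /riesz; case: ifP => // _; exact: powR_ge0. Qed.

Lemma measurable_riesz th : measurable_fun setT (riesz th).
Proof. by rewrite /riesz; mfun. Qed.

(* Splitting according to the size of [Bm v z = min (z-v)^(-1/r) f(z)^(p/r)]
   against a threshold [lam] gives [h v <= C1 lam + lam^(1-r) Q v], hence the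
   pointwise bound [h^r <= C Q], which integrates in [v] by Tonelli. *)
Lemma hls (p r : R) : 1 < p -> p < r -> exists2 C : R, 0 <= C &
  forall f : R -> R, measurable_fun setT f -> (forall x, 0 <= f x) ->
  (\int[mu]_z (powR (f z) p)%:E <= 1)%E ->
  (\int[mu]_v ((\int[mu]_z (riesz (p^-1 - r^-1) (z - v) * f z)%:E) `^ r) <= C%:E)%E.
Proof.
move=> p1 pr; set th := p^-1 - r^-1.
have p0 : 0 < p by exact: lt_trans p1.
have r0 : 0 < r by exact: lt_trans pr.
have r1 : 1 < r by exact: lt_trans pr.
have pn : p != 0 by rewrite gt_eqF.
have rn : r != 0 by rewrite gt_eqF.
have p1n : p - 1 != 0 by rewrite gt_eqF// subr_gt0.
have th0 : 0 < th by rewrite subr_gt0 ltf_pV2.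
(* The exponent conjugate to p, for Young's inequality on the far part. *)
pose q := p / (p - 1).
have q0 : 0 < q by rewrite divr_gt0// subr_gt0.
have qn : q != 0 by rewrite gt_eqF.
have qr0 : 0 < q / r by exact: divr_gt0.
have p10 : 0 < 1 - p^-1 by rewrite subr_gt0 invf_lt1.
(* The summands come from the tail of the q-th power of the kernel, the integral of f^p, and the
   kernel near 0. *)
pose C1 := r / q + 1 + th^-1.
have C10 : 0 < C1 by rewrite !addr_gt0 ?invr_gt0// divr_gt0.
pose C2 := th^-1 + (1 - p^-1)^-1.
have C20 : 0 <= C2 by rewrite addr_ge0 ?invr_ge0 ?ltW.
pose C3 := powR 2 r * powR C1 (r - 1).
have C30 : 0 <= C3 by rewrite mulr_ge0 ?powR_ge0.
exists (C3 * C2); first by rewrite mulr_ge0.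
move=> f mf f0 f1.
have mrz := measurable_riesz th.
pose Bm (v z : R) := Num.min (powR (z - v) (- r^-1)) (powR (f z) (p / r)).
have Bm0 v z : 0 <= Bm v z by rewrite /Bm le_min !powR_ge0.
pose qk (v z : R) := riesz th (z - v) * f z * powR (Bm v z) (r - 1).
have qk0 v z : 0 <= qk v z by rewrite !mulr_ge0// ?riesz_ge0 ?powR_ge0.
have mqk : measurable_fun setT (fun w : R * R => qk w.1 w.2).
  apply: measurable_funM; first by mfun.
  apply: (measurableT_comp (@measurable_powR R _)); apply: measurable_minr; by mfun.
have mqkv v : measurable_fun setT (qk v).
  apply: measurable_funM; first by mfun.
  apply: (measurableT_comp (@measurable_powR R _)); apply: measurable_minr; by mfun.
have mqkz z : measurable_fun setT (fun v => qk v z).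
  apply: measurable_funM; first by mfun.
  apply: (measurableT_comp (@measurable_powR R _)); apply: measurable_minr; by mfun.
pose Q v := (\int[mu]_z (qk v z)%:E)%E.
have Q0 v : (0 <= Q v)%E by apply: integral_ge0 => z _; rewrite lee_fin.
have pE : p * th = 1 - p / r by rewrite /th; field; rewrite pn rn.
have qE : q * (th - 1) = - (q / r) - 1 by rewrite /th /q; field; rewrite pn rn p1n.
have pointwise v lam : 0 < lam ->
   ((\int[mu]_z (riesz th (z - v) * f z)%:E) <=
    (lam * C1)%:E + (powR lam (1 - r))%:E * Q v)%E.
  move=> l0; have [L lE] : exists L, lam = expR L by exists (ln lam); rewrite lnK.
  (* [d] = lam^(-r) is where (z-v)^(-1/r) crosses the level lam. *)
  pose d := expR (- r * L); have d0 : 0 < d by exact: expR_gt0.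
  pose F1 (t : R) := if d < t then powR t (- (q / r) - 1) else 0.
  pose F2 (t : R) := if (0 < t) && (t <= d) then powR t (th - 1) else 0.
  have F10 t : 0 <= F1 t by rewrite /F1; case: ifP => // _; exact: powR_ge0.
  have F20 t : 0 <= F2 t by rewrite /F2; case: ifP => // _; exact: powR_ge0.
  have mF1 : measurable_fun setT F1 by rewrite /F1; mfun.
  have mF2 : measurable_fun setT F2 by rewrite /F2; mfun.
  pose c1 := powR lam (1 - q); pose c2 := powR lam (r / p).
  pose c3 := powR lam (1 - r).
  have c10 : 0 <= c1 by exact: powR_ge0.
  have c20 : 0 <= c2 by exact: powR_ge0.
  have c30 : 0 <= c3 by exact: powR_ge0.
  (* Where Bm >= lam, the factor (Bm/lam)^(r-1) >= 1 gives the [qk] term. Otherwise the far part t >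
     d is treated by Young's inequality, and for t <= d the minimum must be f^(p/r), so f <=
     lam^(r/p). *)
  have split z : riesz th (z - v) * f z <= c1 * F1 (z - v) + lam * powR (f z) p
      + (c2 * F2 (z - v) + c3 * qk v z).
    rewrite {1}/riesz; case: ifPn => t0; last first.
      by rewrite mul0r !addr_ge0// mulr_ge0// ?powR_ge0// ltW.
    set t := z - v in t0 *.
    have a1 : 0 <= c1 * F1 t by rewrite mulr_ge0.
    have a2 : 0 <= lam * powR (f z) p by rewrite mulr_ge0 ?powR_ge0// ltW.
    have a3 : 0 <= c2 * F2 t by rewrite mulr_ge0.
    have a4 : 0 <= c3 * qk v z by rewrite mulr_ge0.
    have [lB|Bl] := leP lam (Bm v z).
      suff : powR t (th - 1) * f z <= c3 * qk v z by lra.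
      rewrite /qk /riesz -/t t0 mulrCA ler_peMr ?mulr_ge0 ?powR_ge0//.
      rewrite /c3 -(opprB r) powRN mulrC ler_pdivlMr ?powR_gt0// mul1r.
      by apply: powR_le => //; rewrite ?subr_ge0 ltW.
    have [dt|td] := ltP d t.
      suff : powR t (th - 1) * f z <= c1 * F1 t + lam * powR (f z) p by lra.
      have -> : powR t (th - 1) * f z = lam * ((powR t (th - 1) / lam) * f z).
        by field; rewrite gt_eqF.
      have -> : c1 * F1 t = lam * powR (powR t (th - 1) / lam) q.
        rewrite /F1 dt /c1 lE !(@powRE t)// !powR_expR -expRB powR_expR -!expRD.
        congr expR; rewrite mulrBr mulrA qE; ring.
      rewrite -mulrDr ler_wpM2l ?(ltW l0)//.
      have x0 : 0 <= powR t (th - 1) / lam by rewrite divr_ge0 ?powR_ge0// ltW.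
      have pq1 : q^-1 + p^-1 = 1 by rewrite /q; field; rewrite pn p1n.
      apply: (le_trans (@conjugate_powR R _ _ q p x0 (f0 z) q0 p0 pq1)).
      apply: lerD; rewrite ler_pdivrMr// ler_peMr ?powR_ge0//; last exact: ltW.
      by rewrite /q ler_pdivlMr ?subr_gt0// mul1r gerBl.
    suff : powR t (th - 1) * f z <= c2 * F2 t by lra.
    rewrite /F2 t0 td mulrC ler_wpM2r ?powR_ge0//.
    have fl : powR (f z) (p / r) <= lam.
      move: Bl; rewrite /Bm -/t gt_min => /orP[|/ltW//].
      rewrite ltNge => /negP[]; rewrite lE powRE// ler_expR mulNr lerNr.
      rewrite -ler_pdivlMl ?invr_gt0// invrK mulrN -mulNr -ler_expR lnK//.
    have -> : f z = powR (powR (f z) (p / r)) (r / p).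
      rewrite -powRrM (_ : p / r * (r / p) = 1) ?powRr1//.
      by field; rewrite pn rn.
    by apply: powR_le; rewrite ?powR_ge0// ltW// divr_gt0.
  apply: (@le_trans _ _ (\int[mu]_z ((c1%:E * (F1 (z - v))%:E + lam%:E * (powR (f z) p)%:E)
      + (c2%:E * (F2 (z - v))%:E + c3%:E * (qk v z)%:E)))%E).
    apply: ge0_integral_le => z; first by rewrite lee_fin mulr_ge0// riesz_ge0.
    by rewrite -!EFinM -!EFinD lee_fin.
  have g1 z : (0 <= c1%:E * (F1 (z - v))%:E)%E by rewrite mule_ge0 ?lee_fin.
  have g2 z : (0 <= lam%:E * (powR (f z) p)%:E)%E.
    by rewrite mule_ge0 ?lee_fin ?powR_ge0// ltW.
  have g3 z : (0 <= c2%:E * (F2 (z - v))%:E)%E by rewrite mule_ge0 ?lee_fin.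
  have g4 z : (0 <= c3%:E * (qk v z)%:E)%E by rewrite mule_ge0 ?lee_fin.
  have mq := mqkv v.
  rewrite ge0_integral_add; [|by mfun|by mfun| |]; last 2 first.
  - by move=> z; rewrite adde_ge0.
  - by move=> z; rewrite adde_ge0.
  rewrite ge0_integral_add; [|by mfun|by mfun|exact: g1|exact: g2].
  rewrite ge0_integral_add; [|by mfun|by mfun|exact: g3|exact: g4].
  rewrite ge0_integral_scale; [|by mfun|by move=> z; rewrite lee_fin|exact: c10].
  rewrite ge0_integral_scale; [|by mfun|by move=> z; rewrite lee_fin powR_ge0|exact: ltW].
  rewrite ge0_integral_scale; [|by mfun|by move=> z; rewrite lee_fin|exact: c20].
  rewrite ge0_integral_scale; [|by mfun|by move=> z; rewrite lee_fin|exact: c30].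
  rewrite (@integral_translate (fun t => (F1 t)%:E)); [|by mfun|by move=> z; rewrite lee_fin].
  rewrite (@integral_translate (fun t => (F2 t)%:E)); [|by mfun|by move=> z; rewrite lee_fin].
  rewrite integral_powR_tail// integral_powR_near// addeA.
  apply: leeD2r.
  apply: (@le_trans _ _ (c1%:E * (powR d (- (q / r)) / (q / r))%:E + lam%:E * 1
     + c2%:E * (powR d th / th)%:E)%E).
    by apply: leeD2r; apply: leeD2l; apply: lee_wpmul2l => //; rewrite lee_fin ltW.
  rewrite mule1 -!EFinM -!EFinD lee_fin.
  have -> : c1 * (powR d (- (q / r)) / (q / r)) = lam * (r / q).
    rewrite /c1 /d lE !powR_expR mulrA -expRD.
    have -> : (1 - q) * L + - (q / r) * (- r * L) = L by field.
    by field; rewrite rn qn.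
  have -> : c2 * (powR d th / th) = lam * th^-1.
    rewrite /c2 /d lE !powR_expR mulrA -expRD.
    have -> : r / p * L + th * (- r * L) = L by rewrite /th; field; rewrite pn rn.
    by [].
  by rewrite /C1 le_eqVlt; apply/orP; left; apply/eqP; ring.
(* For fixed z the two entries of the minimum cross at z - v = f(z)^(-p). The first is used beyond
   this point and the second before it; both integrals scale like f(z)^p. *)
have inner z : (\int[mu]_v (qk v z)%:E <= C2%:E * (powR (f z) p)%:E)%E.
  have [fz|fn] := eqVneq (f z) 0.
    rewrite [leLHS](_ : _ = 0%E); last first.
      by rewrite /qk; under eq_integral do rewrite fz mulr0 mul0r; rewrite integral0.
    by rewrite mule_ge0 ?lee_fin ?powR_ge0.
  have fp : 0 < f z by rewrite lt_neqAle eq_sym fn f0.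
  have [L fE] : exists L, f z = expR L by exists (ln (f z)); rewrite lnK.
  pose d := expR (- p * L); have d0 : 0 < d by exact: expR_gt0.
  pose F1 (t : R) := if d < t then powR t (- (1 - p^-1) - 1) else 0.
  pose F2 (t : R) := if (0 < t) && (t <= d) then powR t (th - 1) else 0.
  have F10 t : 0 <= F1 t by rewrite /F1; case: ifP => // _; exact: powR_ge0.
  have F20 t : 0 <= F2 t by rewrite /F2; case: ifP => // _; exact: powR_ge0.
  have mF1 : measurable_fun setT F1 by rewrite /F1; mfun.
  have mF2 : measurable_fun setT F2 by rewrite /F2; mfun.
  pose c4 := expR (L * (1 + p / r * (r - 1))).
  have c40 : 0 <= c4 by exact: expR_ge0.
  have split v : qk v z <= f z * F1 (z - v) + c4 * F2 (z - v).
    rewrite /qk /riesz; case: ifPn => t0; last first.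
      by rewrite !mul0r addr_ge0// mulr_ge0.
    set t := z - v in t0 *.
    have a1 : 0 <= f z * F1 t by rewrite mulr_ge0.
    have a3 : 0 <= c4 * F2 t by rewrite mulr_ge0.
    have r10 : 0 <= r - 1 by rewrite subr_ge0 ltW.
    have [dt|td] := ltP d t.
      suff : powR t (th - 1) * f z * powR (Bm v z) (r - 1) <= f z * F1 t by lra.
      rewrite mulrAC mulrC ler_wpM2l//.
      apply: (@le_trans _ _ (powR t (th - 1) * powR (powR t (- r^-1)) (r - 1))).
        rewrite ler_wpM2l ?powR_ge0//; apply: powR_le => //.
        by rewrite /Bm ge_min lexx.
      rewrite /F1 dt !(@powRE t)// powR_expR -expRD ler_expR.
      rewrite le_eqVlt; apply/orP; left; apply/eqP.
      by rewrite /th; field; rewrite pn rn.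
    suff : powR t (th - 1) * f z * powR (Bm v z) (r - 1) <= c4 * F2 t by lra.
    rewrite /F2 t0 td -mulrA mulrC ler_wpM2r ?powR_ge0//.
    apply: (@le_trans _ _ (f z * powR (powR (f z) (p / r)) (r - 1))).
      rewrite ler_wpM2l//; apply: powR_le => //.
      by rewrite /Bm ge_min lexx orbT.
    rewrite fE !powR_expR -expRD ler_expR.
    by rewrite le_eqVlt; apply/orP; left; apply/eqP; ring.
  apply: (@le_trans _ _ (\int[mu]_v ((f z)%:E * (F1 (z - v))%:E + c4%:E * (F2 (z - v))%:E))%E).
    apply: ge0_integral_le => v; first by rewrite lee_fin.
    by rewrite -!EFinM -EFinD lee_fin.
  rewrite ge0_integral_add; [|by mfun|by mfun| |]; last 2 first.
  - by move=> v; rewrite mule_ge0 ?lee_fin.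
  - by move=> v; rewrite mule_ge0 ?lee_fin.
  rewrite ge0_integral_scale; [|by mfun|by move=> v; rewrite lee_fin|exact: f0].
  rewrite ge0_integral_scale; [|by mfun|by move=> v; rewrite lee_fin|exact: c40].
  rewrite (@integral_reflect (fun t => (F1 t)%:E)); [|by mfun|by move=> v; rewrite lee_fin].
  rewrite (@integral_reflect (fun t => (F2 t)%:E)); [|by mfun|by move=> v; rewrite lee_fin].
  rewrite integral_powR_tail// integral_powR_near// -!EFinM -EFinD lee_fin.
  have -> : f z * (powR d (- (1 - p^-1)) / (1 - p^-1)) = powR (f z) p / (1 - p^-1).
    rewrite fE /d !powR_expR mulrA -expRD.
    by have -> : L + - (1 - p^-1) * (- p * L) = p * L by field.
  have -> : c4 * (powR d th / th) = powR (f z) p / th.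
    rewrite fE /c4 /d !powR_expR mulrA -expRD.
    by have -> : L * (1 + p / r * (r - 1)) + th * (- p * L) = p * L
      by rewrite /th; field; rewrite pn rn.
  by rewrite /C2 le_eqVlt; apply/orP; left; apply/eqP; ring.
apply: (@le_trans _ _ (\int[mu]_v (C3%:E * Q v))%E).
  apply: ge0_integral_le => v; first exact: poweR_ge0.
  apply: poweR_opt => //; [exact: ltW| |exact: pointwise].
  by apply: integral_ge0 => z _; rewrite lee_fin mulr_ge0// riesz_ge0.
have mqkE : measurable_fun setT (fun w : R * R => (qk w.1 w.2)%:E).
  exact: measurable_fun_EFin.
rewrite ge0_integral_scale; [| |exact: Q0|exact: C30]; last first.
  by apply: measurable_integral_param => // v z; rewrite lee_fin.
rewrite [(C3 * C2)%:E]EFinM; apply: lee_wpmul2l; first by rewrite lee_fin.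
rewrite ge0_tonelli//.
apply: (@le_trans _ _ (\int[mu]_z (C2%:E * (powR (f z) p)%:E))%E).
  apply: ge0_integral_le => z; last exact: inner.
  by apply: integral_ge0 => v _; rewrite lee_fin.
rewrite ge0_integral_scale; [|by mfun|by move=> z; rewrite lee_fin powR_ge0|exact: C20].
apply: (@le_trans _ _ (C2%:E * 1)%E); last by rewrite mule1.
by apply: lee_wpmul2l; [rewrite lee_fin|exact: f1].
Qed.

End HLS.

(** * Sufficiency *)

Section Sufficiency.
Context (R : realType).
Notation mu := (@lebesgue_measure R).

(** Written with r-th powers and a positive upper bound [N], so that roots and infinite norms do not
    appear; a zero norm is recovered by letting [N] tend to 0. *)
Definition strong_bound (K : R -> R -> R) (p r : R) : Prop := exists2 C : R, 0 <= C &
  forall (f : R -> R) (N : R), measurable_fun setT f -> (forall z, 0 <= f z) -> 0 < N ->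
  (\int[mu]_z (powR (f z) p)%:E <= N%:E)%E ->
  (\int[mu]_v ((\int[mu]_z (K v z * f z)%:E) `^ r) <= (C * powR N (r / p))%:E)%E.

(** [weak_jensen] for the measure K(v, z) dz of mass at most [M], then Tonelli and the bound on the
    other marginal. *)
Lemma schur_bound (K : R -> R -> R) (p M : R) : 1 <= p -> 0 < M ->
  measurable_fun setT (fun w : R * R => K w.1 w.2) ->
  (forall v z, 0 <= K v z) ->
  (forall v, \int[mu]_z (K v z)%:E <= M%:E)%E ->
  (forall z, \int[mu]_v (K v z)%:E <= M%:E)%E -> strong_bound K p p.
Proof.
move=> p1 M0 mK K0 H1 H2; have p0 : 0 < p by exact: lt_le_trans p1.
pose C := powR 2 p * powR M (p - 1); have C0 : 0 <= C by rewrite mulr_ge0 ?powR_ge0.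
exists (C * M) => [|f N mf f0 N0 HN]; first by rewrite mulr_ge0 ?(ltW M0).
have mKv v : measurable_fun setT (K v).
  exact: (measurableT_comp mK (pair1_measurable v)).
have mKz z : measurable_fun setT (fun v => K v z).
  exact: (measurableT_comp mK (pair2_measurable z)).
have q0 v z : 0 <= powR (f z) p * K v z by rewrite mulr_ge0 ?powR_ge0.
have mq : measurable_fun setT (fun w : R * R => (powR (f w.2) p * K w.1 w.2)%:E).
  by apply: measurable_fun_EFin; apply: measurable_funM => //; mfun.
apply: (@le_trans _ _ (\int[mu]_v (C%:E * \int[mu]_z (powR (f z) p * K v z)%:E))%E).
  apply: ge0_integral_le => v; first exact: poweR_ge0.
  under eq_integral do rewrite mulrC.
  exact: weak_jensen.
rewrite ge0_integral_scale; [| | |exact: C0]; last 2 first.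
- by apply: (measurable_integral_param (f := fun v z : R => (powR (f z) p * K v z)%:E)) => // v z; rewrite lee_fin.
- by move=> v; apply: integral_ge0 => z _; rewrite lee_fin.
rewrite divff ?gt_eqF// powRr1 ?(ltW N0)// -mulrA [(C * _)%:E]EFinM.
apply: lee_wpmul2l; first by rewrite lee_fin.
rewrite ge0_tonelli; [|exact: mq|by move=> v z; rewrite lee_fin].
apply: (@le_trans _ _ (\int[mu]_z (M%:E * (powR (f z) p)%:E))%E).
  apply: ge0_integral_le => z; first by apply: integral_ge0 => v _; rewrite lee_fin.
  under eq_integral do rewrite EFinM.
  rewrite ge0_integral_scale; [|by apply: measurable_fun_EFin; exact: mKz| |exact: powR_ge0]; last first.
    by move=> v; rewrite lee_fin.
  by rewrite muleC; apply: lee_wpmul2r; rewrite ?lee_fin ?powR_ge0.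
rewrite ge0_integral_scale; [|by mfun|by move=> z; rewrite lee_fin powR_ge0|exact: ltW].
by rewrite [(M * N)%:E]EFinM; apply: lee_wpmul2l; rewrite ?lee_fin ?(ltW M0).
Qed.

(** Now f dz, of mass at most [N], is the measure in [weak_jensen]; Tonelli then leaves the
    integrals of K^r in [v]. *)
Lemma endpoint_bound (K : R -> R -> R) (r M : R) : 1 <= r -> 0 <= M ->
  measurable_fun setT (fun w : R * R => K w.1 w.2) ->
  (forall v z, 0 <= K v z) ->
  (forall z, \int[mu]_v (powR (K v z) r)%:E <= M%:E)%E -> strong_bound K 1 r.
Proof.
move=> r1 M0 mK K0 H; have r0 : 0 < r by exact: lt_le_trans r1.
pose C := powR 2 r * M; have C0 : 0 <= C by rewrite mulr_ge0 ?powR_ge0.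
exists C => // f N mf f0 N0; under eq_integral do rewrite powRr1//; move=> HN.
have mKv v : measurable_fun setT (K v).
  exact: (measurableT_comp mK (pair1_measurable v)).
have mKz z : measurable_fun setT (fun v => K v z).
  exact: (measurableT_comp mK (pair2_measurable z)).
pose D := powR 2 r * powR N (r - 1); have D0 : 0 <= D by rewrite mulr_ge0 ?powR_ge0.
have q0 v z : 0 <= powR (K v z) r * f z by rewrite mulr_ge0 ?powR_ge0.
have mq : measurable_fun setT (fun w : R * R => (powR (K w.1 w.2) r * f w.2)%:E).
  apply: measurable_fun_EFin; apply: measurable_funM; last by mfun.
  exact: (measurableT_comp (@measurable_powR R r) mK).
apply: (@le_trans _ _ (\int[mu]_v (D%:E * \int[mu]_z (powR (K v z) r * f z)%:E))%E).
  apply: ge0_integral_le => v; first exact: poweR_ge0.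
  exact: weak_jensen.
rewrite ge0_integral_scale; [| | |exact: D0]; last 2 first.
- by apply: (measurable_integral_param (f := fun v z : R => (powR (K v z) r * f z)%:E)) => // v z; rewrite lee_fin.
- by move=> v; apply: integral_ge0 => z _; rewrite lee_fin.
rewrite ge0_tonelli; [|exact: mq|by move=> v z; rewrite lee_fin].
apply: (@le_trans _ _ (D%:E * \int[mu]_z (M%:E * (f z)%:E))%E).
  apply: lee_wpmul2l; first by rewrite lee_fin.
  apply: ge0_integral_le => z; first by apply: integral_ge0 => v _; rewrite lee_fin.
  under eq_integral do rewrite mulrC EFinM.
  rewrite ge0_integral_scale; [| | |exact: f0]; last 2 first.
  - by apply: measurable_fun_EFin; exact: (measurableT_comp (@measurable_powR R r) (mKz z)).
  - by move=> v; rewrite lee_fin powR_ge0.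
  by rewrite muleC; apply: lee_wpmul2r; rewrite ?lee_fin.
rewrite ge0_integral_scale; [|by mfun|by move=> z; rewrite lee_fin|exact: M0].
apply: (@le_trans _ _ (D%:E * (M%:E * N%:E))%E).
  by apply: lee_wpmul2l; [rewrite lee_fin|apply: lee_wpmul2l; rewrite ?lee_fin].
rewrite -!EFinM lee_fin /D /C divr1 -(@mulr_powRB1 _ N r) ?(ltW N0)//.
by rewrite le_eqVlt; apply/orP; left; apply/eqP; ring.
Qed.

Lemma poweR_scale (c : R) (x : \bar R) (r : R) : 0 <= c -> (0 <= x)%E ->
  ((c%:E * x) `^ r = (powR c r)%:E * x `^ r)%E.
Proof. by move=> c0 x0; rewrite poweRM ?lee_fin// poweR_EFin. Qed.

Lemma hls_bound (K : R -> R -> R) (p r B : R) : 1 < p -> p < r -> 0 <= B ->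
  (forall v z, 0 <= K v z) ->
  (forall v z, K v z <= B * riesz (p^-1 - r^-1) (z - v)) -> strong_bound K p r.
Proof.
move=> p1 pr B0 K0 KB; have [C C0 HC] := hls p1 pr.
have p0 : 0 < p by exact: lt_trans p1.
have r0 : 0 < r by exact: lt_trans pr.
have mrz := @measurable_riesz R (p^-1 - r^-1).
exists (powR B r * C) => [|f N mf f0 N0 HN]; first by rewrite mulr_ge0 ?powR_ge0.
pose c := powR N p^-1; have c0 : 0 < c by exact: powR_gt0.
pose g z := c^-1 * f z; have g0 z : 0 <= g z by rewrite mulr_ge0 ?invr_ge0 ?(ltW c0).
have mg : measurable_fun setT g by rewrite /g; mfun.
have cp : powR c p = N by rewrite -powRrM mulVf ?gt_eqF// powRr1 ?(ltW N0).
have g1 : (\int[mu]_z (powR (g z) p)%:E <= 1)%E.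
  have -> : (\int[mu]_z (powR (g z) p)%:E = \int[mu]_z ((N^-1)%:E * (powR (f z) p)%:E))%E.
    apply: eq_integral => z _; rewrite -EFinM; congr (_%:E).
    by rewrite /g powRM ?invr_ge0 ?(ltW c0)// -cp -powR_inv1 ?(ltW c0)// -powRrM mulN1r powRN.
  rewrite ge0_integral_scale; [|by mfun|by move=> z; rewrite lee_fin powR_ge0|]; last first.
    by rewrite invr_ge0 ltW.
  apply: (@le_trans _ _ ((N^-1)%:E * N%:E)%E).
    by apply: lee_wpmul2l; rewrite ?lee_fin ?invr_ge0 ?(ltW N0).
  by rewrite -EFinM mulVf ?gt_eqF.
pose h v := (\int[mu]_z (riesz (p^-1 - r^-1) (z - v) * g z)%:E)%E.
have rg0 v z : 0 <= riesz (p^-1 - r^-1) (z - v) * g z by rewrite mulr_ge0 ?riesz_ge0.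
have h0 v : (0 <= h v)%E by apply: integral_ge0 => z _; rewrite lee_fin.
have mh : measurable_fun setT h.
  apply: (measurable_integral_param (f := fun v z : R => (riesz (p^-1 - r^-1) (z - v) * g z)%:E)).
    by mfun.
  by move=> v z; rewrite lee_fin.
have Bc : 0 <= B * c by rewrite mulr_ge0 ?(ltW c0).
apply: (@le_trans _ _ (\int[mu]_v ((powR (B * c) r)%:E * h v `^ r))%E).
  apply: ge0_integral_le => v; first exact: poweR_ge0.
  rewrite -poweR_scale//; apply: gt0_ler_poweR; first exact: ltW.
  - by rewrite in_itv/= leey andbT; apply: integral_ge0 => z _; rewrite lee_fin mulr_ge0.
  - by rewrite in_itv/= leey andbT mule_ge0 ?lee_fin.
  rewrite /h -ge0_integral_scale; [|by mfun|by move=> z; rewrite lee_fin|exact: Bc].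
  apply: ge0_integral_le => z; first by rewrite lee_fin mulr_ge0.
  rewrite -EFinM lee_fin /g (_ : B * c * _ = B * riesz (p^-1 - r^-1) (z - v) * f z).
    by rewrite ler_wpM2r.
  by field; rewrite gt_eqF.
rewrite ge0_integral_scale; [|by mfun|by move=> v; exact: poweR_ge0|exact: powR_ge0].
apply: (@le_trans _ _ ((powR (B * c) r)%:E * C%:E)%E).
  by apply: lee_wpmul2l; [rewrite lee_fin powR_ge0|exact: HC].
rewrite -EFinM lee_fin powRM ?(ltW c0)// -[powR c r]powRrM [p^-1 * r]mulrC.
by rewrite le_eqVlt; apply/orP; left; apply/eqP; ring.
Qed.

Definition kern (ka p r al sa be sb v z : R) : R :=
  ekern ka v z * expR ((be * v - sb * softplus v) / r)
  * expR (- ((al * z - sa * softplus z) / p)).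

Lemma kern_ge0 ka p r al sa be sb v z : 0 <= kern ka p r al sa be sb v z.
Proof. by rewrite !mulr_ge0 ?ekern_ge0 ?expR_ge0. Qed.

Lemma measurable_kern ka p r al sa be sb :
  measurable_fun setT (fun w : R * R => kern ka p r al sa be sb w.1 w.2).
Proof.
have msp := @measurable_softplus R.
by apply: measurable_funM; [apply: measurable_funM; [apply: measurable_ekern|]|]; mfun.
Qed.

Lemma integral_kern ka p r al sa be sb (f Phi : R -> R) : 0 < p -> 0 < r ->
  measurable_fun setT f -> (forall z, 0 <= f z) ->
  (forall z, Phi z = f z * expR (- ((al * z - sa * softplus z) / p))) ->
  (\int[mu]_z (wgt al sa z * powR (Phi z) p)%:E = \int[mu]_z (powR (f z) p)%:E)%E /\
  (\int[mu]_x ((wgt be sb x)%:E * Top ka Phi x `^ r) =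
    \int[mu]_v ((\int[mu]_z (kern ka p r al sa be sb v z * f z)%:E) `^ r))%E.
Proof.
move=> p0 r0 mf f0 PhiE; have msp := @measurable_softplus R.
have Phi0 z : 0 <= Phi z by rewrite PhiE mulr_ge0 ?expR_ge0.
have mPhi : measurable_fun setT Phi by rewrite (funext PhiE); mfun.
split.
  apply: eq_integral => z _; congr (_%:E).
  rewrite PhiE powRM ?expR_ge0// powR_expR mulrCA /wgt -expRD.
  rewrite (_ : _ + _ = 0) ?expR0 ?mulr1//.
  by field; rewrite gt_eqF.
apply: eq_integral => v _.
have -> : wgt be sb v = powR (expR ((be * v - sb * softplus v) / r)) r.
  by rewrite powR_expR; congr expR; field; rewrite gt_eqF.
rewrite -poweR_scale ?expR_ge0 ?Top_ge0//; congr (_ `^ r)%E.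
rewrite /Top -ge0_integral_scale; last 3 first.
- by apply: measurable_fun_EFin; apply: measurable_funM => //; apply: measurable_ekern; mfun.
- by move=> z; rewrite lee_fin mulr_ge0// ekern_ge0.
- exact: expR_ge0.
by apply: eq_integral => z _; rewrite -EFinM; congr (_%:E); rewrite PhiE /kern; ring.
Qed.

Lemma ineq1D_strong_bound ka p r al sa be sb : 1 <= p -> 1 <= r ->
  strong_bound (kern ka p r al sa be sb) p r -> ineq1D ka p r al sa be sb.
Proof.
move=> p1 r1 [C C0 HC]; have p0 : 0 < p by exact: lt_le_trans p1.
have r0 : 0 < r by exact: lt_le_trans r1.
have msp := @measurable_softplus R.
exists (powR C r^-1) => Phi mPhi Phi0.
pose f z := Phi z * expR ((al * z - sa * softplus z) / p).
have f0 z : 0 <= f z by rewrite mulr_ge0 ?expR_ge0.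
have mf : measurable_fun setT f by rewrite /f; mfun.
have fE z : Phi z = f z * expR (- ((al * z - sa * softplus z) / p)).
  by rewrite /f -mulrA -expRD subrr expR0 mulr1.
have [-> ->] := integral_kern ka be sb p0 r0 mf f0 fE.
move: (HC f); set I := (\int[mu]_z (powR (f z) p)%:E)%E; set X := (\int[mu]_v (_ `^ r))%E => {}HC.
have X0 : (0 <= X)%E by apply: integral_ge0 => v _; exact: poweR_ge0.
have I0 : (0 <= I)%E by apply: integral_ge0 => z _; rewrite lee_fin powR_ge0.
move: I0 HC; case: I => [N| |]// N0 HC _; rewrite lee_fin in N0.
(* For a zero integral the bound (e/(C+1))^(p/r) is inserted; the right-hand side becomes C e/(C+1)
   <= e. *)
have [N00|Nn] := eqVneq N 0.
  have -> : X = 0%E.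
    apply/eqP; rewrite eq_le X0 andbT; apply/lee_addgt0Pr => e e0; rewrite add0e.
    have C1 : 0 < C + 1 by rewrite ltr_wpDl.
    have eC : 0 < e / (C + 1) by exact: divr_gt0.
    apply: (le_trans (HC (powR (e / (C + 1)) (p / r)) mf f0 _ _)).
    - exact: powR_gt0.
    - by rewrite N00 lee_fin powR_ge0.
    rewrite lee_fin -powRrM (_ : p / r * (r / p) = 1); last by field; rewrite !gt_eqF.
    rewrite powRr1 ?(ltW eC)// mulrCA ler_piMr ?(ltW e0)// ler_pdivrMr// mul1r.
    by rewrite lerDl.
  by rewrite poweR0r ?invr_neq0 ?gt_eqF// mule_ge0 ?poweR_ge0// lee_fin powR_ge0.
have Np : 0 < N by rewrite lt_neqAle eq_sym Nn.
have {}HC := HC N mf f0 Np (lexx _).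
apply: (@le_trans _ _ ((C * powR N (r / p))%:E `^ r^-1)%E).
  apply: gt0_ler_poweR => //; first by rewrite invr_ge0 ltW.
  - by rewrite in_itv/= leey andbT.
  - by rewrite in_itv/= leey andbT lee_fin mulr_ge0 ?powR_ge0.
rewrite !poweR_EFin -EFinM lee_fin powRM ?powR_ge0// -[powR (powR N _) _]powRrM.
by rewrite (_ : r / p * r^-1 = p^-1)//; field; rewrite !gt_eqF.
Qed.

End Sufficiency.

(** * Pointwise bounds of the kernel and the resulting strong bounds *)

Section KernelBounds.
Context (R : realType).
Notation mu := (@lebesgue_measure R).

Lemma softplus_le (v z : R) : v <= z -> softplus v <= softplus z.
Proof.
by move=> vz; rewrite -ler_expR !expR_softplus lerD2l ler_expR.
Qed.

Lemma softplus_sub_le (v z : R) : v <= z -> softplus z - softplus v <= z - v.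
Proof.
move=> vz; rewrite lerBlDr -ler_expR expRD !expR_softplus mulrDr mulr1 -expRD subrK.
by rewrite lerD2r -expR0 ler_expR subr_ge0.
Qed.

Lemma softplus_nonpos (z : R) : z <= 0 -> softplus z <= ln 2.
Proof.
move=> z0; rewrite -ler_expR expR_softplus lnK ?posrE// -[leRHS](_ : 1 + 1 = 2)//.
by rewrite lerD2l -expR0 ler_expR.
Qed.

Lemma softplus_nonneg (z : R) : 0 <= z -> softplus z <= z + ln 2.
Proof.
move=> z0; rewrite -ler_expR expR_softplus expRD lnK ?posrE//.
have : 1 <= expR z by rewrite -expR0 ler_expR.
by lra.
Qed.

(** With t = z - v, e^t >= 1 + t gives 1/(1 - e^(-t)) <= 1 + 1/t. As 1 - e^(-t) < 1, the exponent 1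
    - ka may be raised to any [sg] >= 0 above it, which also covers ka >= 1. *)
Lemma expR_ln_sub_le (ka sg v z : R) : 0 <= sg -> 1 - ka <= sg -> v < z ->
  expR ((ka - 1) * ln (1 - expR (v - z))) <= powR (1 + (z - v)^-1) sg.
Proof.
move=> sg0 ksg vz; set t := z - v; have t0 : 0 < t by rewrite subr_gt0.
have t1 : 0 < 1 + t^-1 by rewrite addr_gt0 ?invr_gt0.
have x1 : expR (v - z) < 1 by rewrite -expR0 ltr_expR subr_lt0.
have x0 : 0 < 1 - expR (v - z) by rewrite subr_gt0.
have l0 : ln (1 - expR (v - z)) <= 0.
  by apply: ln_le0; rewrite gerBl expR_ge0.
have l1 : - ln (1 - expR (v - z)) <= ln (1 + t^-1).
  rewrite -lnV ?posrE// ler_ln ?posrE ?invr_gt0// -[leRHS]invrK lef_pV2 ?posrE ?invr_gt0//.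
  have e0 := expR_gt0 (v - z).
  have : expR (v - z) * (1 + t) <= 1.
    rewrite (_ : v - z = - t); last by rewrite opprB.
    rewrite expRN mulrC ler_pdivrMr ?expR_gt0// mul1r; exact: expR_ge1Dx.
  have n1 : 1 + t != 0 by rewrite gt_eqF// addr_gt0.
  have n2 : t + 1 != 0 by rewrite addrC.
  have n3 : t != 0 by rewrite gt_eqF.
  have -> : (1 + t^-1)^-1 = 1 - (1 + t)^-1 by field; rewrite ?n1 ?n2 ?n3.
  move=> H; rewrite lerD2l lerN2 -[leRHS]mul1r ler_pdivlMr// addr_gt0//.
rewrite powRE// ler_expR; set l := ln _ in l0 l1 *.
have h1 : 0 <= (sg - (1 - ka)) * - l by apply: mulr_ge0; lra.
have h2 : 0 <= sg * (ln (1 + t^-1) + l) by apply: mulr_ge0; lra.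
by lra.
Qed.

(** The exponent -s is left as 1 - s - 1 to match the form c - 1 in [integral_powR_near]. *)
Definition near_power (s t : R) : R :=
  if (0 < t) && (t <= 1) then powR t (1 - s - 1) else 0.

Definition decay (c t : R) : R := if 0 < t then expR (- c * t) else 0.

Definition growth (c t : R) : R := if t <= 0 then expR (c * t) else 0.

Lemma near_power_ge0 s t : 0 <= near_power s t.
Proof. by rewrite /near_power; case: ifP => // _; exact: powR_ge0. Qed.

Lemma decay_ge0 c t : 0 <= decay c t.
Proof. by rewrite /decay; case: ifP => // _; exact: expR_ge0. Qed.

Lemma growth_ge0 c t : 0 <= growth c t.
Proof. by rewrite /growth; case: ifP => // _; exact: expR_ge0. Qed.

Lemma measurable_near_power s : measurable_fun setT (near_power s).
Proof. by rewrite /near_power; mfun. Qed.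

Lemma measurable_decay c : measurable_fun setT (decay c).
Proof. by rewrite /decay; mfun. Qed.

Lemma measurable_growth c : measurable_fun setT (growth c).
Proof. by rewrite /growth; mfun. Qed.

Lemma integral_near_power s : s < 1 ->
  (\int[mu]_t (near_power s t)%:E = ((1 - s)^-1)%:E)%E.
Proof.
move=> s1; rewrite /near_power integral_powR_near// ?subr_gt0//.
by rewrite powR1 mul1r.
Qed.

Lemma integral_decay c : 0 < c -> (\int[mu]_t (decay c t)%:E = (c^-1)%:E)%E.
Proof.
by move=> c0; rewrite /decay integral_expR_gt// mulr0 expR0 mul1r.
Qed.

Lemma integral_growth c : 0 < c -> (\int[mu]_t (growth c t)%:E = (c^-1)%:E)%E.
Proof.
by move=> c0; rewrite /growth integral_expR_le// mulr0 expR0 mul1r.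
Qed.

(** For t <= 1 use 1 + 1/t <= 2/t, for t > 1 use 1 + 1/t <= 2; in both cases 2^s <= 2. *)
Lemma powR1D_near_power (s t : R) : 0 <= s -> s <= 1 -> 0 < t ->
  powR (1 + t^-1) s <= 2 * (1 + near_power s t).
Proof.
move=> s0 s1 t0; have ti : 0 < t^-1 by rewrite invr_gt0.
have p2 : powR 2 s <= (2 : R).
  by rewrite -[leRHS]powRr1//; apply: ler_powR => //; lra.
have n0 := near_power_ge0 s t.
have [t1|t1] := leP t 1.
  have : powR (1 + t^-1) s <= 2 * near_power s t.
    apply: (@le_trans _ _ (powR (2 * t^-1) s)).
      apply: powR_le => //; first by rewrite addr_ge0// ltW.
      by rewrite mulr_natl mulr2n lerD2r invf_ge1.
    rewrite powRM// ?(ltW ti)// /near_power t0 t1/=.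
    rewrite -[t^-1]powR_inv1 ?(ltW t0)// -powRrM (_ : -1 * s = 1 - s - 1); last by ring.
    by rewrite ler_wpM2r// powR_ge0.
  by move: n0; lra.
have : powR (1 + t^-1) s <= 2.
  apply: le_trans p2; apply: powR_le => //; first by rewrite addr_ge0// ltW.
  have : t^-1 <= 1 by rewrite invf_le1// ltW.
  by lra.
by lra.
Qed.

Section Sublemmas.
Variables (ka p r al sa be sb sg : R).
Hypotheses (p0 : 0 < p) (r0 : 0 < r) (sg0 : 0 <= sg) (ksg : 1 - ka <= sg).
Local Notation b := (be / r).
Local Notation a := (2^-1 - (sa - al) / p).
Local Notation DD := (ka + be / r - al / p).
Local Notation EE := ((sb - be) / r - (sa - al) / p).
Local Notation K := (kern ka p r al sa be sb).

(** The exponent is regrouped into quantities of known sign: z - v > 0, z - softplus z < 0, softplus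
    v > 0, and the increment of [softplus], which lies between 0 and z - v. *)
Lemma kernE v z : v < z -> K v z = expR ((ka - 1) * ln (1 - expR (v - z))) *
  expR (- b * (z - v) + DD * (z - softplus z) + (b - a) * (softplus z - softplus v)
        - EE * softplus v).
Proof.
move=> vz; rewrite /kern /ekern vz -!expRD; congr expR; ring.
Qed.

(** With t = z - v and Delta the increment of [softplus], the exponent is at most -b (t - Delta) - a
    Delta. The two nonnegative amounts add up to t, so any rate below both a and b is a rate of
    decay in t. *)
Lemma kern_decay c v z : 0 <= DD -> 0 <= EE -> 0 <= c -> c <= a -> c <= b -> v < z ->
  K v z <= powR (1 + (z - v)^-1) sg * expR (- c * (z - v)).
Proof.
move=> D0 E0 c0 ca cb vz; rewrite kernE//; apply: ler_pM; rewrite ?expR_ge0//.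
  exact: expR_ln_sub_le.
rewrite ler_expR; have s1 := softplus_le (ltW vz); have s2 := softplus_sub_le (ltW vz).
have s3 := softplus_gt z; have s4 := softplus_gt0 v.
have h1 : 0 <= DD * (softplus z - z) by apply: mulr_ge0 => //; lra.
have h2 : 0 <= EE * softplus v by apply: mulr_ge0 => //; lra.
have h3 : 0 <= (b - c) * (z - v - (softplus z - softplus v)) by apply: mulr_ge0; lra.
have h4 : 0 <= (a - c) * (softplus z - softplus v) by apply: mulr_ge0; lra.
move: h1 h2 h3 h4; set A := a; set B := b; set D := DD; set E := EE; lra.
Qed.

(** With a = 0 the term -a Delta is lost. Since softplus z is at most max(z, 0) + ln 2, the exponent
    is, up to b ln 2, at most -b (z - v) if z <= 0, b v if v <= 0 < z, and -EE v if v > 0. *)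
Lemma kern_endpoint c v z : 0 <= DD -> a = 0 -> 0 <= c -> c <= EE -> c <= b -> v < z ->
  K v z <= powR (1 + (z - v)^-1) sg *
    (expR (b * ln 2) * (expR (- c * (z - v)) + decay c v + growth c v)).
Proof.
move=> D0 a0 c0 ca cb vz; rewrite kernE//; apply: ler_pM; rewrite ?expR_ge0//.
  exact: expR_ln_sub_le.
have s3 := softplus_gt z; have s4 := softplus_gt0 v; have s5 := softplus_gt v.
have h1 : 0 <= DD * (softplus z - z) by apply: mulr_ge0 => //; lra.
have d0 := decay_ge0 c v; have g0 := growth_ge0 c v; have e0 := expR_ge0 (- c * (z - v)).
have [z0|z0] := leP z 0.
  apply: (@le_trans _ _ (expR (b * ln 2) * expR (- c * (z - v)))); last first.
    by rewrite ler_wpM2l ?expR_ge0//; lra.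
  rewrite -expRD ler_expR a0 subr0.
  have sz := softplus_nonpos z0.
  have h2 : 0 <= EE * softplus v by apply: mulr_ge0 => //; lra.
  have h3 : 0 <= b * (ln 2 - softplus z) by apply: mulr_ge0; lra.
  have h4 : 0 <= (b - c) * (z - v) by apply: mulr_ge0; lra.
  have h5 : 0 <= b * softplus v by apply: mulr_ge0; lra.
  move: h1 h2 h3 h4 h5; set B := b; set D := DD; set E := EE; lra.
have sz := softplus_nonneg (ltW z0).
have h3 : 0 <= b * (z + ln 2 - softplus z) by apply: mulr_ge0; lra.
have [v0|v0] := leP v 0.
  apply: (@le_trans _ _ (expR (b * ln 2) * growth c v)); last first.
    by rewrite ler_wpM2l ?expR_ge0//; lra.
  rewrite /growth v0 -expRD ler_expR a0 subr0.
  have h2 : 0 <= EE * softplus v by apply: mulr_ge0 => //; lra.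
  have h4 : 0 <= (b - c) * - v by apply: mulr_ge0; lra.
  have h5 : 0 <= b * softplus v by apply: mulr_ge0; lra.
  move: h1 h2 h3 h4 h5; set B := b; set D := DD; set E := EE; lra.
apply: (@le_trans _ _ (expR (b * ln 2) * decay c v)); last first.
  by rewrite ler_wpM2l ?expR_ge0//; lra.
rewrite /decay v0 -expRD ler_expR a0 subr0.
have h2 : 0 <= EE * (softplus v - v) by apply: mulr_ge0 => //; lra.
have h4 : 0 <= (EE - c) * v by apply: mulr_ge0; lra.
have h5 : 0 <= b * (softplus v - v) by apply: mulr_ge0; lra.
move: h1 h2 h3 h4 h5; set B := b; set D := DD; set E := EE; lra.
Qed.

Lemma kern_right v z : ~~ (v < z) -> K v z = 0.
Proof. by move=> /negbTE vz; rewrite /kern /ekern vz !mul0r. Qed.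

Lemma kern_near_decay c v z : 0 <= DD -> 0 <= EE -> 0 <= c -> c <= a -> c <= b ->
  sg <= 1 -> K v z <= 2 * (decay c (z - v) + near_power sg (z - v)).
Proof.
move=> D0 E0 c0 ca cb s1; have [vz|/negbTE zv] := boolP (v < z); last first.
  rewrite kern_right ?zv// mulr_ge0// addr_ge0 ?decay_ge0 ?near_power_ge0//.
apply: (le_trans (kern_decay D0 E0 c0 ca cb vz)).
have t0 : 0 < z - v by rewrite subr_gt0.
rewrite /decay t0; have e1 : expR (- c * (z - v)) <= 1.
  by rewrite -expR0 ler_expR mulNr oppr_le0 mulr_ge0// ltW.
have e0 := expR_ge0 (- c * (z - v)); have n0 := near_power_ge0 sg (z - v).
apply: (@le_trans _ _ (2 * (1 + near_power sg (z - v)) * expR (- c * (z - v)))).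
  by rewrite ler_wpM2r// powR1D_near_power.
rewrite -mulrA ler_wpM2l// mulrDl mul1r lerD2l ler_piMr//.
Qed.

(** Raising the exponent to 1 - th and writing 1 + 1/t = (1 + t)/t leaves the factor (1 + t)^(1-th)
    e^(-ct), at most 1 + 1/c because e^(ct) >= 1 + ct. *)
Lemma kern_riesz c th v z : 0 <= DD -> 0 <= EE -> 0 < c -> c <= a -> c <= b ->
  0 <= th -> th < 1 -> sg <= 1 - th -> K v z <= (1 + c^-1) * riesz th (z - v).
Proof.
move=> D0 E0 c0 ca cb th0 th1 s1; have ci : 0 < c^-1 by rewrite invr_gt0.
have [vz|/negbTE zv] := boolP (v < z); last first.
  by rewrite kern_right ?zv// mulr_ge0 ?riesz_ge0// addr_ge0// ltW.
apply: (le_trans (kern_decay D0 E0 (ltW c0) ca cb vz)).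
rewrite /riesz; set t := z - v; have t0 : 0 < t by rewrite subr_gt0.
rewrite t0; have ti : 0 < t^-1 by rewrite invr_gt0.
have t1 : 0 < 1 + t by lra.
have -> : powR t (th - 1) = powR t^-1 (1 - th).
  by rewrite -[t^-1]powR_inv1 ?(ltW t0)// -powRrM; congr powR; ring.
apply: (@le_trans _ _ (powR (1 + t^-1) (1 - th) * expR (- c * t))).
  rewrite ler_wpM2r ?expR_ge0//; apply: ler_powR => //; lra.
have -> : 1 + t^-1 = (1 + t) * t^-1 by field; rewrite gt_eqF.
rewrite powRM ?(ltW t1) ?(ltW ti)// mulrAC ler_wpM2r ?powR_ge0//.
apply: (@le_trans _ _ ((1 + t) * expR (- c * t))).
  rewrite ler_wpM2r ?expR_ge0// -[leRHS]powRr1 ?(ltW t1)//.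
  apply: ler_powR; lra.
rewrite mulNr expRN ler_pdivrMr ?expR_gt0//.
apply: (@le_trans _ _ ((1 + c^-1) * (1 + c * t))); last first.
  by rewrite ler_wpM2l ?expR_ge1Dx//; lra.
have -> : (1 + c^-1) * (1 + c * t) = 1 + t + c^-1 + c * t by field; rewrite gt_eqF.
have : 0 <= c * t by rewrite mulr_ge0 ?ltW.
by lra.
Qed.

(** The kernel is dominated by an integrable function of z - v alone, so both marginals in Schur's
    test are bounded by the same integral. *)
Lemma kern_strong_diag c : 1 <= p -> p = r -> 0 <= DD -> 0 <= EE -> 0 < c -> c <= a -> c <= b ->
  sg < 1 -> strong_bound K p p.
Proof.
move=> p1 pr D0 E0 c0 ca cb s1.
have md := measurable_decay c; have mn := measurable_near_power sg.
have s10 : 0 < 1 - sg by rewrite subr_gt0.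
have ci : 0 < c^-1 by rewrite invr_gt0.
have si : 0 < (1 - sg)^-1 by rewrite invr_gt0.
pose F t := decay c t + near_power sg t.
have F0 t : 0 <= F t by rewrite addr_ge0 ?decay_ge0 ?near_power_ge0.
have mF : measurable_fun setT F by rewrite /F; mfun.
have mFE : measurable_fun setT (fun t => (F t)%:E) by mfun.
have F0E t : (0 <= (F t)%:E)%E by rewrite lee_fin.
have IF : (\int[mu]_t (F t)%:E = (c^-1 + (1 - sg)^-1)%:E)%E.
  rewrite /F; under eq_integral do rewrite EFinD.
  rewrite ge0_integral_add; [|by mfun|by mfun| |]; last 2 first.
  - by move=> t; rewrite lee_fin decay_ge0.
  - by move=> t; rewrite lee_fin near_power_ge0.
  by rewrite integral_decay// integral_near_power.
apply: (@schur_bound _ _ _ (2 * (c^-1 + (1 - sg)^-1))) => //.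
- by rewrite mulr_gt0// addr_gt0.
- exact: measurable_kern.
- by move=> v z; exact: kern_ge0.
- move=> v; apply: (@le_trans _ _ (\int[mu]_z (2%:E * (F (z - v))%:E))%E).
    apply: ge0_integral_le => z; first by rewrite lee_fin kern_ge0.
    by rewrite -EFinM lee_fin kern_near_decay// ltW.
  rewrite ge0_integral_scale; [|by mfun|by move=> z; rewrite lee_fin|by []].
  by rewrite (@integral_translate _ (fun t => (F t)%:E))// IF -EFinM.
- move=> z; apply: (@le_trans _ _ (\int[mu]_v (2%:E * (F (z - v))%:E))%E).
    apply: ge0_integral_le => v; first by rewrite lee_fin kern_ge0.
    by rewrite -EFinM lee_fin kern_near_decay// ltW.
  rewrite ge0_integral_scale; [|by mfun|by move=> v; rewrite lee_fin|by []].
  by rewrite (@integral_reflect _ (fun t => (F t)%:E))// IF -EFinM.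
Qed.

(** The r-th power has the singularity t^(-sg r), integrable since sg r < 1. The bracket is at most
    3, which linearizes its r-th power and removes it where it multiplies the singularity; each
    remaining term has an integral in [v] bounded uniformly in [z]. *)
Lemma kern_strong_endpoint c M : 1 <= r -> 0 < c -> 0 <= M -> sg * r < 1 ->
  (forall v z, v < z -> K v z <= powR (1 + (z - v)^-1) sg *
    (M * (expR (- c * (z - v)) + decay c v + growth c v))) -> strong_bound K 1 r.
Proof.
move=> r1 c0 M0 s1 HK.
have s0 : 0 <= sg * r by rewrite mulr_ge0// ltW.
have md := measurable_decay c; have mg := measurable_growth c.
have mn := measurable_near_power (sg * r).
have s10 : 0 < 1 - sg * r by rewrite subr_gt0.
have ci : 0 < c^-1 by rewrite invr_gt0.
have si : 0 < (1 - sg * r)^-1 by rewrite invr_gt0.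
(* The factor 3^(r-1) comes from S^r <= 3^(r-1) S, the factor 2 from [powR1D_near_power]. *)
pose B := powR M r * (powR 3 (r - 1) * 2).
have B0 : 0 <= B by rewrite !mulr_ge0 ?powR_ge0.
have KB v z : powR (K v z) r <= B * ((decay c (z - v) + decay c v)
    + (growth c v + 3 * near_power (sg * r) (z - v))).
  have d0 := decay_ge0 c v; have g0 := growth_ge0 c v.
  have d1 := decay_ge0 c (z - v); have n0 := near_power_ge0 (sg * r) (z - v).
  have [vz|/negbTE zv] := boolP (v < z); last first.
    by rewrite kern_right ?zv// powR0 ?gt_eqF// mulr_ge0//; lra.
  have t0 : 0 < z - v by rewrite subr_gt0.
  have t1 : 0 <= 1 + (z - v)^-1 by rewrite addr_ge0// invr_ge0 ltW.
  set S := expR (- c * (z - v)) + decay c v + growth c v.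
  have e0 : 0 <= expR (- c * (z - v)) by exact: expR_ge0.
  have e1 : expR (- c * (z - v)) <= 1.
    by rewrite -expR0 ler_expR mulNr oppr_le0 mulr_ge0// ltW.
  have d2 : decay c v <= 1.
    rewrite /decay; case: ifPn => // v0.
    by rewrite -expR0 ler_expR mulNr oppr_le0 mulr_ge0// ltW.
  have g2 : growth c v <= 1.
    rewrite /growth; case: ifPn => // v0.
    by rewrite -expR0 ler_expR mulr_ge0_le0// ltW.
  have S0 : 0 <= S by rewrite /S; lra.
  have S3 : S <= 3 by rewrite /S; lra.
  apply: (le_trans (powR_le (ltW r0) (kern_ge0 _ _ _ _ _ _ _ _ _) (HK v z vz))).
  rewrite -/S !powRM ?powR_ge0 ?mulr_ge0// -[powR (powR _ sg) r]powRrM.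
  have Sr : powR S r <= powR 3 (r - 1) * S.
    rewrite -(@mulr_powRB1 _ S r)// mulrC ler_wpM2r//; apply: powR_le => //.
    by rewrite subr_ge0.
  apply: (@le_trans _ _ (2 * (1 + near_power (sg * r) (z - v)) *
      (powR M r * (powR 3 (r - 1) * S)))).
    apply: ler_pM; rewrite ?powR_ge0 ?mulr_ge0 ?powR_ge0//.
    - by apply: powR1D_near_power => //; exact: ltW.
    - by rewrite ler_wpM2l ?powR_ge0.
  rewrite (_ : 2 * _ * _ = B * ((1 + near_power (sg * r) (z - v)) * S)); last first.
    by rewrite /B; ring.
  rewrite ler_wpM2l//.
  have h : 0 <= near_power (sg * r) (z - v) * (3 - S) by rewrite mulr_ge0//; lra.
  rewrite [decay c (z - v)]/decay t0; move: h; rewrite /S; lra.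
apply: (@endpoint_bound _ _ _ (B * ((c^-1 + c^-1) + (c^-1 + 3 * (1 - sg * r)^-1)))) => //.
- by rewrite mulr_ge0//; lra.
- exact: measurable_kern.
- by move=> v z; exact: kern_ge0.
move=> z.
apply: (@le_trans _ _ (\int[mu]_v (B%:E * (((decay c (z - v))%:E + (decay c v)%:E)
    + ((growth c v)%:E + 3%:E * (near_power (sg * r) (z - v))%:E))))%E).
  apply: ge0_integral_le => v; first by rewrite lee_fin powR_ge0.
  by have := KB v z; rewrite -lee_fin.
have g1 v : (0 <= (decay c (z - v))%:E)%E by rewrite lee_fin decay_ge0.
have g2 v : (0 <= (decay c v)%:E)%E by rewrite lee_fin decay_ge0.
have g3 v : (0 <= (growth c v)%:E)%E by rewrite lee_fin growth_ge0.
have g4' v : (0 <= (near_power (sg * r) (z - v))%:E)%E by rewrite lee_fin near_power_ge0.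
have g4 v : (0 <= 3%:E * (near_power (sg * r) (z - v))%:E)%E by apply: mule_ge0; [rewrite lee_fin|exact: g4'].
rewrite ge0_integral_scale; [|by mfun| |exact: B0]; last first.
  by move=> v; rewrite !adde_ge0.
rewrite ge0_integral_add; [|by mfun|by mfun| |]; last 2 first.
- by move=> v; rewrite adde_ge0.
- by move=> v; rewrite adde_ge0.
rewrite ge0_integral_add; [|by mfun|by mfun|exact: g1|exact: g2].
rewrite ge0_integral_add; [|by mfun|by mfun|exact: g3|exact: g4].
rewrite ge0_integral_scale; [|by mfun|exact: g4'|by []].
rewrite (@integral_reflect _ (fun t => (decay c t)%:E)); [|by mfun|]; last first.
  by move=> t; rewrite lee_fin decay_ge0.
rewrite (@integral_reflect _ (fun t => (near_power (sg * r) t)%:E)); [|by mfun|]; last first.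
  by move=> t; rewrite lee_fin near_power_ge0.
rewrite integral_decay// integral_growth// integral_near_power//; exact: lexx.
Qed.

(** [sg] measures the singularity on the diagonal. The conditional hypotheses say that it is no
    stronger than that of the Riesz kernel of order 1/p - 1/r when p > 1, and that its r-th power is
    integrable when p = 1. *)
Lemma ineq1D_sufficient : 1 <= p -> p <= r -> sg < 1 ->
  (1 < p -> sg <= 1 - (p^-1 - r^-1)) -> (p = 1 -> sg * r < 1) ->
  0 < be -> 0 <= DD -> 0 <= EE -> 0 <= a -> (a = 0 -> p = 1 /\ 0 < EE) ->
  ineq1D ka p r al sa be sb.
Proof.
move=> p1 pr s1 Hp Hp1 be0 D0 E0 a0 Ha.
have r1 : 1 <= r by exact: le_trans pr.
have b0 : 0 < b by rewrite divr_gt0.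
apply: ineq1D_strong_bound => //.
have [az|an] := eqVneq a 0.
  have [pE E1] := Ha az; rewrite [X in strong_bound _ X]pE.
  apply: (@kern_strong_endpoint (Num.min EE b) (expR (b * ln 2))) => //.
  - by rewrite lt_min E1.
  - exact: Hp1.
  move=> v z vz; apply: kern_endpoint => //.
  - by rewrite le_min E0 ltW.
  - by rewrite ge_min lexx.
  - by rewrite ge_min lexx orbT.
have a1 : 0 < a by rewrite lt_neqAle eq_sym an.
pose c := Num.min a b.
have c0 : 0 < c by rewrite lt_min a1.
have ca : c <= a by rewrite ge_min lexx.
have cb : c <= b by rewrite ge_min lexx orbT.
have [pE|pn] := eqVneq p 1.
  rewrite [X in strong_bound _ X]pE.
  apply: (@kern_strong_endpoint c 1) => //; first exact: Hp1.
  move=> v z vz; apply: (le_trans (kern_decay D0 E0 (ltW c0) ca cb vz)).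
  rewrite mul1r ler_wpM2l ?powR_ge0//.
  by have := decay_ge0 c v; have := growth_ge0 c v; lra.
have {}p1 : 1 < p by rewrite lt_neqAle eq_sym pn.
have [prE|prn] := eqVneq p r.
  by rewrite -[X in strong_bound _ _ X]prE; apply: (@kern_strong_diag c) => //; exact: ltW.
have {}pr : p < r by rewrite lt_neqAle prn.
have ip : p^-1 < 1 by rewrite invf_lt1.
have ir : 0 < r^-1 by rewrite invr_gt0.
have irp : r^-1 < p^-1 by rewrite ltf_pV2.
apply: (@hls_bound _ _ _ _ (1 + c^-1)) => //.
- by rewrite addr_ge0// invr_ge0 ltW.
- by move=> v z; exact: kern_ge0.
move=> v z; apply: kern_riesz => //; first by lra.
- by lra.
- exact: Hp.
Qed.

End Sublemmas.
End KernelBounds.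

(** * Necessity *)

Section Necessity.
Context (R : realType).
Notation mu := (@lebesgue_measure R).

Lemma integral_cst_itv (c u w : R) : u <= w -> 0 <= c ->
  (\int[mu]_v (if (u <= v) && (v <= w) then c else 0)%:E = (c * (w - u))%:E)%E.
Proof.
move=> uw c0; transitivity (\int[mu]_v (c%:E * (\1_(`[u, w] : set R) v)%:E))%E; last first.
  rewrite ge0_integral_scale; last 3 first.
  - by apply: measurable_fun_EFin; exact: measurable_indic.
  - by move=> v; rewrite lee_fin.
  - exact: c0.
  have -> : (\int[mu]_x (\1_(`[u, w] : set R) x)%:E = lebesgue_measure (`[u, w]%classic : set R))%E.
    by rewrite integral_indic// setIT.
  rewrite lebesgue_measure_itv/= lte_fin.
  case: ltP => [_|wu]; first by rewrite -EFinB -EFinM.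
  by rewrite mule0 (_ : w - u = 0) ?mulr0//; apply/eqP; rewrite subr_eq0 eq_le wu.
apply: eq_integral => v _; rewrite indicE -EFinM; congr (_%:E).
rewrite (_ : (v \in _) = (u <= v <= w)); last by apply/idP/idP; rewrite inE/= in_itv.
by case: ifP; rewrite ?mulr1 ?mulr0.
Qed.

Section Tests.
Variables (ka p r al sa be sb : R).
Hypotheses (p0 : 0 < p) (r0 : 0 < r).
Local Notation b := (be / r).
Local Notation a := (2^-1 - (sa - al) / p).
Local Notation DD := (ka + be / r - al / p).
Local Notation EE := ((sb - be) / r - (sa - al) / p).
Local Notation K := (kern ka p r al sa be sb).

(** After the weights are absorbed the test function is the indicator of [m, m+1], of norm 1; a
    lower bound of the kernel on a box then limits the length of the box in [v]. *)
Lemma test_bound : ineq1D ka p r al sa be sb -> exists B : R, forall m u w c : R,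
  u <= w -> 0 <= c ->
  (forall v z, u <= v -> v <= w -> m <= z -> z <= m + 1 -> c <= K v z) ->
  (w - u) * powR c r <= B.
Proof.
move=> [C HC]; exists (powR `|C| r) => m u w c uw c0 H.
pose f (z : R) : R := if (m <= z) && (z <= m + 1) then 1 else 0.
have mf : measurable_fun setT f by rewrite /f; mfun.
have f0 z : 0 <= f z by rewrite /f; case: ifP.
have msp := @measurable_softplus R.
pose Phi z := f z * expR (- ((al * z - sa * softplus z) / p)).
have mPhi : measurable_fun setT Phi by rewrite /Phi; mfun.
have Phi0 z : 0 <= Phi z by rewrite mulr_ge0 ?expR_ge0.
have := HC Phi mPhi Phi0.
have PhiE z : Phi z = f z * expR (- ((al * z - sa * softplus z) / p)) by [].
have [-> ->] := integral_kern ka be sb p0 r0 mf f0 PhiE.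
have m1 : m <= m + 1 by rewrite lerDl.
have -> : (\int[mu]_z (powR (f z) p)%:E = 1)%E.
  transitivity (\int[mu]_z (f z)%:E)%E.
    apply: eq_integral => z _; rewrite /f; case: ifP => _; first by rewrite powR1.
    by rewrite powR0// gt_eqF.
  by rewrite integral_cst_itv// mul1r addrAC subrr add0r.
rewrite poweR_EFin powR1 mule1 => /(_ (ltry _)); set X := (\int[mu]_v _)%E => HX.
have X0 : (0 <= X)%E by apply: integral_ge0 => v _; exact: poweR_ge0.
have XB : (X <= (powR `|C| r)%:E)%E.
  have -> : X = ((X `^ r^-1) `^ r)%E by rewrite -poweRrM mulVf ?gt_eqF// poweRe1.
  rewrite -poweR_EFin; apply: gt0_ler_poweR; first exact: ltW.
  - by rewrite in_itv/= leey andbT poweR_ge0.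
  - by rewrite in_itv/= leey andbT lee_fin.
  by apply: (le_trans HX); rewrite lee_fin ler_norm.
rewrite -lee_fin mulrC; apply: le_trans XB.
rewrite -integral_cst_itv ?powR_ge0//; apply: ge0_integral_le => v.
  by rewrite lee_fin; case: ifP => // _; exact: powR_ge0.
case: ifPn => [/andP[uv vw]|_]; last exact: poweR_ge0.
rewrite -poweR_EFin; apply: gt0_ler_poweR; first exact: ltW.
- by rewrite in_itv/= leey andbT lee_fin.
- rewrite in_itv/= leey andbT; apply: integral_ge0 => z _.
  by rewrite lee_fin mulr_ge0// kern_ge0.
apply: (@le_trans _ _ (\int[mu]_z (if (m <= z) && (z <= m + 1) then c else 0)%:E)%E).
  by rewrite integral_cst_itv// addrAC subrr add0r mulr1.
apply: ge0_integral_le => z; first by rewrite lee_fin; case: ifP.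
rewrite lee_fin /f; case: ifPn => [/andP[mz zm]|_]; rewrite ?mulr1 ?mulr0//.
exact: H.
Qed.

(** The largest value of |ln (1 - e^(v-z))| for z - v >= 1. *)
Let L := - ln (1 - expR (-1) : R).

(** Keeping z - v >= 1 avoids the diagonal, so the singular factor costs a bounded amount whatever
    the sign of ka - 1. *)
Lemma kern_lower X v z : v <= z - 1 ->
  X <= - b * (z - v) + DD * (z - softplus z) + (b - a) * (softplus z - softplus v)
        - EE * softplus v ->
  expR (X - `|ka - 1| * L) <= K v z.
Proof.
move=> vz HX; have {}vz1 : v < z by lra.
rewrite kernE// -expRD ler_expR addrC; apply: lerD => //.
have e1 : expR (-1) < 1 :> R by rewrite -expR0 ltr_expR oppr_lt0.
have e2 : expR (v - z) <= expR (-1) by rewrite ler_expR; lra.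
have e3 := expR_gt0 (v - z).
have l1 : ln (1 - expR (v - z)) <= 0 by apply: ln_le0; lra.
have l2 : - L <= ln (1 - expR (v - z)) by rewrite /L opprK ler_ln ?posrE; lra.
rewrite -[leRHS]opprK lerN2; apply: (le_trans (ler_norm _)).
rewrite normrN normrM ler_wpM2l// ler0_norm//; lra.
Qed.

Lemma mulr_lower (x s S : R) : `|s| <= S -> - (`|x| * S) <= x * s.
Proof.
move=> sS; rewrite -[leRHS]opprK lerN2; apply: (le_trans (ler_norm _)).
by rewrite normrN normrM ler_wpM2l.
Qed.

Lemma ler_expR_self (x : R) : x <= expR x.
Proof. by apply: le_trans (expR_ge1Dx x); rewrite lerDr. Qed.

(** For [v] and [z] near [m] the exponent is DD (m - softplus m) - EE softplus m up to a constant.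
    It behaves like DD m as m tends to minus infinity and like -EE m as m tends to plus infinity;
    boundedness above forces both signs. *)
Lemma ineq1D_exponents : ineq1D ka p r al sa be sb -> 0 <= DD /\ 0 <= EE.
Proof.
move=> /test_bound[B HB].
(* For v in [m-2, m-1] and z in [m, m+1] the errors are at most 3, 3, 1 and 2 times the
   coefficients, because [softplus] is increasing with slope at most 1. *)
pose S := `|ka - 1| * L + (`|b| * 3 + `|b - a| * 3 + `|DD| * 1 + `|EE| * 2).
have HG m : DD * (m - softplus m) - EE * softplus m <= B / r + S.
  pose G := DD * (m - softplus m) - EE * softplus m - S.
  have : ((m - 1) - (m - 2)) * powR (expR G) r <= B.
    apply: (HB m); [lra|exact: expR_ge0|] => v z uv vw mz zm.
    rewrite (_ : G = DD * (m - softplus m) - EE * softplus m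
       - (`|b| * 3 + `|b - a| * 3 + `|DD| * 1 + `|EE| * 2) - `|ka - 1| * L); last first.
      by rewrite /G /S; ring.
    apply: kern_lower; first by lra.
    have vz : v <= z by lra.
    have vm : v <= m by lra.
    have s1 := softplus_le vz; have s2 := softplus_sub_le vz.
    have s3 := softplus_le vm; have s4 := softplus_sub_le vm.
    have s5 := softplus_le mz; have s6 := softplus_sub_le mz.
    have h1 : - (`|b| * 3) <= b * - (z - v).
      by apply: mulr_lower; rewrite normrN ger0_norm; lra.
    have h2 : - (`|b - a| * 3) <= (b - a) * (softplus z - softplus v).
      by apply: mulr_lower; rewrite ger0_norm; lra.
    have h3 : - (`|DD| * 1) <= DD * ((z - softplus z) - (m - softplus m)).
      by apply: mulr_lower; rewrite ger0_norm; lra.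
    have h4 : - (`|EE| * 2) <= EE * (softplus m - softplus v).
      by apply: mulr_lower; rewrite ger0_norm; lra.
    move: h1 h2 h3 h4; set D := DD; set E := EE.
    by set b' := b; set a' := a; lra.
  rewrite (_ : m - 1 - (m - 2) = 1) ?mul1r; last by ring.
  (* The crude x <= e^x turns the bound on e^(rG) into one on G without a logarithm of [B]. *)
  rewrite powR_expR => H; have {}H := le_trans (ler_expR_self _) H.
  by move: H; rewrite -ler_pdivlMl// /G; rewrite [r^-1 * _]mulrC; lra.
split; rewrite leNgt; apply/negP => neg.
(* Chosen so that at m = -|T| the term DD m exceeds all the others by at least 1. *)
- pose T := (B / r + S + `|EE| * ln 2 + 1) / - DD.
  pose m := - `|T|; have m0 : m <= 0 by rewrite oppr_le0.
  have := HG m; have s1 := softplus_nonpos m0; have s2 := softplus_gt0 m.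
  have h1 : 0 <= - DD * softplus m by apply: mulr_ge0; lra.
  have h2 : - (`|EE| * ln 2) <= EE * - softplus m.
    by apply: mulr_lower; rewrite normrN ger0_norm; lra.
  have h3 : B / r + S + `|EE| * ln 2 + 1 <= - DD * `|T|.
    rewrite -ler_pdivrMl ?oppr_gt0// mulrC; exact: ler_norm.
  rewrite /m in h1 h2 *; move: h1 h2 h3; set D := DD; set E := EE; lra.
- pose T := (B / r + S + `|DD| * ln 2 + 1) / - EE.
  pose m := `|T|; have m0 : 0 <= m by rewrite /m.
  have := HG m; have s1 := softplus_nonneg m0; have s2 := softplus_gt m.
  have h1 : 0 <= - EE * (softplus m - m) by apply: mulr_ge0; lra.
  have h2 : - (`|DD| * ln 2) <= DD * (m - softplus m).
    by apply: mulr_lower; rewrite ler0_norm; lra.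
  have h3 : B / r + S + `|DD| * ln 2 + 1 <= - EE * `|T|.
    rewrite -ler_pdivrMl ?oppr_gt0// mulrC; exact: ler_norm.
  rewrite -/m in h3; move: h1 h2 h3; set D := DD; set E := EE; lra.
Qed.

Lemma unbounded_length (B c : R) : (forall l, 0 <= l -> l * powR (expR c) r <= B) -> False.
Proof.
move=> H; have e0 : 0 < powR (expR c) r by rewrite powR_gt0// expR_gt0.
have := H ((`|B| + 1) / powR (expR c) r); rewrite divfK ?gt_eqF// => /(_ _) h.
have {}h : `|B| + 1 <= B by apply: h; rewrite divr_ge0 ?ltW// addr_ge0.
by have := ler_norm B; lra.
Qed.

(** As v tends to minus infinity with z in [0, 1], the kernel behaves like e^(-b (z-v)); for b <= 0
    it stays bounded below on arbitrarily long intervals. *)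
Lemma ineq1D_origin : ineq1D ka p r al sa be sb -> 0 < be.
Proof.
move=> /test_bound[B HB]; rewrite ltNge; apply/negP => be0.
have b0 : b <= 0 by rewrite pmulr_lle0// invr_gt0.
pose S := `|DD| * 1 + `|DD| * ln 2 + (`|b - a| * (1 + ln 2) + `|EE| * ln 2).
apply: (@unbounded_length B (- S - `|ka - 1| * L)) => l l0.
have -> : l = (-1) - (-1 - l) by ring.
apply: (HB 0); [lra|exact: expR_ge0|] => v z uv vw z0 z1.
apply: kern_lower; first by lra.
have v0 : v <= 0 by lra.
have vz : v <= z by lra.
have s1 := softplus_nonpos v0; have s2 := softplus_gt0 v.
have s3 := softplus_nonneg z0; have s4 := softplus_gt z; have s5 := softplus_le vz.
have h1 : 0 <= - b * (z - v) by apply: mulr_ge0; lra.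
have h2 : - (`|b - a| * (1 + ln 2)) <= (b - a) * (softplus z - softplus v).
  by apply: mulr_lower; rewrite ger0_norm; lra.
have h3 : - (`|DD| * ln 2) <= DD * (z - softplus z).
  by apply: mulr_lower; rewrite ler0_norm; lra.
have h4 : - (`|EE| * ln 2) <= EE * - softplus v.
  by apply: mulr_lower; rewrite normrN ger0_norm; lra.
have h5 : 0 <= `|DD| by exact: normr_ge0.
rewrite /S; move: h1 h2 h3 h4 h5; set D := DD; set E := EE.
by set b' := b; set a' := a; lra.
Qed.

(** On the positive half-line [softplus] is within ln 2 of the identity. If a and [EE] both vanish,
    the exponent is then bounded below for v in [0, l] and z in [l+1, l+2], uniformly in l. *)
Lemma ineq1D_equator : ineq1D ka p r al sa be sb -> a = 0 -> EE != 0.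
Proof.
move=> /test_bound[B HB] a0; apply/eqP => E0.
pose S := `|DD| * ln 2 + `|b| * ln 2.
apply: (@unbounded_length B (- S - `|ka - 1| * L)) => l l0.
rewrite -[l]subr0.
apply: (HB (l + 1)); [lra|exact: expR_ge0|] => v z v0 vl lz z1.
apply: kern_lower; first by lra.
have z0 : 0 <= z by lra.
have vz : v <= z by lra.
have s1 := softplus_nonneg v0; have s2 := softplus_gt v.
have s3 := softplus_nonneg z0; have s4 := softplus_gt z; have s5 := softplus_sub_le vz.
have h1 : - (`|DD| * ln 2) <= DD * (z - softplus z).
  by apply: mulr_lower; rewrite ler0_norm; lra.
have h2 : - (`|b| * ln 2) <= b * - ((z - v) - (softplus z - softplus v)).
  by apply: mulr_lower; rewrite normrN ger0_norm; lra.
rewrite a0 E0 /S; move: h1 h2; set D := DD; set b' := b; lra.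
Qed.

End Tests.
End Necessity.

(** * Translation of the exponents into (N), and conclusion *)

Lemma radon_ineq_condN (R : realType) (k l : nat) (p r a1 a2 b1 b2 sg : R) :
  1 <= p -> p <= r -> 1 + a2 <= p -> (0 < a2 -> 1 + a2 < p) ->
  0 <= sg -> 1 - k.+1%:R / 2 <= sg -> sg < 1 ->
  (1 < p -> sg <= 1 - (p^-1 - r^-1)) -> (p = 1 -> sg * r < 1) ->
  radon_ineq k.+1 (k.+1 + l.+1) p r a1 a2 b1 b2 <->
  condN k.+1 (k.+1 + l.+1) p r a1 a2 b1 b2.
Proof.
move=> p1 pr pa Hpa sg0 ksg sg1 Hp Hp1.
have r1 : 1 <= r by exact: le_trans pr.
have p0 : 0 < p by exact: lt_le_trans p1.
have r0 : 0 < r by exact: lt_le_trans r1.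
have pn : p != 0 by rewrite gt_eqF.
have rn : r != 0 by rewrite gt_eqF.
apply: (iff_trans (radon_ineq_log k l a1 a2 b1 b2 p1 r1)); rewrite /condN.
have nE : (k.+1 + l.+1)%:R = k.+1%:R + l.+1%:R :> R by rewrite natrD.
have nE1 : (k.+1 + l.+1).+1%:R = k.+1%:R + l.+1%:R + 1 :> R by rewrite -natr1 natrD.
rewrite nE1 nE; move: (k.+1%:R : R) (l.+1%:R : R) ksg => kr lr ksg.
(* [DD] and [EE] are half the gaps in the second and third inequalities of (N), and a vanishes
   exactly when p = 1 + a2. *)
have DE : kr / 2 + (b1 + lr) / 2 / r - (a1 + (kr + lr)) / 2 / p =
   (kr - ((a1 + (kr + lr)) / p - (b1 + (kr + lr) - kr) / r)) / 2.
  by field; rewrite pn rn.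
have EE : ((kr + lr + 1 + b1 + b2) / 2 - (b1 + lr) / 2) / r -
   ((kr + lr + 1 + a1 + a2) / 2 - (a1 + (kr + lr)) / 2) / p =
   ((b2 + kr + 1) / r - (a2 + 1) / p) / 2.
  by field; rewrite pn rn.
have AE : 2^-1 - ((kr + lr + 1 + a1 + a2) / 2 - (a1 + (kr + lr)) / 2) / p =
   (p - (1 + a2)) / p / 2.
  by field; rewrite pn.
split.
- move=> H; have [D0 E0] := ineq1D_exponents p0 r0 H.
  have B0 := ineq1D_origin p0 r0 H; have Q := ineq1D_equator p0 r0 H.
  rewrite DE in D0; rewrite EE in E0 Q; rewrite AE in Q; split; [lra|lra|lra|].
  move=> pE; rewrite -subr_gt0 lt_neqAle; apply/andP; split; last by lra.
  have := Q; rewrite pE subrr !mul0r => /(_ erefl); rewrite mulf_eq0 negb_or eq_sym.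
  by rewrite -pE => /andP[].
- move=> [H1 H2 H3 H4]; apply: (ineq1D_sufficient p0 r0 sg0) => //.
  + by lra.
  + by rewrite DE; lra.
  + by rewrite EE; lra.
  + by rewrite AE !divr_ge0// ?subr_ge0// ltW.
  rewrite AE EE => /eqP; rewrite !mulf_eq0 !invr_eq0 pnatr_eq0 orbF (negbTE pn) orbF subr_eq0.
  move=> /eqP pE; split; last by have := H4 pE; lra.
  (* If p = 1 + a2, then a2 > 0 is excluded by [Hpa], so p <= 1 and hence p = 1. *)
  apply/eqP; rewrite eq_le p1 andbT pE -lerBrDl subrr leNgt; apply/negP => /Hpa.
  by rewrite pE ltxx.
Qed.

Theorem theorem4p8 (R : realType) (n k : nat) (a1 a2 b1 b2 p r : R) :
  (2 <= n)%N -> (1 <= k)%N -> (k <= n.-1)%N ->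
  1 <= p -> 1 + a2 <= p -> (0 < a2 -> 1 + a2 < p) -> p <= r ->
  ((2 <= k)%N -> (radon_ineq k n p r a1 a2 b1 b2 <-> condN k n p r a1 a2 b1 b2))
  /\
  (k = 1%N ->
     (1 < p -> p^-1 - r^-1 <= 2^-1) -> (p = 1 -> r < 2) ->
     (radon_ineq k n p r a1 a2 b1 b2 <-> condN k n p r a1 a2 b1 b2)).
Proof.
move=> n2 k1 kn p1 pa Hpa pr.
have p0 : 0 < p by exact: lt_le_trans p1.
have r0 : 0 < r by exact: lt_le_trans pr.
(* Writing k = k' + 1 and n = k + (l + 1) encodes 1 <= k <= n - 1 in the form used by the
   reduction. *)
have [k' kE] : exists k', k = k'.+1 by exists k.-1; rewrite prednK.
have [l nE] : exists l, n = (k + l.+1)%N.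
  exists (n - k).-1; rewrite prednK ?subnKC//; first by rewrite (leq_trans kn)// leq_pred.
  by rewrite subn_gt0 (leq_ltn_trans kn)// prednK// (leq_trans _ n2).
rewrite nE kE; split=> [k2|[k0]].
(* For k >= 2 the diagonal exponent 1 - k/2 is at most 0, so [sg] = 0 and both conditions on it hold
   automatically. *)
- apply: (@radon_ineq_condN _ _ _ _ _ _ _ _ _ 0) => //.
  + have : 2 <= k'.+1%:R :> R by rewrite ler_nat.
    by lra.
  + have : p^-1 <= 1 by rewrite invf_le1.
    have : 0 < r^-1 by rewrite invr_gt0.
    by lra.
  + by rewrite mul0r.
(* For k = 1 the diagonal exponent is exactly 1/2, and the two conditions on [sg] become the extra
   hypotheses of (B). *)
- rewrite k0 => H1 H2; apply: (@radon_ineq_condN _ _ _ _ _ _ _ _ _ 2^-1) => //.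
  + by lra.
  + by lra.
  + by move=> /H1; lra.
  + by move=> /H2; lra.
Qed.
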